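(* Let $D$ be a positive integer and let $(G_1,G_2,\dots)$ be a sequence of finite graphs with all degrees bounded by $D$ that converges to a graphing $\mathbf{G}$ in the local-global sense. Let $f$ be a real-valued parameter of graphings (finite graphs being regarded as graphings with the uniform probability measure on their vertex set) that is continuous with respect to local convergence. For a graphing $\mathbf{H}=(J,\mu,E)$ define the setfunction $\varphi_{\mathbf{H},f}(F)=f(\mathbf{H}^F)$ on Borel subsets $F\subseteq E$, where $\mathbf{H}^F=(J,\mu,F)$. Then $\varphi_{G_n,f}\rightarrowtail\varphi_{\mathbf{G},f}$.
   Context: A graphing $\mathbf{G}=(J,\mu,E)$ consists of a standard Borel probability space $(J,\mu)$ and a Borel edge set $E\subseteq\binom{J}{2}$ with bounded degrees, such that $\int_A \deg(B,x)\,d\mu(x)=\int_B\deg(A,x)\,d\mu(x)$ for all measurable $A,B\subseteq J$, where $\deg(S,x)$ is the number of edges from $x$ to $S$. Local statistics: for $r\ge1$ and a rooted connected graph $\alpha$ of radius $r$, $P_r(\mathbf{H},\alpha)$ is the probability that the radius-$r$ ball around a random vertex (chosen by the vertex measure) is root-isomorphic to $\alpha$. $\mathbf{H}_n$ converges locally to $\mathbf{H}$ if $P_r(\mathbf{H}_n,\alpha)\to P_r(\mathbf{H},\alpha)$ for all $r,\alpha$; $f$ is continuous with respect to local convergence if $\mathbf{H}_n\to\mathbf{H}$ locally implies $f(\mathbf{H}_n)\to f(\mathbf{H})$. Local-global convergence: for $k,r\ge1$ and a (Borel, for graphings) coloring $c:V\to[k]$, $P_r[\mathbf{H},c]$ is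 the distribution of the isomorphism class of the colored radius-$r$ ball around a random vertex, and $Q_{k,r}(\mathbf{H})=\{P_r[\mathbf{H},c]:c\}$; $G_n\to\mathbf{G}$ local-globally if $Q_{k,r}(G_n)\to Q_{k,r}(\mathbf{G})$ in Hausdorff distance for all $k,r$. Quotient convergence: for a setfunction $\varphi$ on a set-algebra $(X,\mathcal{B})$, a $k$-quotient is $\varphi\circ F^{-1}$ for measurable $F:X\to[k]$, a vector in $\mathbb{R}^{2^k}$ indexed by subsets of $[k]$; $Q_k(\varphi)$ is the set of $k$-quotients; $\varphi_n\rightarrowtail\varphi$ means $Q_k(\varphi_n)\to Q_k(\varphi)$ in Hausdorff distance for every $k$. For finite graphs the set-algebra is all subsets of the edge set; for graphings it is the Borel subsets of the edge set. *)

(* Defs.v *)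
From HB Require Import structures.
From mathcomp Require Import all_boot all_order all_algebra.
From mathcomp Require Import all_classical all_reals all_analysis.
From mathcomp Require Import finmap.

Unset Printing Implicit Defensive.

Import Order.TTheory GRing.Theory Num.Theory.
Import numFieldNormedType.Exports.
Local Open Scope classical_set_scope.
Local Open Scope ring_scope.
Local Open Scope fset_scope.

(* Raw data of a graphing: a measurable space J (with its sigma-algebra),   *)
(* a vertex measure mu and an edge set E.  Edges (unordered pairs {x,y})    *)
(* are encoded as a symmetric irreflexive set of ordered pairs of J * J,    *)
(* measurable for the product sigma-algebra.                                *)
Record pregraphing (R : realType) := PreGraphing {
  pg_disp : measure_display;
  pg_carrier : measurableType pg_disp;
  pg_mu : set pg_carrier -> \bar R;
  pg_E : set (pg_carrier * pg_carrier) }.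
Arguments pg_disp {R} p.
Arguments pg_carrier {R} p.
Arguments pg_mu {R} p _.
Arguments pg_E {R} p _.

Definition with_edges {R : realType} (H : pregraphing R)
  (F : set (pg_carrier H * pg_carrier H)) : pregraphing R :=
  @PreGraphing R (pg_disp H) (pg_carrier H) (pg_mu H) F.

Definition deg {T : choiceType} (E : set (T * T)) (S : set T) (x : T) : nat :=
  #|` fset_set [set y | E (x, y) /\ S y] |.

Definition bounded_degree {T : choiceType} (E : set (T * T)) : Prop :=
  exists D : nat, forall x : T,
    finite_set [set y | E (x, y)] /\ (#|` fset_set [set y | E (x, y)] | <= D)%N.

Definition standard_Borel (R : realType) {d : measure_display}
  (T : measurableType d) : Prop :=
  exists g : T -> R,
    injective g /\ measurable (range g) /\ measurable_fun setT g /\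
    (forall A : set T, measurable A -> measurable (g @` A)).

Definition is_probability_measure {R : realType} {d : measure_display}
  {T : measurableType d} (mu : set T -> \bar R) : Prop :=
  mu set0 = 0%E /\ (forall A, measurable A -> (0 <= mu A)%E) /\
  semi_sigma_additive mu /\ mu setT = 1%E.

Definition is_graphing {R : realType} (H : pregraphing R) : Prop :=
  let mu := pg_mu H in let E := pg_E H in
  standard_Borel R (pg_carrier H) /\
  is_probability_measure mu /\
  measurable E /\
  (forall x y, E (x, y) -> E (y, x)) /\
  (forall x, ~ E (x, x)) /\
  bounded_degree E /\
  (forall A B : set (pg_carrier H), measurable A -> measurable B ->
     (\int[mu]_(x in A) ((deg E B x)%:R)%:E =
      \int[mu]_(x in B) ((deg E A x)%:R)%:E)%E).

Fixpoint within {T : Type} (E : set (T * T)) (r : nat) (x y : T) : Prop :=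
  match r with
  | 0 => x = y
  | r'.+1 => within E r' x y \/ exists z, within E r' x z /\ E (z, y)
  end.

(* A rooted graph, coded on vertex set 'I_(n+1) with root ord0. *)
Record rgraph := RGraph { rg_size : nat; rg_adj : rel 'I_rg_size.+1 }.
Arguments rg_adj : clear implicits.

Record cgraph (k : nat) := CGraph {
  cg_size : nat; cg_adj : rel 'I_cg_size.+1; cg_col : 'I_cg_size.+1 -> 'I_k }.
Arguments cg_adj {k} c.
Arguments cg_col {k} c.

Definition is_rball (r : nat) (a : rgraph) : Prop :=
  symmetric (rg_adj a) /\ irreflexive (rg_adj a) /\
  forall v, within [set p | rg_adj a p.1 p.2] r ord0 v.

Definition ball_iso {T : Type} (E : set (T * T)) (r : nat) (x : T) {n : nat}
  (adj : rel 'I_n.+1) (phi : 'I_n.+1 -> T) : Prop :=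
  injective phi /\ phi ord0 = x /\ range phi = [set y | within E r x y] /\
  (forall i j, adj i j <-> E (phi i, phi j)).

Definition Pr {R : realType} (r : nat) (H : pregraphing R) (a : rgraph) : R :=
  fine (pg_mu H [set x | exists phi, ball_iso (pg_E H) r x (rg_adj a) phi]).

Definition local_conv {R : realType} (Hs : nat -> pregraphing R)
  (H : pregraphing R) : Prop :=
  forall (r : nat) (a : rgraph), (1 <= r)%N -> is_rball r a ->
    (fun n => Pr r (Hs n) a) @ \oo --> Pr r H a.

Definition local_continuous {R : realType} (f : pregraphing R -> R) : Prop :=
  forall (Hs : nat -> pregraphing R) (H : pregraphing R),
    (forall n, is_graphing (Hs n)) -> is_graphing H -> local_conv Hs H ->
    (fun n => f (Hs n)) @ \oo --> f H.

Definition borel_coloring {R : realType} {k : nat} (H : pregraphing R)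
  (c : pg_carrier H -> 'I_k) : Prop :=
  forall i : 'I_k, measurable (c @^-1` [set i]).

Definition Prc {R : realType} {k : nat} (r : nat) (H : pregraphing R)
  (c : pg_carrier H -> 'I_k) (b : cgraph k) : R :=
  fine (pg_mu H [set x | exists phi, ball_iso (pg_E H) r x (cg_adj b) phi /\
                          forall i, c (phi i) = cg_col b i]).

Definition Qkr {R : realType} (k r : nat) (H : pregraphing R)
  : set (cgraph k -> R) :=
  [set p | exists c : pg_carrier H -> 'I_k, borel_coloring H c /\ p = Prc r H c].

Definition hausdorff_conv {R : realType} {I : Type} (A : nat -> set (I -> R))
  (B : set (I -> R)) : Prop :=
  forall eps : R, 0 < eps -> \forall n \near \oo,
    (forall a, A n a -> exists2 b, B b & forall i, `|a i - b i| <= eps) /\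
    (forall b, B b -> exists2 a, A n a & forall i, `|a i - b i| <= eps).

Definition local_global_conv {R : realType} (Hs : nat -> pregraphing R)
  (H : pregraphing R) : Prop :=
  forall k r : nat, (1 <= k)%N -> (1 <= r)%N ->
    hausdorff_conv (fun n => Qkr k r (Hs n)) (Qkr k r H).

(* a measurable map F : E -> [k] (edge-wise, i.e. symmetric on pairs) *)
Definition edge_map {R : realType} {k : nat} (H : pregraphing R)
  (F : pg_carrier H * pg_carrier H -> 'I_k) : Prop :=
  (forall x y, F (x, y) = F (y, x)) /\
  forall i : 'I_k, measurable (pg_E H `&` F @^-1` [set i]).

Definition phi_setfun {R : realType} (f : pregraphing R -> R) (H : pregraphing R)
  (F : set (pg_carrier H * pg_carrier H)) : R := f (with_edges H F).

Definition Qk {R : realType} (k : nat) (f : pregraphing R -> R)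
  (H : pregraphing R) : set ({set 'I_k} -> R) :=
  [set q | exists F, edge_map H F /\
     q = fun S : {set 'I_k} =>
           phi_setfun f H (pg_E H `&` [set e | F e \in S])].

Definition quotient_conv {R : realType} (f : pregraphing R -> R)
  (Hs : nat -> pregraphing R) (H : pregraphing R) : Prop :=
  forall k : nat, (1 <= k)%N -> hausdorff_conv (fun n => Qk k f (Hs n)) (Qk k f H).

Definition fvert (m : nat) : Type := 'I_m.+1.
HB.instance Definition _ m := Choice.on (fvert m).
HB.instance Definition _ m := isPointed.Build (fvert m) (@ord0 m).
HB.instance Definition _ m := @isMeasurable.Build default_measure_display
  (fvert m) discrete_measurable discrete_measurable0 discrete_measurableC
  discrete_measurableU.

Definition fin_graphing (R : realType) {m : nat} (adj : rel 'I_m.+1)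
  : pregraphing R :=
  @PreGraphing R default_measure_display (fvert m)
    (fun A : set (fvert m) => ((#|` fset_set A|)%:R / (m.+1)%:R : R)%:E)
    [set p : fvert m * fvert m | adj p.1 p.2].

(* Main.v *)
From Pilot Require Import Defs.
From HB Require Import structures.
From mathcomp Require Import all_boot all_order all_algebra all_fingroup.
From mathcomp Require Import all_classical all_reals all_analysis.
From mathcomp Require Import finmap measurable_realfun lra.

(* Edge [k]-colourings transfer between [G_n] and [G]: a colouring of the edges
   is encoded by a Borel vertex colouring, using a proper distance colouring on
   [G_n] and finitely many bits of a Borel embedding into the line on [G].  The
   colour classes of two edge colourings related in this way have nearly equal
   ball frequencies up to a large radius.

   It remains to see that nearly equal ball frequencies force nearly equal values
   of [f], uniformly over finite graphs of degree at most [D].  Otherwise there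
   are counterexamples for every radius and precision, and these have a locally
   convergent subsequence whose limit is a graphing; continuity of [f] at that
   limit gives a contradiction.  The limit is built on binary sequences: distance
   colourings decompose the edges into finitely many partial involutions, a vertex
   is coded by the colours seen along words of involutions, and the limiting
   cylinder frequencies define a measure preserved by the involutions, which
   act by shifting codes.

   As the vertex measure of a graphing is unconstrained outside the
   sigma-algebra, ball events have to be shown Borel.  This uses that the edge
   relation, having finite sections, is covered by countably many graphs of Borel
   maps, which follows from the separation of disjoint analytic sets. *)

Set Implicit Arguments.
Unset Strict Implicit.
Import Order.TTheory GRing.Theory Num.Theory.
Import numFieldNormedType.Exports.
(* MathComp has its own [rgraph] and [within]. *)
Import Pilot.Defs.
Local Open Scope classical_set_scope.
Local Open Scope ring_scope.

(** * Analytic sets *)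

(** The two encodings differ because only finitely many colours are allowed. On a finite graph a
    distance-2 colouring names the neighbours of each vertex apart, so each end of an edge can store
    the edge colour under the name of the other end, and decoding is exact. On [G] the names are
    bits of an injection into the reals; balls are finite, so enough bits separate them outside a
    set of small measure, and this set is the only loss. Continuity of [f] is sequential and speaks
    only of limits that are genuine graphings, which is why a limit has to be built rather than a
    mere limit of statistics. Colourings of every radius are kept in the codes: whether two words of
    moves reach the same vertex is then decided by finitely many bits, so ball types are locally
    constant on codes and survive the limit. Mass transport is obtained in two ways. For a union of
    measure-preserving involutions it holds term by term; for Borel subgraphs it follows because the
    degree integral is a finite measure on edges, determined by its values on rectangles. *)

Fixpoint branch (a : nat -> nat) n : seq nat :=
  if n is n'.+1 then a n' :: branch a n' else [::].

Lemma size_branch a n : size (branch a n) = n.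
Proof. by elim: n => //= n ->. Qed.

(** [branch] lists the latest entry first, so refining a cell is [::] and the very first choice sits
    at the end, where this isolates it. *)
Lemma branchS a n :
  branch a n.+1 = rcons (branch (fun m => a m.+1) n) (a 0%N).
Proof. by elim: n => //= n IHn; rewrite -IHn. Qed.

(* A Suslin scheme whose cells shrink, along every branch with nonempty cells,
   to a point of [A]: this is a continuous image of a closed subset of Baire
   space, without mentioning Baire space. *)
Definition analytic {X : topologicalType} (A : set X) : Prop :=
  exists C : seq nat -> set X,
  [/\ C [::] = A,
      forall s, C s `<=` \bigcup_i C (i :: s),
      forall s i, C (i :: s) `<=` C s &
      forall a, (forall n, C (branch a n) !=set0) ->
        exists2 x, A x & forall U, nbhs x U -> exists n, C (branch a n) `<=` U].

Section analytic_topological.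
Variable X : topologicalType.
Implicit Types A B : set X.

Lemma branch_decr (C : seq nat -> set X) a m n :
  (forall s i, C (i :: s) `<=` C s) -> (m <= n)%N ->
  C (branch a n) `<=` C (branch a m).
Proof.
move=> Cd; elim: n => [|n IHn]; first by rewrite leqn0 => /eqP ->.
rewrite leq_eqVlt => /orP[/eqP -> //|]; rewrite ltnS => /IHn; apply: subset_trans.
exact: Cd.
Qed.

(** The first choice, which is the last entry of the list, selects the index [k]; the remaining
    entries run the scheme of [A k]. *)
Lemma analytic_bigcup (A : nat -> set X) :
  (forall k, analytic (A k)) -> analytic (\bigcup_k A k).
Proof.
move=> /choice[C HC].
pose C' s := if rev s is k :: t then C k (rev t) else \bigcup_k A k.
have C'0 k s : C' (rcons s k) = C k s by rewrite /C' rev_rcons revK.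
exists C'; split=> //.
- case/lastP=> [|s k]; last first.
    rewrite C'0 => x; have [_ + _ _] := HC k => /[apply] -[i _ Cx].
    by exists i => //; rewrite -rcons_cons C'0.
  move=> x [k _ Akx]; exists k => //; rewrite -[[:: k]]/(rcons [::] k) C'0.
  by have [-> _ _ _] := HC k.
- case/lastP=> [|s k] i.
    rewrite -[[:: i]]/(rcons [::] i) C'0; have [-> _ _ _] := HC i.
    exact: bigcup_sup.
  by rewrite -rcons_cons !C'0; have [_ _ + _] := HC k; apply.
- move=> a C'n; have [_ _ Cd] := HC (a 0%N).
  move=> /(_ (fun m => a m.+1))[|x Ax Ux].
    by move=> n; have := C'n n.+1; rewrite branchS C'0.
  exists x; first by exists (a 0%N).
  by move=> U /Ux[n nU]; exists n.+1; rewrite branchS C'0.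
Qed.

Lemma analytic0 : analytic (@set0 X).
Proof.
by exists (fun=> set0); split=> // [s x []|s i x []|a /(_ 0%N)[]].
Qed.

Lemma analyticU A B : analytic A -> analytic B -> analytic (A `|` B).
Proof.
move=> aA aB; rewrite -bigcup2E; apply: analytic_bigcup => k; rewrite /bigcup2.
by case: ifP => // _; case: ifP => // _; exact: analytic0.
Qed.

Definition decode_seq (i : nat) : seq nat := odflt [::] (choice.unpickle i).

Lemma decode_seqE (s : seq nat) : exists i, decode_seq i = s.
Proof. by exists (choice.pickle s); rewrite /decode_seq choice.pickleK. Qed.

(* At stage [n] the entry codes one refinement step for each of the first
   [n + 1] schemes. *)
Fixpoint interleave (k : nat) (s : seq nat) : seq nat :=
  if s is i :: s' then
    if (k <= size s')%N then
      nth 0%N (decode_seq i) k :: interleave k s'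
    else interleave k s'
  else [::].

(** The scheme [k] only starts at stage [k], so its entry [m] is read at stage [m + k] and the
    truncated difference [n - k] is its depth. *)
Lemma interleave_branch k a n :
  interleave k (branch a n) =
  branch (fun m => nth 0%N (decode_seq (a (m + k)%N)) k) (n - k).
Proof.
elim: n => //= n IHn; rewrite size_branch IHn.
case: leqP => kn; first by rewrite subSn //= subnK.
by move: kn => /[dup] /ltnW; rewrite -!subn_eq0 -subSS => /eqP -> /eqP ->.
Qed.

(** All schemes run at once, a new one joining at each stage, so that every entry codes finitely
    many steps. A cell of the combined scheme is the intersection of the current cells. *)
Lemma analytic_bigcap (A : nat -> set X) : hausdorff_space X ->
  (forall k, analytic (A k)) -> analytic (\bigcap_k A k).
Proof.
move=> hX /choice[C HC].
have Cd k s i : C k (i :: s) `<=` C k s by have [] := HC k.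
exists (fun s => \bigcap_k C k (interleave k s)); split.
- by apply: eq_bigcapr => k _ /=; have [-> _ _ _] := HC k.
- move=> s x Cx.
  have /choice[u Cu] : forall k, exists i, C k (i :: interleave k s) x.
    by move=> k; have [_ + _ _] := HC k => /(_ _ _ (Cx k I))[i _ ?]; exists i.
  have [i iE] := decode_seqE (mkseq u (size s).+1).
  exists i => // k _ /=; rewrite iE.
  case: leqP => ks; last exact: Cx.
  by rewrite (nth_mkseq 0%N u) ?ltnS.
- move=> s i x Cx k _; have := Cx k I => /=.
  by case: ifP => // _; have [_ _ + _] := HC k; apply.
- move=> a Cn; pose b k m := nth 0%N (decode_seq (a (m + k)%N)) k.
  have bE k n : interleave k (branch a (n + k)) = branch (b k) n.
    by rewrite interleave_branch addnK.
  have /choice[x Hx] : forall k, exists x, A k x /\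
      forall U, nbhs x U -> exists n, C k (branch (b k) n) `<=` U.
    move=> k; have [_ _ _ /(_ (b k))[|x Ax Hx]] := HC k; last by exists x.
    by move=> n; have [y /(_ k I)] := Cn (n + k)%N; rewrite bE; exists y.
  (* A point of a deep combined cell is near the limits of both schemes, so these limits cannot be
     separated. *)
  have xE k : x k = x 0%N.
    apply: hX => U V /(proj2 (Hx k))[n nU] /(proj2 (Hx 0%N))[m mV].
    have [y Cy] := Cn (maxn n m + k)%N.
    exists y; split; [apply: nU | apply: mV].
      have := Cy k I; rewrite bE.
      by apply: (branch_decr (Cd k)); exact: leq_maxl.
    have := Cy 0%N I; rewrite -[(_ + k)%N]addn0 bE.
    apply: (branch_decr (Cd 0%N)).
    by rewrite (leq_trans (leq_maxr n m)) // leq_addr.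
  exists (x 0%N); first by move=> k _; rewrite -(xE k); have [] := Hx k.
  move=> U /(proj2 (Hx 0%N))[n nU]; exists n => y /(_ 0%N I).
  by rewrite -{1}[n]addn0 bE; exact: nU.
Qed.

Lemma analyticI A B : hausdorff_space X ->
  analytic A -> analytic B -> analytic (A `&` B).
Proof.
move=> hX aA aB.
suff -> : A `&` B = \bigcap_k (if k == 0%N then A else B).
  by apply: analytic_bigcap => // k; case: ifP.
apply/seteqP; split=> [x [Ax Bx] k _|x ABx]; first by case: ifP.
by split; [have := ABx 0%N I | have := ABx 1%N I].
Qed.

End analytic_topological.

Lemma analytic_image (X Y : topologicalType) (h : X -> Y) (A : set X) :
  continuous h -> analytic A -> analytic (h @` A).
Proof.
move=> ch [C [C0 Cc Cd Cb]]; exists (fun s => h @` C s); split.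
- by rewrite C0.
- by move=> s _ [x /Cc[i _ Cx] <-]; exists i => //; exists x.
- by move=> s i; exact/image_subset/Cd.
- move=> a Cn; have [|x Ax Hx] := Cb a.
    by move=> n; have [_ [y Cy _]] := Cn n; exists y.
  exists (h x); first by exists x.
  move=> U /ch /Hx[n nU]; exists n => _ [y Cy <-]; exact: nU.
Qed.

Lemma analytic_setX (X Y : topologicalType) (A : set X) (B : set Y) :
  analytic A -> analytic B -> analytic (A `*` B).
Proof.
move=> [C [C0 Cc Cd Cb]] [C' [C'0 C'c C'd C'b]].
pose l i := (odflt (0, 0) (@choice.unpickle (nat * nat)%type i)).1%N.
pose r i := (odflt (0, 0) (@choice.unpickle (nat * nat)%type i)).2%N.
have mapb (u : nat -> nat) a n : map u (branch a n) = branch (u \o a) n.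
  by elim: n => //= n ->.
exists (fun s => C (map l s) `*` C' (map r s)); split.
- by rewrite /= C0 C'0.
- move=> s [x y] [/= /Cc[i _ Cx] /C'c[j _ C'y]].
  by exists (choice.pickle (i, j)) => //; rewrite /setX /= /l /r choice.pickleK.
- by move=> s i [x y] [/= /Cd + /C'd]; split.
- move=> a Cn; have [|x Ax Hx] := Cb (l \o a).
    by move=> n; have [[y z] [/= + _]] := Cn n; rewrite mapb; exists y.
  have [|y By Hy] := C'b (r \o a).
    by move=> n; have [[u z] [/= _ +]] := Cn n; rewrite mapb; exists z.
  exists (x, y) => // U [[V W] [/= /Hx[n nV] /Hy[m mW]] VWU].
  exists (maxn n m) => -[u v] [/= Cu C'v]; apply: VWU; split=> /=.
    by apply/nV/(branch_decr Cd (leq_maxl n m)); rewrite -mapb.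
  by apply/mW/(branch_decr C'd (leq_maxr n m)); rewrite -mapb.
Qed.

(** * Borel and analytic subsets of the line; Lusin separation *)

Section analytic_real.
Variable R : realType.

Let q (i : nat) : R := ratr (odflt 0 (choice.unpickle i)).
Let e (n : nat) : R := n.+1%:R^-1.

Lemma natSinv_lt (d : R) : 0 < d -> exists n : nat, n.+1%:R^-1 < d.
Proof.
move=> d0; near \oo => n; exists n; near: n.
exact: (near_infty_natSinv_lt (PosNum d0)).
Unshelve. all: end_near. Qed.

Let e0 n : 0 < e n. Proof. by rewrite /e invr_gt0 ltr0n. Qed.

(** A refinement step at depth [n] intersects with a closed interval of radius [1 / (n + 1)] around
    a rational; completeness of the line supplies the limit point. *)
Lemma closed_analytic (F : set R) : closed F -> analytic F.
Proof.
move=> cF.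
pose C := fix C s := if s is i :: s' then
  C s' `&` [set x | `|x - q i| <= e (size s')] else F.
have Cd s i : C (i :: s) `<=` C s by move=> x [].
have CF s : C s `<=` F by elim: s => //= i s IHs x [/IHs].
exists C; split=> //.
- move=> s x Cx; have xe : x - e (size s) < x + e (size s).
    by rewrite ltrD2l gtrN.
  have [t tx] := rat_in_itvoo xe.
  exists (choice.pickle t) => //=; split=> //=; rewrite /q choice.pickleK /=.
  by move: tx; rewrite in_itv /= distrC ler_distl => /andP[/ltW -> /ltW ->].
- move=> a Cn; pose lo n := q (a n) - e n; pose up n := q (a n) + e n.
  have lu n k : lo n <= up k.
    have [x Cx] := Cn (maxn n k).+1.
    have /= [_] := branch_decr Cd (leq_maxl n k : (n.+1 <= (maxn n k).+1)%N) Cx.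
    have /= [_] := branch_decr Cd (leq_maxr n k : (k.+1 <= (maxn n k).+1)%N) Cx.
    rewrite !size_branch !ler_distl => /andP[_ xk] /andP[nx _].
    exact: le_trans nx xk.
  (* By [lu] every left end lies below every right end, so the supremum of the left ends belongs to
     all the intervals. *)
  pose x := sup (range lo).
  have hs : has_sup (range lo).
    by split; [exists (lo 0%N), 0%N | exists (up 0%N) => _ [n _ <-]].
  have lx n : lo n <= x by apply: ub_le_sup; [case: hs | exists n].
  have xu n : x <= up n by apply: ge_sup; [case: hs | move=> _ [k _ <-]].
  have Hx U : nbhs x U -> exists n, C (branch a n) `<=` U.
    move=> /nbhs_ballP[d /= d0 dU].
    have [n nd] := natSinv_lt (divr_gt0 d0 (ltr0Sn _ 1)).
    exists n.+1 => y /= [_]; rewrite /= size_branch => yn; apply: dU.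
    rewrite /ball /= ; move: (lx n) (xu n) yn nd; rewrite /lo /up ler_distl ltr_distl.
    rewrite -/(e n); move: (q (a n)) (e n) (x) => Q en z.
    by move=> ? ? /andP[? ?] ?; apply/andP; split; lra.
  exists x => //; apply: cF => U /Hx[n nU].
  by have [y Cy] := Cn n; exists y; split; [exact: CF Cy | exact: nU].
Unshelve. all: end_near. Qed.

(** Analytic sets are not closed under complement, so set and complement are carried together.
    Injectivity of [h] lets images commute with intersections, which handles the complement of a
    union. *)
Lemma sigma_algebra_bianalytic (X : topologicalType) T (h : T -> X) :
  hausdorff_space X -> injective h ->
  analytic (range h) -> 
  sigma_algebra setT [set A | analytic (h @` A) /\ analytic (h @` (~` A))].
Proof.
move=> hX hi ah; split.
- by rewrite /= image_set0 setC0; split=> //; exact: analytic0.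
- by move=> A [? ?]; rewrite /= setTD setCK.
- move=> A HA /=; rewrite image_bigcup setC_bigcup; split.
    by apply: analytic_bigcup => k; have [] := HA k.
  suff -> : h @` (\bigcap_k ~` A k) = \bigcap_k (h @` ~` A k).
    by apply: analytic_bigcap => // k; have [] := HA k.
  apply/seteqP; split=> [_ [x Ax <-] k _|y Hy]; first by exists x => //; exact: Ax.
  have [x _ xy] := Hy 0%N I; exists x => // k _.
  by have [z Akz] := Hy k I; rewrite -xy => /hi <-.
Qed.

Lemma measurable_analytic (A : set R) : measurable A -> analytic A.
Proof.
move=> mA; have {}mA : (@RGenCInfty.G R).-sigma.-measurable A.
  by rewrite -RGenCInfty.measurableE.
suff [] : [set A | analytic (@idfun R @` A) /\ analytic (@idfun R @` (~` A))] A.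
  by rewrite image_id.
apply: (smallest_sub _ _ mA) => [|_ [x ->]] /=.
  apply: sigma_algebra_bianalytic => //.
  by rewrite image_id; apply: closed_analytic; exact: closedT.
rewrite !image_id; split; first exact/closed_analytic/interval_closed.
rewrite setCitvr.
have -> : `]-oo, x[%classic = \bigcup_n `]-oo, x - e n]%classic.
  apply/seteqP; split=> [y /=|y [n _] /=]; rewrite !in_itv /=; last first.
    by move/le_lt_trans; apply; rewrite gtrBl.
  rewrite -subr_gt0 => /natSinv_lt[n nyx]; exists n => //=.
  by rewrite in_itv /= lerBrDl -lerBrDr ltW.
apply: analytic_bigcup => n; exact/closed_analytic/interval_closed.
Qed.

Definition separated_by_measurable (A B : set R) : Prop :=
  exists M : set R, [/\ measurable M, A `<=` M & M `&` B = set0].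

(** Read contrapositively, inseparable unions contain an inseparable pair of pieces; this drives the
    descent in [analytic_separation]. *)
Lemma separated_bigcup (A B : nat -> set R) :
  (forall i j, separated_by_measurable (A i) (B j)) ->
  separated_by_measurable (\bigcup_i A i) (\bigcup_j B j).
Proof.
move=> H; have /choice[M HM] : forall ij : nat * nat, exists M : set R,
    [/\ measurable M, A ij.1 `<=` M & M `&` B ij.2 = set0].
  by move=> [i j]; exact: H.
exists (\bigcup_i \bigcap_j M (i, j)); split.
- apply: bigcup_measurable => i _; apply: bigcap_measurable => // j _.
  by have [] := HM (i, j).
- by move=> x [i _ Ax]; exists i => // j _; have [_ + _] := HM (i, j); apply.
- rewrite -subset0 => x [[i _ Mx] [j _ Bx]].
  by have [_ _ <-] := HM (i, j); split=> //; exact: Mx.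
Qed.

(** Lusin's argument: an inseparable pair has inseparable subcells at every depth. The two branches
    converge to a point of [A] and a point of [B]; these differ, and disjoint open neighbourhoods
    separate deep cells after all. *)
Lemma analytic_separation (A B : set R) : analytic A -> analytic B ->
  A `&` B = set0 -> separated_by_measurable A B.
Proof.
move=> [C [C0 Cc Cd Cb]] [C' [C'0 C'c C'd C'b]] AB; apply: contrapT => nAB.
pose sep := separated_by_measurable.
have sub A' A'' B' B'' : A' `<=` A'' -> B' `<=` B'' -> sep A'' B'' -> sep A' B'.
  move=> sA sB [M [mM AM MB]]; exists M; split=> //; first exact: subset_trans AM.
  by rewrite -subset0 -MB; exact: setIS.
have step (st : seq nat * seq nat) : exists ij : nat * nat, 
    ~ sep (C st.1) (C' st.2) -> ~ sep (C (ij.1 :: st.1)) (C' (ij.2 :: st.2)).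
  have [h|h] := pselect (sep (C st.1) (C' st.2)); first by exists (0%N, 0%N).
  apply: contrapT => H; apply: h; apply: (sub _ _ _ _ (Cc _) (C'c _)).
  apply: separated_bigcup => i j; apply: contrapT => ns; apply: H.
  by exists (i, j).
have [F HF] := choice step.
pose st := fix st n := if n is n'.+1 then
  ((F (st n')).1 :: (st n').1, (F (st n')).2 :: (st n').2) else ([::], [::]).
have stN n : ~ sep (C (st n).1) (C' (st n).2).
  by elim: n => [|n IHn] /=; [rewrite C0 C'0 | exact: HF].
pose a n := (F (st n)).1; pose b n := (F (st n)).2.
have sta n : (st n).1 = branch a n by elim: n => //= n <-.
have stb n : (st n).2 = branch b n by elim: n => //= n <-.
(* An empty cell would be separated by [set0], or by [setT] if it is on the other side, so
   inseparability keeps the cells nonempty. *)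
have [|x Ax Hx] := Cb a.
  move=> n; rewrite -sta; apply/set0P/negP => /eqP C_0; apply: (stN n).
  by rewrite C_0; exists set0; split=> //; rewrite set0I.
have [|y By Hy] := C'b b.
  move=> n; rewrite -stb; apply/set0P/negP => /eqP C_0; apply: (stN n).
  by rewrite C_0; exists setT; split=> //; rewrite setI0.
have xy : x != y by apply/eqP => xy; have : (A `&` B) x by [split=> //; rewrite xy]; rewrite AB.
have := @Rhausdorff R; rewrite open_hausdorff => /(_ x y xy).
move=> [[U V] /= [xU yV] [oU oV UV]].
have [n nU] := Hx U (open_nbhs_nbhs (conj oU (set_mem xU))).
have [m mV] := Hy V (open_nbhs_nbhs (conj oV (set_mem yV))).
apply: (stN (maxn n m)); exists U; split; first exact: open_measurable.
- rewrite sta; apply: subset_trans nU; exact/(branch_decr Cd)/leq_maxl.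
- rewrite stb -subset0 => z [Uz C'z]; rewrite -(eqP UV); split=> //.
  by apply: mV; apply: (branch_decr C'd _ C'z); exact: leq_maxr.
Qed.

End analytic_real.

(** * Measurable enumeration of finite sections *)

Lemma image_setI_inj (T U : Type) (g : T -> U) (A B : set T) : injective g ->
  g @` (A `&` B) = g @` A `&` g @` B.
Proof.
move=> gI; apply/seteqP; split; first exact: sub_image_setI.
by move=> _ [[x Ax <-] [y By /gI yx]]; exists x => //; split=> //; rewrite -yx.
Qed.

Definition at_least {T : choiceType} (n : nat) (E : set (T * T)) : set T :=
  [set x | exists s : seq T,
     [/\ size s = n, uniq s & forall y, y \in s -> E (x, y)]].

Definition section_dom {T : Type} (E : set (T * T)) : set T :=
  [set x | exists y, E (x, y)].

Section at_least.
Variable T : choiceType.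
Implicit Types E F : set (T * T).

Lemma at_least_sub n E F : E `<=` F -> at_least n E `<=` at_least n F.
Proof. by move=> EF x [s [ss us sE]]; exists s; split=> // y /sE/EF. Qed.

Lemma at_least1 E : at_least 1 E = section_dom E.
Proof.
apply/seteqP; split=> [x [[|y [|? ?]] [] //= _ _ sE]|x [y Exy]].
  by exists y; apply: sE; rewrite inE.
by exists [:: y]; split=> // z; rewrite inE => /eqP ->.
Qed.

Lemma at_least_cat n m E F x : E `&` F = set0 ->
  at_least n E x -> at_least m F x -> at_least (n + m) (E `|` F) x.
Proof.
move=> EF0 [s [ss us sE]] [t [st ut tF]]; exists (s ++ t); split.
- by rewrite size_cat ss st.
- rewrite cat_uniq us ut andbT /=; apply/hasPn => y /tF Fy.
  by apply/negP => /sE Ey; have : (E `&` F) (x, y) by []; rewrite EF0.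
- by move=> y; rewrite mem_cat => /orP[/sE|/tF]; [left|right].
Qed.

End at_least.

Section lusin_novikov.
Context d (T : measurableType d) (R : realType) (g : T -> R).
Hypotheses (gI : injective g) (mrg : measurable (range g))
  (mg : measurable_fun setT g)
  (mig : forall A : set T, measurable A -> measurable (g @` A)).
Implicit Types E : set (T * T).

Let g2 (p : T * T) : R * R := (g p.1, g p.2).

Let g2I : injective g2.
Proof. by move=> [x y] [x' y'] [/gI -> /gI ->]. Qed.

Let image_g2 (A B : set T) : g2 @` (A `*` B) = (g @` A) `*` (g @` B).
Proof.
apply/seteqP; split=> [_ [[x y] [/= Ax By] <-]|[_ _] [/= [x Ax <-] [y By <-]]].
  by split; [exists x | exists y].
by exists (x, y).
Qed.

Lemma analytic_g2 E : measurable E -> analytic (g2 @` E : set (R * R)).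
Proof.
have aX (A B : set T) : measurable A -> measurable B ->
    analytic (g2 @` (A `*` B) : set (R * R)).
  move=> mA mB; rewrite image_g2.
  by apply: analytic_setX; apply: measurable_analytic; exact: mig.
rewrite measurable_prod_measurableType => mE.
suff [] : [set E | analytic (g2 @` E : set (R * R)) /\
                   analytic (g2 @` (~` E) : set (R * R))] E by [].
apply: (smallest_sub _ _ mE) => [|_ [A mA] [B mB] <-] /=.
  apply: sigma_algebra_bianalytic => //.
  by rewrite -setXTT; apply: aX.
split; first exact: aX.
have -> : ~` (A `*` B) = (~` A `*` setT) `|` (setT `*` ~` B).
  apply/seteqP; split=> [[x y] nAB|[x y] [[/= nA _]|[/= _ nB]] [//]].
  have [Ax|nA] := pselect (A x); last by left.
  by right; split=> //= By; apply: nAB.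
rewrite image_setU; apply: analyticU; apply: aX => //; exact: measurableC.
Qed.

(** A projection of a Borel set is in general only analytic; the bound on section sizes is what
    later makes it Borel. *)
Lemma analytic_section_dom E : measurable E -> analytic (g @` section_dom E).
Proof.
move=> /analytic_g2 aE.
have -> : g @` section_dom E = fst @` (g2 @` E).
  apply/seteqP; split=> [_ [x [y Exy] <-]|_ [_ [[x y] Exy <-] <-]].
    by exists (g x, g y) => //; exists (x, y).
  by exists x => //; exists y.
by apply: analytic_image aE => p; exact: cvg_fst.
Qed.

Let below (q : rat) : set (T * T) := [set p | g p.2 < ratr q].

Let mbelow q : measurable (below q).
Proof.
have -> : below q = (g \o snd) @^-1` `]-oo, ratr q[.
  by apply/seteqP; split=> p /=; rewrite in_itv.
rewrite -[X in measurable X]setTI.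
by apply: (measurableT_comp mg); [exact: measurable_snd | | exact: measurable_itv].
Qed.

(** With the points sorted by [g], a rational strictly between the two smallest values puts one
    point below and leaves [n.+1] above. *)
Let at_leastS n E :
  at_least n.+2 E = \bigcup_q (section_dom (E `&` below q) `&`
                               at_least n.+1 (E `\` below q)).
Proof.
apply/seteqP; split=> [x [s [ss us sE]]|x [q _ [xE xE']]]; last first.
  rewrite -[E](setUIDK _ (below q)) -[n.+2]/(1 + n.+1)%N.
  apply: at_least_cat => //; last by rewrite at_least1.
  by rewrite -subset0 => p [[_ pq] []].
pose le : rel T := fun y z => g y <= g z.
have let_ : transitive le by move=> y z w; exact: le_trans.
have : sorted le (sort le s) by apply: sort_sorted => y z; exact: le_total.
have : perm_eq (sort le s) s by rewrite perm_sort.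
case: (sort le s) => [|y [|z t]] /[dup] /perm_size; rewrite ss // => -[st].
move=> /[dup] /perm_uniq; rewrite us => ut /perm_mem mt /= /andP[yz pt].
have {}yz : g y < g z.
  rewrite lt_neqAle [_ <= _]yz andbT; apply: contraTN ut => /eqP/gI ->.
  by rewrite /= inE eqxx.
have [q] := rat_in_itvoo yz; rewrite in_itv /= => /andP[yq qz].
exists q => //; split.
  by exists y; split=> //; apply: sE; rewrite -mt inE eqxx.
exists (z :: t); split; first by rewrite /= st.
  by move: ut => /= /andP[].
move=> w wzt; split; first by apply: sE; rewrite -mt inE wzt orbT.
apply/negP; rewrite /= -leNgt; apply: (le_trans (ltW qz)).
move: wzt; rewrite inE => /predU1P[->//|wt].
exact: (allP (order_path_min let_ pt) _ wt).
Qed.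

Let analytic_bigcup_rat (A : rat -> set T) :
  (forall q, analytic (g @` A q)) -> analytic (g @` \bigcup_q A q).
Proof.
move=> aA.
have -> : \bigcup_q A q = \bigcup_n A (odflt 0 (choice.unpickle n)).
  apply/seteqP; split=> [x [q _ Aq]|x [n _ An]]; last by exists (odflt 0 (choice.unpickle n)).
  by exists (choice.pickle q) => //; rewrite choice.pickleK.
by rewrite image_bigcup; apply: analytic_bigcup => n.
Qed.

Lemma analytic_at_least n E :
  measurable E -> analytic (g @` at_least n.+1 E).
Proof.
elim: n E => [|n IHn] E mE; first by rewrite at_least1; exact: analytic_section_dom.
rewrite at_leastS; apply: analytic_bigcup_rat => q.
rewrite image_setI_inj //.
apply: analyticI => //; first by apply: analytic_section_dom; exact: measurableI.
by apply: IHn; exact: measurableD.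
Qed.

Lemma section_separation (A B : set T) :
  analytic (g @` A) -> analytic (g @` B) -> A `&` B = set0 ->
  exists M : set T, [/\ measurable M, A `<=` M & M `&` B = set0].
Proof.
move=> aA aB AB; have [|M [mM AM MB]] := analytic_separation aA aB.
  by rewrite -image_setI_inj // AB image_set0.
exists (g @^-1` M); split.
- by rewrite -[X in measurable X]setTI; exact: mg.
- by move=> x Ax; apply: AM; exists x.
- rewrite -subset0 => x [Mx Bx]; have : set0 (g x) by rewrite -MB; split=> //; exists x.
  by [].
Qed.

(* The section over [x] is the point [y] with [g y = inf {q | x \in M q}], where
   [M q] separates the [x] whose point lies below [q] from the others. *)
Lemma measurable_section_dom1 E : measurable E ->
  (forall x, ~ at_least 2 E x) -> measurable (section_dom E).
Proof.
move=> mE E1.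
have EU x y z : E (x, y) -> E (x, z) -> y = z.
  move=> Ey Ez; apply: contrapT => /eqP yz; apply: (E1 x); exists [:: y; z].
  split=> //=; first by rewrite inE yz.
  by move=> w; rewrite !inE => /orP[] /eqP ->.
have /choice[M HM] : forall q, exists M : set T, [/\ measurable M,
    section_dom (E `&` below q) `<=` M & M `&` section_dom (E `\` below q) = set0].
  move=> q; apply: section_separation.
  - by apply: analytic_section_dom; exact: measurableI.
  - by apply: analytic_section_dom; exact: measurableD.
  - by rewrite -subset0 => x [[y [Ey yq]] [z [Ez]]]; rewrite (EU _ _ _ Ey Ez) in yq *.
have ME x y q : E (x, y) -> M q x <-> g y < ratr q.
  move=> Exy; have [_ H1 H2] := HM q; split=> [Mx|yq]; last by apply: H1; exists y.
  apply: contrapT => yq; have : (M q `&` section_dom (E `\` below q)) x.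
    by split=> //; exists y.
  by rewrite H2.
pose Q n : rat := odflt 0 (choice.unpickle n).
(* [+oo] is neutral for the infimum over the enumerated rationals. *)
pose u n (x : T) : \bar R := if x \in M (Q n) then (ratr (Q n))%:E else +oo%E.
pose h x := einfs (u ^~ x) 0.
have mh : measurable_fun setT h.
  apply: measurable_fun_einfs => n; apply: measurable_fun_ifT => //.
  apply: (measurable_fun_bool true); rewrite setTI.
  have [mM _ _] := HM (Q n).
  rewrite (_ : _ @^-1` _ = M (Q n)) //; apply/seteqP.
  by split=> x /=; [exact: set_mem | exact: mem_set].
have hE x y : E (x, y) -> h x = (g y)%:E.
  move=> Exy; apply/eqP; rewrite eq_le; apply/andP; split.
    apply/lee_addgt0Pr => e e0.
    have ye : g y < g y + e by rewrite ltrDl.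
    have [q] := rat_in_itvoo ye.
    rewrite in_itv /= => /andP[yq qe]; apply: (@le_trans _ _ (ratr q)%:E).
      apply: ereal_inf_lbound; exists (choice.pickle q) => //=.
      by rewrite /u /Q choice.pickleK /=; case: ifPn => //; rewrite notin_setE (ME _ _ _ Exy).
    by rewrite -EFinD lee_fin ltW.
  apply: le_ereal_inf_tmp => _ [n _ <-]; rewrite /u.
  case: ifPn => [|_]; last by rewrite leey.
  by rewrite in_setE (ME _ _ _ Exy) lee_fin => /ltW.
pose f x := xget x [set y | (g y)%:E = h x].
have fE x y : E (x, y) -> f x = y.
  by move=> /hE hx; rewrite /f; case: xgetP => [z _ /=|/(_ y)]; rewrite /= hx // => -[/gI].
have mf : measurable_fun setT f.
  move=> _ A mA; rewrite setTI.
  (* Where [h] misses the range of [g], [xget] falls back on [x] itself. *)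
  have -> : f @^-1` A = h @^-1` (EFin @` (g @` A)) `|`
      (A `\` h @^-1` (EFin @` range g)).
    apply/seteqP; split=> [x|x [[_ [y Ay <-] yx]|[Ax nx]]] /=; rewrite /f.
    - case: xgetP => [y _ yx Ay|nx Ax]; first by left; exists (g y); [exists y | exact: yx].
      by right; split=> // -[_ [y _ <-]] /nx.
    - by case: xgetP => [z _ /=|/(_ y)//]; rewrite -yx => -[/gI ->].
    - by case: xgetP => // y _ yx; exfalso; apply: nx; exists (g y); [exists y | exact: yx].
  have mhE (B : set R) : measurable B -> measurable (h @^-1` (EFin @` B)).
    move=> mB; rewrite -[X in measurable X]setTI; apply: mh => //.
    exact: measurable_image_EFin.
  by apply: measurableU; [apply: mhE; exact: mig | apply: measurableD => //; exact: mhE].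
(* Since [f] is Borel and picks the only candidate, the projection has turned into a preimage. *)
rewrite (_ : section_dom E = (fun x => (x, f x)) @^-1` E).
  rewrite -[X in measurable X]setTI.
  by apply: measurable_fun_pair.
apply/seteqP; split=> [x [y Exy]|x Ex] /=; first by rewrite (fE _ _ Exy).
by exists (f x).
Qed.

(** Induction on the size of sections. If a rational [q] splits the section of [x], both halves are
    smaller and the induction hypothesis would apply to them, but only for such [x], and the set of
    these is so far just analytic. It is disjoint from the analytic set where some half is too
    large; a Borel [M] separating the two restricts [E] to where both halves are small. *)
Lemma measurable_section_dom n E : measurable E ->
  (forall x, ~ at_least n.+1 E x) -> measurable (section_dom E).
Proof.
elim: n E => [|[|n] IHn] E mE En; last 1 first.
- have mW q : measurable (section_dom (E `&` below q) `&` section_dom (E `\` below q)).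
    have mE1 : measurable (E `&` below q) by exact: measurableI.
    have mE2 : measurable (E `\` below q) by exact: measurableD.
    have E12 : (E `&` below q) `&` (E `\` below q) = set0.
      by rewrite -subset0 => p [[_ ?] []].
    have [M [mM WM MZ]] : exists M : set T, [/\ measurable M,
        section_dom (E `&` below q) `&` section_dom (E `\` below q) `<=` M &
        M `&` (at_least n.+2 (E `&` below q) `|` at_least n.+2 (E `\` below q)) = set0].
      apply: section_separation.
      - rewrite image_setI_inj //.
        by apply: analyticI => //; exact: analytic_section_dom.
      - by rewrite image_setU; apply: analyticU; exact: analytic_at_least.
      - rewrite -!at_least1 -subset0 => x [[x1 x2] [xn|xn]].
          apply: (En x); rewrite -[E](setUIDK _ (below q)) -[n.+3]addn1.
          exact: at_least_cat.
        apply: (En x); rewrite -[E](setUIDK _ (below q)) -[n.+3]add1n.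
        exact: at_least_cat.
    have mM1 : measurable (M `*` setT : set (T * T)) by exact: measurableX.
    have mS F : measurable F -> (forall x, M x -> ~ at_least n.+2 F x) ->
        measurable (section_dom (F `&` M `*` setT)).
      move=> mF Fn; apply: IHn; first exact: measurableI.
      move=> x xn; have [[|y s] [] // ss us sF] := xn.
      have [_ [/= Mx _]] := sF y (mem_head _ _); apply: (Fn x Mx).
      by apply: at_least_sub xn => p [].
    have -> : section_dom (E `&` below q) `&` section_dom (E `\` below q) =
        section_dom ((E `&` below q) `&` M `*` setT) `&`
        section_dom ((E `\` below q) `&` M `*` setT).
      apply/seteqP; split=> [x [[y Ey] [z Ez]]|x [[y [Ey _]] [z [Ez _]]]]; last first.
        by split; [exists y | exists z].
      have Mx : M x by apply: WM; split; [exists y | exists z].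
      by split; [exists y | exists z].
    apply: measurableI; apply: mS => // x Mx xn.
      by have : set0 x by rewrite -MZ; split=> //; left.
    by have : set0 x by rewrite -MZ; split=> //; right.
  (* A section has two points exactly when some rational splits it, so [mW] makes [W] Borel; off [W]
     a section has at most one point. *)
  pose W := at_least 2 E.
  have mW2 : measurable W.
    rewrite /W at_leastS; apply: countable_bigcupT_measurable => [|q]; first exact: countableP.
    by rewrite at_least1.
  have -> : section_dom E = W `|` section_dom (E `&` (~` W) `*` setT).
    apply/seteqP; split=> [x [y Exy]|x [[[|y s] [//_ _ sE]]|[y [Ey _]]]].
    - by have [?|?] := pselect (W x); [left | right; exists y].
    - by exists y; apply: sE; rewrite inE eqxx.
    - by exists y.
  apply: measurableU => //; apply: measurable_section_dom1.
    by apply: measurableI => //; apply: measurableX => //; exact: measurableC.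
  move=> x xn; have [[|y s] [] // ss us sF] := xn.
  have [_ [/= + _]] := sF y (mem_head _ _); apply.
  by apply: at_least_sub xn => p [].
- rewrite (_ : section_dom E = set0) // -at_least1 -subset0 => x /En //.
- exact: measurable_section_dom1.
Qed.

(* A point of a finite section is the only one in some rational interval. *)
Lemma finite_sections_enumeration n E : measurable E ->
  (forall x, ~ at_least n.+1 E x) ->
  exists f : nat -> T -> T, (forall i, measurable_fun setT (f i)) /\
    forall x y, E (x, y) -> exists i, y = f i x.
Proof.
move=> mE En.
pose I (ab : rat * rat) := E `&` (below ab.2 `\` below ab.1).
have mI ab : measurable (I ab) by apply: measurableI => //; exact: measurableD.
have In F : F `<=` E -> measurable F -> measurable (section_dom F).
  move=> FE mF; apply: (@measurable_section_dom n) => // x /(at_least_sub FE).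
  exact: En.
pose U ab := section_dom (I ab) `\` at_least 2 (I ab).
have mU ab : measurable (U ab).
  apply: measurableD; first by apply: In => // p [].
  rewrite at_leastS; apply: countable_bigcupT_measurable => [|q]; first exact: countableP.
  by rewrite at_least1; apply: measurableI; apply: In;
    [move=> p [[]] | exact: measurableI | move=> p [[]] | exact: measurableD].
have UI ab x y z : U ab x -> I ab (x, y) -> I ab (x, z) -> y = z.
  move=> [_ Ux] Iy Iz; apply: contrapT => /eqP yz; apply: Ux; exists [:: y; z].
  by split=> //= [|w]; rewrite !inE ?yz // => /orP[] /eqP ->.
pose f ab x := if x \in U ab then xget x [set y | I ab (x, y)] else x.
have fE ab x y : U ab x -> I ab (x, y) -> f ab x = y.
  move=> Ux Iy; rewrite /f mem_set //.
  by case: xgetP => [z _ Iz|/(_ y)//]; apply: UI Iy.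
have mf ab : measurable_fun setT (f ab).
  move=> _ A mA; rewrite setTI.
  have -> : f ab @^-1` A =
      (U ab `&` section_dom (I ab `&` setT `*` A)) `|` (A `\` U ab).
    apply/seteqP; split=> [x /= Ax|x [[Ux [y [Iy [_ /= Ay]]]]|[Ax Ux]] /=].
    - have [Ux|Ux] := pselect (U ab x).
        left; split=> //; have [[y Iy] _] := Ux; exists y; split=> //; split=> //=.
        by rewrite -(fE _ _ _ Ux Iy).
      by right; split=> //; move: Ax; rewrite /f memNset.
    - by rewrite (fE _ _ _ Ux Iy).
    - by rewrite /f memNset.
  apply: measurableU; apply: measurableI => //.
    by apply: In; [move=> p [[]] | apply: measurableI => //; exact: measurableX].
  exact: measurableC.
exists (fun i => f (odflt (0, 0) (choice.unpickle i))); split=> // x y Exy.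
suff [ab Uab Iab] : exists2 ab, U ab x & I ab (x, y).
  by exists (choice.pickle ab); rewrite choice.pickleK /= (fE _ _ _ Uab Iab).
suff [a [b [ay yb H]]] : exists a b : rat, [/\ (ratr a : R) <= g y, g y < ratr b &
    forall z, E (x, z) -> ratr a <= g z < ratr b -> z = y].
  exists (a, b); last by split=> //; split=> //=; apply/negP; rewrite -leNgt.
  split; first by exists y; split=> //; split=> //=; apply/negP; rewrite -leNgt.
  move=> [[|z [|w [|? ?]]] [] //= _]; rewrite inE andbT => zw sI.
  have zy v : v \in [:: z; w] -> v = y.
    move=> /sI[Ev [/= vb /negP]]; rewrite -leNgt => av; apply: H => //.
    exact/andP.
  by move: zw; rewrite (zy z) ?inE ?eqxx // (zy w) ?inE ?eqxx ?orbT.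
have [s Hs] : exists s : seq T, forall z, E (x, z) -> z \in s.
  apply: contrapT => H.
  suff Hk k : at_least k E x by apply: (En x).
  elim: k => [|k [s [ss us sE]]]; first by exists [::].
  have /existsNP[z /not_implyP[Ez /negP zs]] : ~ forall z, E (x, z) -> z \in s.
    by move=> ?; apply: H; exists s.
  exists (z :: s); split=> //=; [by rewrite ss | by rewrite zs |].
  by move=> w; rewrite inE => /predU1P[->|/sE].
(* A gap around [g y], inside which the rational ends [a] and [b] are taken. *)
have [e e0 He] : exists2 e : R, 0 < e & forall z, z \in s -> z != y -> e <= `|g z - g y|.
  elim: s {Hs} => [|z s [e e0 He]]; first by exists 1.
  have [->|zy] := eqVneq z y.
    by exists e => // w; rewrite inE => /predU1P[->|/He//]; rewrite eqxx.
  exists (Num.min e `|g z - g y|).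
    by rewrite lt_min e0 normr_gt0 subr_eq0 (inj_eq gI).
  move=> w; rewrite inE ge_min => /predU1P[-> _|/He/[apply] -> //].
  by rewrite lexx orbT.
have ley : g y - e < g y by rewrite gtrBl.
have gey : g y < g y + e by rewrite ltrDl.
have [a] := rat_in_itvoo ley; have [b] := rat_in_itvoo gey.
rewrite !in_itv /= => /andP[yb be] /andP[ea ay].
exists a, b; split=> //; first exact: ltW.
move=> z /Hs zs /andP[az zb]; apply: contrapT => /eqP zy.
have := He z zs zy; apply/negP; rewrite -ltNge ltr_distl.
by apply/andP; split; lra.
Qed.

End lusin_novikov.

(** * Isomorphism types of balls *)

Lemma within_mono (T : Type) (E : set (T * T)) s r x y :
  (s <= r)%N -> within E s x y -> within E r x y.
Proof.
elim: r => [|r IHr]; first by rewrite leqn0 => /eqP ->.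
by rewrite leq_eqVlt => /predU1P[->//|]; rewrite ltnS => sr /(IHr sr); left.
Qed.

Lemma within_refl (T : Type) (E : set (T * T)) r x : within E r x x.
Proof. exact: (@within_mono _ _ 0). Qed.

Lemma within_sub (T : Type) (E F : set (T * T)) r x y :
  E `<=` F -> within E r x y -> within F r x y.
Proof.
move=> EF; elim: r y => [|r IHr] //= y [/IHr|[z [/IHr xz /EF zy]]]; first by left.
by right; exists z.
Qed.

Section ball_transfer.
Variables (T T' : Type).

Let within_transfer (U U' : Type) (E : set (U * U)) (E' : set (U' * U'))
    (rho : U -> U' -> Prop) r x x' :
  (forall y, within E r x y -> exists y', rho y y') ->
  (forall y y' z z', rho y y' -> rho z z' -> (y = z <-> y' = z')) ->
  rho x x' ->
  (forall y y' z z', rho y y' -> rho z z' -> (E (y, z) <-> E' (y', z'))) ->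
  forall y y', rho y y' -> within E r x y -> within E' r x' y'.
Proof.
elim: r => [|r IHr] H1 H3 H4 H5 y y' yy' /=; first by move/(H3 _ _ _ _ H4 yy').
have H1' z : within E r x z -> exists z', rho z z' by move=> ?; apply: H1; left.
move=> [xy|[z [xz zy]]]; first by left; exact: IHr H1' H3 H4 H5 _ _ yy' xy.
have [z' zz'] := H1' z xz; right; exists z'; split.
  exact: IHr H1' H3 H4 H5 _ _ zz' xz.
by apply/(H5 _ _ _ _ zz' yy').
Qed.

(** A relation [rho] defined on the two balls is enough, so no map between the whole vertex sets is
    needed; the instances relate equal vertices, vertices with one index in a coded ball, or ends of
    one word. *)
Lemma ball_transfer (E : set (T * T)) (E' : set (T' * T')) r x x'
    (rho : T -> T' -> Prop) n (adj : rel 'I_n.+1) :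
  (forall y, within E r x y -> exists y', rho y y') ->
  (forall y', within E' r x' y' -> exists y, rho y y') ->
  (forall y y' z z', rho y y' -> rho z z' -> (y = z <-> y' = z')) ->
  rho x x' ->
  (forall y y' z z', rho y y' -> rho z z' -> (E (y, z) <-> E' (y', z'))) ->
  (exists phi, ball_iso E r x adj phi) -> exists phi, ball_iso E' r x' adj phi.
Proof.
move=> H1 H2 H3 H4 H5 [phi [phiI [phi0 [phir phia]]]].
have phiB i : within E r x (phi i).
  by rewrite -[within _ _ _ _]/([set y | within E r x y] (phi i)) -phir; exists i.
have /choice[psi Hpsi] i : exists y', rho (phi i) y' by exact: H1.
exists psi; split; first by move=> i j ij; apply/phiI/(H3 _ _ _ _ (Hpsi i) (Hpsi j)).
split; first by apply/(H3 _ _ _ _ (Hpsi ord0) H4).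
split; last by move=> i j; rewrite phia; exact: H5.
apply/seteqP; split=> [_ [i _ <-] /=|y' /= xy'].
  exact: (within_transfer H1 H3 H4 H5 (Hpsi i)).
have [y yy'] := H2 y' xy'.
have : within E r x y.
  apply: (@within_transfer _ _ E' E (fun z' z => rho z z') r x' x) yy' xy' => //.
    by move=> ? ? ? ? /H3 h /h[].
  by move=> ? ? ? ? /H5 h /h[].
rewrite -[within _ _ _ _]/([set y | within E r x y] y) -phir => -[i _ iy].
by exists i => //; apply/(H3 _ _ _ _ (Hpsi i) yy').
Qed.

End ball_transfer.

Lemma ball_transfer_iff (T T' : Type) (E : set (T * T)) (E' : set (T' * T')) r x x'
    (rho : T -> T' -> Prop) n (adj : rel 'I_n.+1) :
  (forall y, within E r x y -> exists y', rho y y') ->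
  (forall y', within E' r x' y' -> exists y, rho y y') ->
  (forall y y' z z', rho y y' -> rho z z' -> (y = z <-> y' = z')) ->
  rho x x' ->
  (forall y y' z z', rho y y' -> rho z z' -> (E (y, z) <-> E' (y', z'))) ->
  (exists phi, ball_iso E r x adj phi) <-> exists phi, ball_iso E' r x' adj phi.
Proof.
move=> H1 H2 H3 H4 H5; split; first exact: (ball_transfer H1 H2 H3 H4 H5).
apply: (@ball_transfer _ _ _ _ _ _ _ (fun z' z => rho z z')) => //.
  by move=> ? ? ? ? /H3 h /h[].
by move=> ? ? ? ? /H5 h /h[].
Qed.

Definition has_ball {T : Type} (E : set (T * T)) (r : nat) (a : rgraph) : set T :=
  [set x | exists phi, ball_iso E r x (rg_adj a) phi].

Definition has_cball {T : Type} {k : nat} (E : set (T * T)) (c : T -> 'I_k)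
    (r : nat) (b : cgraph k) : set T :=
  [set x | exists phi, ball_iso E r x (cg_adj b) phi /\
                       forall i, c (phi i) = cg_col b i].

Lemma eq_has_ball (T : Type) (E F : set (T * T)) r a x :
  (forall y z, within (E `|` F) r x y -> within (E `|` F) r x z ->
     (E (y, z) <-> F (y, z))) ->
  has_ball E r a x <-> has_ball F r a x.
Proof.
move=> EF.
apply: (@ball_transfer_iff _ _ _ _ _ _ _
  (fun y y' => y = y' /\ within (E `|` F) r x y)).
- move=> y xy; exists y; split=> //; apply: within_sub xy; exact: subsetUl.
- move=> y xy; exists y; split=> //; apply: within_sub xy; exact: subsetUr.
- by move=> y _ z _ [<- _] [<- _].
- by split=> //; exact: within_refl.
- by move=> y _ z _ [<- xy] [<- xz]; exact: EF.
Qed.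

(** Edges selected through the colours of their ends can be recognised inside a coloured ball, and a
    subgraph only shrinks balls. *)
Lemma has_cball_sub (T T' : Type) k (E : set (T * T)) (E' : set (T' * T'))
    (c : T -> 'I_k) (c' : T' -> 'I_k) r s (b : cgraph k) (P : 'I_k -> 'I_k -> Prop)
    a x x' : (s <= r)%N ->
  has_cball E c r b x -> has_cball E' c' r b x' ->
  has_ball (E `&` [set e | P (c e.1) (c e.2)]) s a x <->
  has_ball (E' `&` [set e | P (c' e.1) (c' e.2)]) s a x'.
Proof.
move=> sr [phi [[phiI [phi0 [phir phia]]] phic]].
move=> [psi [[psiI [psi0 [psir psia]]] psic]].
apply: (@ball_transfer_iff _ _ _ _ _ _ _
  (fun y y' => exists i, y = phi i /\ y' = psi i)).
- move=> y xy; have : [set y | within E r x y] y.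
    by apply: (within_mono sr); apply: within_sub xy => p [].
  by rewrite -phir => -[i _ <-]; exists (psi i), i.
- move=> y xy; have : [set y | within E' r x' y] y.
    by apply: (within_mono sr); apply: within_sub xy => p [].
  by rewrite -psir => -[i _ <-]; exists (phi i), i.
- by move=> _ _ _ _ [i [-> ->]] [j [-> ->]]; split=> [/phiI -> //|/psiI ->].
- by exists ord0; rewrite phi0 psi0.
- move=> _ _ _ _ [i [-> ->]] [j [-> ->]]; rewrite /setI /= !phic !psic.
  by split=> -[e Pij]; split=> //; [apply/psia/phia | apply/phia/psia].
Qed.

Section measurable_predicates.
Context d (T : measurableType d).
Implicit Types P Q : T -> Prop.

Definition mpred P := measurable [set x | P x].

Lemma mpredN P : mpred P -> mpred (fun x => ~ P x).
Proof. exact: measurableC. Qed.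

Lemma mpredA P Q : mpred P -> mpred Q -> mpred (fun x => P x /\ Q x).
Proof. exact: measurableI. Qed.

Lemma mpredO P Q : mpred P -> mpred Q -> mpred (fun x => P x \/ Q x).
Proof. exact: measurableU. Qed.

Lemma eq_mpred P Q : (forall x, P x <-> Q x) -> mpred P -> mpred Q.
Proof. by move=> PQ; congr measurable; apply/seteqP; split=> x /PQ. Qed.

Lemma mpredI P Q : mpred P -> mpred Q -> mpred (fun x => P x -> Q x).
Proof.
move=> mP mQ; apply: (@eq_mpred (fun x => ~ P x \/ Q x)) => [x|].
  split=> [[|//]//|PQ]; have [/PQ|] := pselect (P x); by [right|left].
exact/mpredO/mQ/mpredN.
Qed.

Lemma mpred_cst (p : Prop) : mpred (fun=> p).
Proof.
have [hp|np] := pselect p.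
  by apply: (@eq_mpred (fun=> True)) => //; exact: measurableT.
by apply: (@eq_mpred (fun=> False)) => //; exact: measurable0.
Qed.

Lemma mpred_iff P Q : mpred P -> mpred Q -> mpred (fun x => P x <-> Q x).
Proof. by move=> mP mQ; apply: mpredA; exact: mpredI. Qed.

Lemma mpred_exists (I : countType) (P : I -> T -> Prop) :
  (forall i, mpred (P i)) -> mpred (fun x => exists i, P i x).
Proof.
move=> mP; rewrite /mpred (_ : [set x | _] = \bigcup_i [set x | P i x]).
  by apply: countable_bigcupT_measurable => //; exact: countableP.
by apply/seteqP; split=> [x [i ?]|x [i _ ?]]; exists i.
Qed.

Lemma mpred_forall (I : countType) (P : I -> T -> Prop) :
  (forall i, mpred (P i)) -> mpred (fun x => forall i, P i x).
Proof.
move=> mP; apply: (@eq_mpred (fun x => ~ exists i, ~ P i x)) => [x|].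
  by split=> [H i|H [i]//]; apply: contrapT => ?; apply: H; exists i.
by apply: mpredN; apply: mpred_exists => i; exact: mpredN.
Qed.

Lemma mpred_pre d' (U : measurableType d') (f : T -> U) (A : set U) :
  measurable_fun setT f -> measurable A -> mpred (fun x => A (f x)).
Proof. by move=> mf mA; have := mf measurableT A mA; rewrite setTI. Qed.

End measurable_predicates.

(** * Measurability of ball types *)

Section measurable_balls.
Context d (T : measurableType d) (E : set (T * T)) (f : nat -> T -> T).
Hypotheses (mdiag : measurable [set p : T * T | p.1 = p.2]) (mE : measurable E)
  (mf : forall i, measurable_fun setT (f i))
  (Ef : forall x y, E (x, y) -> exists i, y = f i x).

(** Every vertex of a ball around [x] is some [fw w x]; there are countably many words, so
    quantifiers over vertices become countable ones. *)
Let fw (w : seq nat) (x : T) := foldr f x w.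

Let mfw w : measurable_fun setT (fw w).
Proof.
elim: w => [|i w IHw]; first exact: measurable_id.
exact: (measurableT_comp (mf i) IHw).
Qed.

Let fw_rel (S : set (T * T)) v w : measurable S -> mpred (fun x => S (fw v x, fw w x)).
Proof.
move=> mS; apply: (@mpred_pre _ _ _ _ (fun x => (fw v x, fw w x))) => //.
exact: measurable_fun_pair.
Qed.

Let fw_eq v w : mpred (fun x => fw v x = fw w x).
Proof. exact: (@fw_rel [set p | p.1 = p.2]). Qed.

Let within_fw r x y : within E r x y -> exists w, y = fw w x.
Proof.
elim: r y => [|r IHr] y /=; first by move=> ->; exists [::].
by move=> [/IHr//|[z [/IHr[w ->] /Ef[i ->]]]]; exists (i :: w).
Qed.

Let mwithin r w : mpred (fun x => within E r x (fw w x)).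
Proof.
elim: r w => [|r IHr] w /=; first exact: (fw_eq [::]).
apply: mpredO => //.
apply: (@eq_mpred _ _ (fun x => exists v, within E r x (fw v x) /\ E (fw v x, fw w x))).
  move=> x; split=> [[v ?]|[z [xz zw]]]; first by exists (fw v x).
  by have [v vE] := within_fw xz; exists v; rewrite -vE.
by apply: mpred_exists => v; apply: mpredA => //; exact: fw_rel.
Qed.

Lemma measurable_within_exists r (S : set (T * T)) : measurable S ->
  mpred (fun x => exists y z, [/\ within E r x y, within E r x z & S (y, z)]).
Proof.
move=> mS; apply: (@eq_mpred _ _ (fun x => exists v, exists w,
    within E r x (fw v x) /\ within E r x (fw w x) /\ S (fw v x, fw w x))).
  move=> x; split=> [[v [w [? []]]]|[y [z [xy xz Syz]]]].
    by exists (fw v x), (fw w x).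
  have [v vE] := within_fw xy; have [w wE] := within_fw xz.
  by exists v, w; rewrite -vE -wE.
apply: mpred_exists => v; apply: mpred_exists => w.
by do 2!apply: mpredA => //; exact: fw_rel.
Qed.

Lemma measurable_has_cball k (c : T -> 'I_k) r (b : cgraph k) :
  (forall i, measurable (c @^-1` [set i])) -> measurable (has_cball E c r b).
Proof.
move=> mc; rewrite -[measurable _]/(mpred _).
apply: (@eq_mpred _ _ (fun x => exists W : {ffun 'I_(cg_size k b).+1 -> seq nat},
  (forall i j, fw (W i) x = fw (W j) x -> i = j) /\
  fw (W ord0) x = x /\
  ((forall i, within E r x (fw (W i) x)) /\
   (forall v, within E r x (fw v x) -> exists i, fw v x = fw (W i) x)) /\
  (forall i j, cg_adj b i j <-> E (fw (W i) x, fw (W j) x)) /\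
  (forall i, c (fw (W i) x) = cg_col b i))).
  move=> x; split=> [[W [WI [W0 [[W1 W2] [W3 W4]]]]]|[phi [[phiI [phi0 [phir phia]]] phic]]].
    exists (fun i => fw (W i) x); split=> //; split=> //; split=> //; split=> //.
    apply/seteqP; split=> [_ [i _ <-]//|y /= xy].
    have [v vE] := within_fw xy; rewrite vE in xy *.
    by have [i ->] := W2 v xy; exists i.
  have phiB i : within E r x (phi i).
    by rewrite -[within _ _ _ _]/([set y | within E r x y] (phi i)) -phir; exists i.
  have /choice[W HW] i : exists w, phi i = fw w x by exact: within_fw (phiB i).
  exists [ffun i => W i]; split=> [i j|]; first by rewrite !ffunE -!HW => /phiI.
  split; first by rewrite ffunE -HW.
  split; last by split=> *; rewrite !ffunE -!HW.
  split=> [i|v xv]; first by rewrite ffunE -HW.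
  have : [set y | within E r x y] (fw v x) by [].
  by rewrite -phir => -[i _ <-]; exists i; rewrite ffunE HW.
apply: mpred_exists => W; apply: mpredA.
  apply: mpred_forall => i; apply: mpred_forall => j; apply: mpredI => //.
  exact: mpred_cst.
apply: mpredA; first exact: (fw_eq _ [::]).
apply: mpredA.
  apply: mpredA; first exact: mpred_forall.
  by apply: mpred_forall => v; apply: mpredI => //; exact: mpred_exists.
apply: mpredA.
  apply: mpred_forall => i; apply: mpred_forall => j; apply: mpred_iff.
    exact: mpred_cst.
  exact: fw_rel.
apply: mpred_forall => i.
exact: (@mpred_pre _ _ _ _ (fw (W i)) (c @^-1` [set cg_col b i])).
Qed.

Lemma measurable_has_ball r a : measurable (has_ball E r a).
Proof.
pose b := @CGraph 1 _ (rg_adj a) (fun=> ord0).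
rewrite (_ : has_ball E r a = has_cball E (fun=> ord0) r b).
  apply: measurable_has_cball => i; rewrite -[measurable _]/(mpred _).
  exact: mpred_cst.
by apply/seteqP; split=> [x [phi ?]|x [phi [? _]]]; exists phi.
Qed.

End measurable_balls.

(** * Mass transport *)

(* [is_probability_measure] leaves the values on non-measurable sets
   unconstrained, whereas a [probability] is nonnegative on all sets. *)
Definition trim {R : realType} {d} {T : measurableType d} {mu : set T -> \bar R}
  (hmu : is_probability_measure mu) : set T -> \bar R :=
  fun A => if `[< measurable A >] then mu A else 0%E.

Section trim.
Context {R : realType} {d} {T : measurableType d} {mu : set T -> \bar R}.
Variable hmu : is_probability_measure mu.

Lemma trimE A : measurable A -> trim hmu A = mu A.
Proof. by move=> mA; rewrite /trim asboolT. Qed.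

Let trim0 : trim hmu set0 = 0%E.
Proof. by rewrite trimE //; case: hmu. Qed.

Let trim_ge0 A : (0 <= trim hmu A)%E.
Proof. by rewrite /trim; case: asboolP => // mA; case: hmu => _ [+ _]; apply. Qed.

Let trim_sigma_additive : semi_sigma_additive (trim hmu).
Proof.
move=> F mF tF mUF; rewrite trimE //.
rewrite (_ : (fun n => _) = (fun n => \sum_(0 <= i < n) mu (F i))%E); last first.
  by apply/funext => n; apply: eq_bigr => i _; rewrite trimE.
by case: hmu => _ [_ [+ _]]; apply.
Qed.

HB.instance Definition _ := isMeasure.Build _ _ _ (trim hmu)
  trim0 trim_ge0 trim_sigma_additive.

Let trimT : trim hmu setT = 1%E.
Proof. by rewrite trimE //; case: hmu => _ [_ [_]]. Qed.

HB.instance Definition _ := Measure_isProbability.Build _ _ _ (trim hmu) trimT.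

Import HBNNSimple.

(** The integral is built from simple functions, whose level sets are measurable, so only the common
    values of [mu] and [trim hmu] enter. *)
Lemma integral_trim D f : integral mu D f = integral (trim hmu) D f.
Proof.
have sE (h : {nnsfun T >-> R}) : sintegral mu h = sintegral (trim hmu) h.
  by apply: eq_fsbigr => x _; rewrite trimE.
by rewrite /integral; congr (_ - _)%E; congr ereal_sup; apply: eq_imagel => h _.
Qed.

End trim.

Lemma card_fset_set_seq (T : choiceType) (A : set T) (s : seq T) :
  uniq s -> (forall y, y \in s <-> A y) -> #|` fset_set A|%fset = size s.
Proof.
move=> us sA; have -> : A = [set` [fset y in s]%fset].
  by apply/seteqP; split=> y /=; rewrite inE => /sA.
by rewrite set_fsetK card_fseq undup_id.
Qed.

Lemma bounded_degree_at_least (T : choiceType) (E : set (T * T)) :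
  bounded_degree E -> exists n, forall x, ~ at_least n.+1 E x.
Proof.
move=> [D HD]; exists D => x [s [ss us sE]]; have [fE cE] := HD x.
suff : (size s <= #|` fset_set [set y | E (x, y)]|%fset)%N.
  by move=> /leq_trans/(_ cE); rewrite ss ltnn.
apply: uniq_leq_size => // y ys; rewrite in_fset_set //; apply/mem_set; exact: sE.
Qed.

Section section_count.
Context d (T : measurableType d) (f : nat -> T -> T).
Hypotheses (mdiag : measurable [set p : T * T | p.1 = p.2])
  (mf : forall i, measurable_fun setT (f i)).
Implicit Types S E : set (T * T).

(** The maps [f] may repeat a neighbour; counting it at its least index avoids multiplicities. *)
Definition first_hit i S : set T :=
  [set x | S (x, f i x) /\ forall j : 'I_i, f i x <> f j x].

Lemma measurable_first_hit i S : measurable S -> measurable (first_hit i S).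
Proof.
move=> mS; rewrite -[measurable _]/(mpred _); apply: mpredA.
  apply: (@mpred_pre _ _ _ _ (fun x => (x, f i x))) => //.
  exact: measurable_fun_pair.
apply: mpred_forall => j; apply: mpredN.
apply: (@mpred_pre _ _ _ _ (fun x => (f i x, f j x)) [set p | p.1 = p.2]) => //.
exact: measurable_fun_pair.
Qed.

Lemma card_section (R : realType) S x : finite_set [set y | S (x, y)] ->
  (forall y, S (x, y) -> exists i, y = f i x) ->
  ((#|` fset_set [set y | S (x, y)]|%fset%:R : R)%:E =
   \sum_(0 <= i <oo) (\1_(first_hit i S) x)%:E)%E.
Proof.
move=> fS cS.
have first y : S (x, y) -> exists i, y = f i x /\ first_hit i S x.
  move=> Sxy.
  have ex : exists i, `[< y = f i x >] by have [i ?] := cS y Sxy; exists i; apply/asboolP.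
  exists (ex_minn ex); case: ex_minnP => i /asboolP yi Hi; split=> //.
  split; first by rewrite -yi.
  move=> j ij; have := Hi j; rewrite leqNgt ltn_ord => H.
  by have : false by apply: H; apply/asboolP; rewrite yi.
have hitI i j : first_hit i S x -> first_hit j S x -> f i x = f j x -> i = j.
  move=> [_ Hi] [_ Hj] fij; have [ij|ji|//] := ltngtP i j.
    by have := Hj (Ordinal ij); rewrite /= fij.
  by have := Hi (Ordinal ji); rewrite /= fij.
have [N HN] : exists N, forall i, first_hit i S x -> (i < N)%N.
  have [s Hs] : exists s : seq nat, forall y, S (x, y) ->
      exists2 i, i \in s & (y = f i x /\ first_hit i S x).
    have [s sS] := (finite_seqP _).1 fS.
    have sE y : S (x, y) -> y \in s.
      by rewrite -[S _]/([set y | S (x, y)] y) sS.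
    have /choice[i Hi] : forall y, exists i, S (x, y) ->
        y = f i x /\ first_hit i S x.
      move=> y; have [/first[i ?]|?] := pselect (S (x, y)); first by exists i.
      by exists 0%N.
    exists (map i s) => y Sy; exists (i y); last exact: Hi.
    by apply: map_f; exact: sE.
  exists (\max_(i <- s) i).+1%N => i hi; rewrite ltnS.
  have [j js [fij hj]] := Hs (f i x) hi.1.
  by rewrite (hitI _ _ hi hj fij); apply: leq_bigmax_seq.
pose h i := `[< first_hit i S x >].
pose s := [seq f i x | i <- iota 0 N & h i].
rewrite (@card_fset_set_seq _ _ s); last 2 first.
- rewrite map_inj_in_uniq ?filter_uniq ?iota_uniq // => i j.
  by rewrite !mem_filter => /andP[/asboolP hi _] /andP[/asboolP hj _]; exact: hitI.
- move=> y; split=> [/mapP[i]|/first[i [-> hi]]].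
    by rewrite mem_filter => /andP[/asboolP[Si _] _] ->.
  by apply: map_f; rewrite mem_filter mem_iota /= add0n (HN _ hi) andbT; apply/asboolP.
rewrite size_map size_filter.
rewrite (nneseries_split 0 N) ?add0n; last by move=> k _; rewrite lee_fin.
rewrite [X in (_ + X)%E]eseries0 ?adde0; last first.
  move=> i Ni _; rewrite indicE memNset //= => /HN; by rewrite ltnNge Ni.
rewrite -sum1_count natr_sum sumEFin big_mkcond /=.
rewrite /index_iota subn0; congr EFin; apply: eq_bigr => i _.
rewrite indicE /h; case: asboolP => hi; first by rewrite mem_set.
by rewrite memNset.
Qed.

(** The right side makes sense for any Borel set of edges in place of a rectangle; in this form mass
    transport can be extended beyond rectangles. *)
Lemma integral_deg (R : realType) (P : {measure set T -> \bar R}) E (A B : set T) :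
  measurable E -> measurable A -> measurable B ->
  (forall x, finite_set [set y | E (x, y)]) ->
  (forall x y, E (x, y) -> exists i, y = f i x) ->
  (\int[P]_(x in A) ((deg E B x)%:R)%:E =
   \sum_(0 <= i <oo) P (first_hit i (E `&` A `*` B)))%E.
Proof.
move=> mE mA mB fE cE; pose S := E `&` A `*` B.
have mS : measurable S by apply: measurableI => //; exact: measurableX.
rewrite integral_mkcond.
transitivity (\int[P]_x (\sum_(0 <= i <oo) (\1_(first_hit i S) x)%:E))%E.
  congr integral; apply/funext => x; rewrite patchE -card_section; last 2 first.
  - by apply: sub_finite_set (fE x) => y [].
  - by move=> y [/cE].
  case: ifPn => [/set_mem Ax|/negP nAx].
    rewrite /deg (_ : [set y | E (x, y) /\ B y] = [set y | S (x, y)]) //.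
    by apply/seteqP; split=> [y [? ?]|y [? []]].
  rewrite (_ : [set y | S (x, y)] = set0) ?fset_set0 ?cardfs0 //.
  by rewrite -subset0 => y [_ [/= Ax _]]; apply: nAx; apply/mem_set.
rewrite integral_nneseries //; last 1 first.
- move=> i; apply/measurable_EFinP; apply: measurable_indic.
  exact: measurable_first_hit.
apply: eq_eseriesr => i _.
by rewrite integral_indic ?setIT //; exact: measurable_first_hit.
Qed.

End section_count.

Section edge_measure.
Context d (T : measurableType d) (R : realType) (P : probability T R).
Context (E : set (T * T)) (f : nat -> T -> T).
Hypotheses (mdiag : measurable [set p : T * T | p.1 = p.2]) (mE : measurable E)
  (mf : forall i, measurable_fun setT (f i))
  (Ef : forall x y, E (x, y) -> exists i, y = f i x)
  (bE : bounded_degree E).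

Let fE x : finite_set [set y | E (x, y)].
Proof. by case: bE => D /(_ x)[]. Qed.

Let swap (p : T * T) := (p.2, p.1).

Let mswap (S : set (T * T)) : measurable S -> measurable (swap @^-1` S).
Proof.
move=> mS; rewrite -[X in measurable X]setTI.
by apply: measurable_fun_pair mS.
Qed.

Let nu i (S : set (T * T)) : \bar R := P (first_hit f i (E `&` S)).
Let nu' i (S : set (T * T)) : \bar R := P (first_hit f i (E `&` swap @^-1` S)).

Let nu0 i : nu i set0 = 0%E.
Proof. by rewrite /nu setI0 (_ : first_hit _ _ _ = set0) ?measure0 // -subset0 => x []. Qed.

Let nu_ge0 i S : (0 <= nu i S)%E. Proof. exact: measure_ge0. Qed.

Let first_hit_bigcup i (F : nat -> set (T * T)) :
  first_hit f i (E `&` \bigcup_n F n) = \bigcup_n first_hit f i (E `&` F n).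
Proof.
apply/seteqP; split=> [x [[Ex [n _ Fx]] hx]|x [n _ [[Ex Fx] hx]]].
  by exists n.
by split=> //; split=> //; exists n.
Qed.

Let nu_sa i : semi_sigma_additive (nu i).
Proof.
move=> F mF tF mUF; rewrite /nu first_hit_bigcup.
apply: measure_semi_sigma_additive.
- by move=> n; apply: measurable_first_hit => //; exact: measurableI.
- move=> n m _ _ [x [[[_ Fn] _] [[_ Fm] _]]]; apply: tF => //.
  by exists (x, f i x).
- rewrite -first_hit_bigcup; apply: measurable_first_hit => //.
  exact: measurableI.
Qed.

HB.instance Definition _ i := isMeasure.Build _ _ _ (nu i) (nu0 i) (nu_ge0 i) (nu_sa (i:=i)).

Let nu'0 i : nu' i set0 = 0%E.
Proof. exact: (nu0 i). Qed.

Let nu'_ge0 i S : (0 <= nu' i S)%E. Proof. exact: measure_ge0. Qed.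

Let nu'_sa i : semi_sigma_additive (nu' i).
Proof.
move=> F mF tF mUF.
have := @nu_sa i (fun n => swap @^-1` F n); rewrite -preimage_bigcup; apply.
- by move=> n; exact: mswap.
- by move=> n m _ _ [p [Fn Fm]]; apply: tF => //; exists (swap p).
- exact: mswap.
Qed.

HB.instance Definition _ i := isMeasure.Build _ _ _ (nu' i) (nu'0 i) (nu'_ge0 i) (nu'_sa (i:=i)).

Let measurable_deg (B : set T) : measurable B ->
  measurable_fun setT (fun x => ((deg E B x)%:R : R)%:E).
Proof.
move=> mB.
rewrite (_ : (fun x => _) = (fun x =>
    \sum_(0 <= i <oo | i \in xpredT) (\1_(first_hit f i (E `&` setT `*` B)) x)%:E)%E); last first.
  apply/funext => x; rewrite -card_section; last 2 first.
  - by apply: sub_finite_set (fE x) => y [].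
  - by move=> y [/Ef].
  rewrite /deg (_ : [set y | E (x, y) /\ B y] = [set y | (E `&` setT `*` B) (x, y)]) //.
  by apply/seteqP; split=> [y [? ?]|y [? []]].
apply: ge0_emeasurable_sum => // i _; apply/measurable_EFinP.
apply: measurable_indic; apply: measurable_first_hit => //.
by apply: measurableI => //; exact: measurableX.
Qed.

Let nuT : (mseries nu 0 setT < +oo)%E.
Proof.
have -> : mseries nu 0 setT = (\int[P]_(x in setT) ((deg E setT x)%:R)%:E)%E.
  rewrite (integral_deg mdiag mf) // setXTT.
  by apply: eq_eseriesr => i _.
have [D HD] := bE.
apply: (@le_lt_trans _ _ (\int[P]_(x in setT) (cst (D%:R%:E : \bar R) x))%E).
  apply: ge0_le_integral => //; first exact: measurable_deg.
  move=> x _; rewrite lee_fin ler_nat /deg.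
  have [_] := HD x; apply: leq_trans.
  rewrite (_ : [set y | E (x, y) /\ _] = [set y | E (x, y)]) //.
  by apply/seteqP; split=> [y []|y].
have PT : P setT = 1%E := probability_setT P.
by rewrite integral_cst // [X in (_ * X)%E]PT mule1 ltry.
Qed.

(** Both sides are measures in [S] that agree on rectangles by mass transport. Rectangles form a
    generating class closed under intersection, and bounded degree makes the total mass finite, so
    the measures coincide. *)
Lemma edge_measure_swap (S : set (T * T)) :
  (forall A B : set T, measurable A -> measurable B ->
     (\int[P]_(x in A) ((deg E B x)%:R)%:E = \int[P]_(x in B) ((deg E A x)%:R)%:E)%E) ->
  measurable S ->
  (\sum_(0 <= i <oo) P (first_hit f i (E `&` S)) =
   \sum_(0 <= i <oo) P (first_hit f i (E `&` [set p | S (p.2, p.1)])))%E.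
Proof.
move=> mt mS; rewrite -[LHS]/(mseries nu 0 S) -[RHS]/(mseries nu' 0 S).
apply: (measure_unique [set A `*` B | A in measurable & B in measurable] (fun=> setT)) => //.
- exact: measurable_prod_measurableType.
- move=> _ _ [A mA [B mB <-]] [A' mA' [B' mB' <-]].
  exists (A `&` A'); first exact: measurableI.
  by exists (B `&` B'); [exact: measurableI | rewrite setXI].
- by move=> _; exists setT => //; exists setT => //; rewrite setXTT.
- by rewrite bigcup_const.
- move=> _ [A mA [B mB <-]].
  transitivity (\int[P]_(x in A) ((deg E B x)%:R)%:E)%E.
    by rewrite (integral_deg mdiag mf).
  rewrite mt // (integral_deg mdiag mf) //; apply: eq_eseriesr => i _.
  rewrite /nu'; congr (P (first_hit _ _ _)); congr (_ `&` _).
  by apply/seteqP; split=> -[x y] [].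
Qed.

End edge_measure.

Lemma standard_Borel_diag (R : realType) d (T : measurableType d) :
  standard_Borel R T -> measurable [set p : T * T | p.1 = p.2].
Proof.
move=> [g [gI [_ [mg _]]]].
have -> : [set p : T * T | p.1 = p.2] = (fun p => g p.1 - g p.2) @^-1` [set 0].
  apply/seteqP; split=> [[x y] /= ->|[x y] /= /eqP]; first by rewrite subrr.
  by rewrite subr_eq0 => /eqP/gI.
rewrite -[X in measurable X]setTI; apply: measurable_funB => //.
  by apply: measurableT_comp => //; exact: measurable_fst.
by apply: measurableT_comp => //; exact: measurable_snd.
Qed.

Lemma standard_Borel_enumeration (R : realType) d (T : measurableType d)
    (E : set (T * T)) :
  standard_Borel R T -> measurable E -> bounded_degree E ->
  exists f : nat -> T -> T, (forall i, measurable_fun setT (f i)) /\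
    forall x y, E (x, y) -> exists i, y = f i x.
Proof.
move=> [g [gI [mrg [mg mig]]]] mE /bounded_degree_at_least[n En].
exact: (finite_sections_enumeration gI mrg mg mig mE En).
Qed.

Lemma bounded_degree_sub (T : choiceType) (E F : set (T * T)) :
  F `<=` E -> bounded_degree E -> bounded_degree F.
Proof.
move=> FE [D HD]; exists D => x; have [fE cE] := HD x.
have fF : finite_set [set y | F (x, y)] by apply: sub_finite_set fE => y /FE.
split=> //; apply: leq_trans cE; apply: fsubset_leq_card.
by rewrite -fset_set_sub // => y /FE.
Qed.

(** Mass transport for [F] is the swap invariance of the edge measure of [G] at the set [F] cut by a
    rectangle, which is generally not a rectangle in [pg_E G]. *)
Lemma with_edges_graphing (R : realType) (G : pregraphing R) F :
  is_graphing G -> F `<=` pg_E G -> measurable F ->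
  (forall x y, F (x, y) -> F (y, x)) -> is_graphing (with_edges G F).
Proof.
move=> [sB [hmu [mE [symE [irrE [bE mt]]]]]] FE mF symF.
have mdiag := standard_Borel_diag sB.
have [f [mf Ef]] := standard_Borel_enumeration sB mE bE.
do 4!split=> //; split; first by move=> x /FE; exact: irrE.
split; first exact: bounded_degree_sub bE.
move=> A B mA mB; rewrite /= !(integral_trim hmu).
have fF x : finite_set [set y | F (x, y)].
  by have [D HD] := bounded_degree_sub FE bE; have [] := HD x.
have Ff x y : F (x, y) -> exists i, y = f i x by move=> /FE/Ef.
rewrite !(integral_deg mdiag mf) //.
have mFAB : measurable (F `&` A `*` B) by apply: measurableI => //; exact: measurableX.
have := @edge_measure_swap _ _ _ (trim hmu) _ _ mdiag mE mf Ef bE _ _ mFAB.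
rewrite setIA (setIidr FE) => ->; last first.
  by move=> A' B' mA' mB'; rewrite -!(integral_trim hmu); exact: mt.
apply: eq_eseriesr => i _; congr (trim hmu (first_hit _ _ _)).
apply/seteqP; split=> [[x y] [_ [/= /symF ? []]]|[x y] [/= ? [? ?]]] //.
by split; [exact: FE | split=> //=; exact: symF].
Qed.

(** No neighbour is reached by two different involutions, so [first_hit] loses nothing. The preimage
    under [t i] of the starting points of edges from [A] to [B] consists of those from [B] to [A],
    so mass transport holds for each [i] separately. *)
Lemma involution_graphing (R : realType) (H : pregraphing R) (C : nat)
    (t : nat -> pg_carrier H -> pg_carrier H) :
  standard_Borel R (pg_carrier H) -> is_probability_measure (pg_mu H) ->
  (forall i, measurable_fun setT (t i)) ->
  (forall i A, measurable A -> pg_mu H (t i @^-1` A) = pg_mu H A) ->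
  (forall i x, t i (t i x) = x) ->
  (forall i x, (C <= i)%N -> t i x = x) ->
  (forall i j x, t i x = t j x -> t i x <> x -> i = j) ->
  pg_E H = [set p | p.1 <> p.2 /\ exists i, p.2 = t i p.1] ->
  is_graphing H.
Proof.
case: H t => dT T mu E /= t sB hmu mt mut tt tC tU EE.
have mdiag := standard_Borel_diag sB.
have mE : measurable E.
  rewrite EE -[measurable _]/(mpred _).
  apply: mpredA; first exact: (mpredN mdiag).
  apply: mpred_exists => i.
  apply: (@mpred_pre _ _ _ _ (fun p => (p.2, t i p.1)) [set p | p.1 = p.2]) => //.
  by apply: measurable_fun_pair => //; exact: measurableT_comp.
have Et x y : E (x, y) -> exists i, y = t i x by rewrite EE => -[].
have Es x y : E (x, y) -> E (y, x).
  by rewrite EE => -[/= xy [i yi]]; split=> /=; [exact: nesym | exists i; rewrite yi tt].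
have Ehit x : [set y | E (x, y)] `<=` [set` [seq t i x | i <- iota 0 C]].
  move=> y /=; rewrite EE => -[/= xy [i yi]]; rewrite yi; apply: map_f.
  rewrite mem_iota /= add0n ltnNge; apply/negP => Ci.
  by apply: xy; rewrite yi tC.
have fE x : finite_set [set y | E (x, y)].
  exact: sub_finite_set (Ehit x) (finite_seq _).
have bE : bounded_degree E.
  exists C => x; split=> //.
  have := @uniq_leq_size _ (fset_set [set y | E (x, y)]) [seq t i x | i <- iota 0 C].
  rewrite size_map size_iota; apply; first exact: fset_uniq.
  by move=> y; rewrite in_fset_set // => /set_mem/Ehit.
do 4!split=> //; split; first by move=> x; rewrite EE => -[].
split=> // A B mA mB; rewrite /= !(integral_trim hmu) !(integral_deg mdiag mt) //.
have hitE i S : S `<=` E -> first_hit t i S = [set x | S (x, t i x)].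
  move=> SE; apply/seteqP; split=> [x []//|x /= Sx]; split=> // j tij.
  have [/= tx _] : [set p | p.1 <> p.2 /\ exists i, p.2 = t i p.1] (x, t i x).
    by rewrite -EE; exact: SE.
  have ij : i = j by apply: tU tij _ => h; apply: tx.
  by have := ltn_ord j; rewrite -ij ltnn.
apply: eq_eseriesr => i _.
rewrite !hitE; [|exact: subIsetl|exact: subIsetl].
have mAB (A' B' : set T) : measurable A' -> measurable B' ->
    measurable [set x | (E `&` A' `*` B') (x, t i x)].
  move=> mA' mB'; rewrite -[measurable _]/(mpred _).
  apply: (@mpred_pre _ _ _ _ (fun x => (x, t i x))); first exact: measurable_fun_pair.
  by apply: measurableI => //; exact: measurableX.
rewrite [LHS](trimE hmu (mAB _ _ mA mB)) [RHS](trimE hmu (mAB _ _ mB mA)).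
rewrite -(mut i _ (mAB _ _ mA mB)); congr mu.
apply/seteqP; split=> x /= [] /Es; rewrite /= tt => ? [/= ? ?]; by split.
Qed.

(** * Finite graphs as graphings *)

Section finite_graphs.
Context (R : realType) (m : nat).

Lemma fvert_finite (A : set (fvert m)) : finite_set A.
Proof. exact: (@finite_finset 'I_m.+1). Qed.

Lemma fvert_standard_Borel : standard_Borel R (fvert m).
Proof.
pose g (x : fvert m) : R := (x : nat)%:R.
have mg (A : set (fvert m)) : measurable (g @` A).
  apply: countable_measurable; first by move=> t; exact: measurable_set1.
  exact/finite_set_countable/finite_image/fvert_finite.
exists g; split; last by split=> //; split=> // _ A _.
by move=> x y /eqP; rewrite eqr_nat => /eqP/val_inj.
Qed.

Lemma fin_prob (adj : rel 'I_m.+1) : is_probability_measure (pg_mu (fin_graphing R adj)).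
Proof.
have c0 : 0 <= m.+1%:R^-1 :> R by rewrite invr_ge0.
pose c : {nonneg R} := NngNum c0.
pose cm : {measure set (fvert m) -> \bar R} := counting.
have muE (A : set (fvert m)) : pg_mu (fin_graphing R adj) A = mscale c cm A.
  have -> : mscale c cm A = (m.+1%:R^-1%:E * counting A)%E by [].
  rewrite /counting asboolT; last exact: fvert_finite.
  by rewrite -EFinM mulrC.
have -> : pg_mu (fin_graphing R adj) = mscale c cm.
  by apply/funext.
split; first by rewrite measure0.
split; first by move=> A _; exact: measure_ge0.
split; first exact: measure_semi_sigma_additive.
rewrite -muE /= (@card_fset_set_seq _ _ (enum 'I_m.+1)) ?enum_uniq //.
  by rewrite size_enum_ord divff ?pnatr_eq0.
by move=> y; rewrite mem_enum.
Qed.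

End finite_graphs.

(** Every edge is the transposition of its ends, indexed by the pair in increasing order so that it
    occurs once; permutations preserve the uniform measure. *)
Lemma fin_graphing_graphing (R : realType) m (adj : rel 'I_m.+1) :
  symmetric adj -> irreflexive adj -> is_graphing (fin_graphing R adj).
Proof.
move=> sadj iadj.
pose I := ('I_m.+1 * 'I_m.+1)%type.
pose t (i : nat) (x : fvert m) : fvert m :=
  if @pickle_inv I i is Some p then
    if (p.1 < p.2)%N && adj p.1 p.2 then tperm p.1 p.2 x else x
  else x.
have tt i x : t i (t i x) = x.
  by rewrite /t; case: pickle_inv => // p; case: (_ && _) => //; exact: tpermK.
pose C := (\max_(p : I) choice.pickle p).+1%N.
have pC i p : @pickle_inv I i = Some p -> choice.pickle p = i.
  by move=> ip; have := @pickle_invK I i; rewrite ip.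
apply: (@involution_graphing R (fin_graphing R adj) C t).
- exact: fvert_standard_Borel.
- exact: fin_prob.
- by move=> i _ A _.
- move=> i A _ /=; congr (_ / _)%:E; congr _%:R.
  have -> : t i @^-1` A = t i @` A.
    apply/seteqP; split=> [x Ax|_ [x Ax <-]] /=; last by rewrite tt.
    by exists (t i x).
  rewrite fset_set_image; last exact: fvert_finite.
  by rewrite card_imfset //; exact: (can_inj (tt i)).
- exact: tt.
- move=> i x + ; rewrite /t; case ip: pickle_inv => [p|//].
  have iC := @leq_bigmax I (fun p : I => choice.pickle p) p.
  by rewrite (pC _ _ ip) in iC; move=> /leq_trans/(_ iC); rewrite ltnn.
- move=> i j x; rewrite /t.
  case ip: (pickle_inv i) => [p|//]; case: ifP => // /andP[plt padj].
  case jq: (pickle_inv j) => [q|]; last by move=> ->.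
  case: ifP => [/andP[qlt qadj]|_ ->//] pq px.
  suff pqE : p = q by rewrite -(pC _ _ ip) -(pC _ _ jq) pqE.
  case: p q {ip jq} plt padj qlt qadj pq px => [a b] [a' b'] /= ab _ a'b' _.
  case: tpermP => [xa|xb|//]; case: tpermP => [xa'|xb'|_ _ -> //] e _.
  + by rewrite -xa -xa' e.
  + by move: a'b'; rewrite -e -xb' xa ltnNge ltnW.
  + by move: ab; rewrite e -xb xa' ltnNge ltnW.
  + by rewrite -xb -xb' e.
- rewrite /fin_graphing /=; apply/seteqP; split=> [[x y] /= xy|[x y] /= [xy [i]]].
    have nxy : x <> y by move=> e; move: xy; rewrite e iadj.
    split=> //; have [lt|lt|/val_inj//] := ltngtP x y.
      by exists (choice.pickle ((x, y) : I)); rewrite /t pickleK_inv /= lt xy tpermL.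
    by exists (choice.pickle ((y, x) : I)); rewrite /t pickleK_inv /= lt sadj xy tpermR.
  rewrite /t; case: pickle_inv => [p|/esym//]; case: ifP => [/andP[_ padj]|_ /esym//].
  by case: tpermP => [-> -> //|-> ->|_ _ /esym//]; rewrite sadj.
Qed.

(** * Finitely many ball types *)

Lemma within_trans (T : Type) (E : set (T * T)) s t x y z :
  within E s x y -> within E t y z -> within E (t + s) x z.
Proof.
move=> xy; elim: t z => [|t IHt] z /=; first by move=> <-.
by move=> [/IHt|[w [/IHt xw wz]]]; [left | right; exists w].
Qed.

Lemma within_edge (T : Type) (E : set (T * T)) x y : E (x, y) -> within E 1 x y.
Proof. by move=> Exy; right; exists x. Qed.

Lemma within_sym (T : Type) (E : set (T * T)) r x y :
  (forall x y, E (x, y) -> E (y, x)) -> within E r x y -> within E r y x.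
Proof.
move=> sE; elim: r y => [|r IHr] y /=; first by [].
move=> [/IHr|[z [/IHr zx /sE yz]]]; first by left.
rewrite -[_ \/ _]/(within E r.+1 y x) -addn1.
exact: within_trans (within_edge yz) zx.
Qed.

Definition degree_le {T : choiceType} (E : set (T * T)) (D : nat) : Prop :=
  forall x, exists s : seq T, (size s <= D)%N /\ forall y, E (x, y) -> y \in s.

Lemma bounded_degree_le (T : choiceType) (E : set (T * T)) :
  bounded_degree E -> exists D, degree_le E D.
Proof.
move=> [D HD]; exists D => x; have [fE cE] := HD x.
exists (fset_set [set y | E (x, y)]); split=> // y Exy.
by rewrite in_fset_set //; apply/mem_set.
Qed.

Lemma degree_leW (T : choiceType) (E : set (T * T)) D D' :
  (D <= D')%N -> degree_le E D -> degree_le E D'.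
Proof. by move=> DD' HD x; have [s [sD Hs]] := HD x; exists s; rewrite (leq_trans sD). Qed.

(** Each step adds at most [D] neighbours per vertex, a factor [D.+1]. The root is listed apart, so
    that [size s] bounds the conflicts in a greedy colouring. *)
Lemma ball_seq (T : choiceType) (E : set (T * T)) D r x : degree_le E D ->
  exists s : seq T, [/\ uniq (x :: s), (size s < D.+1 ^ r)%N &
    forall y, y \in x :: s <-> within E r x y].
Proof.
move=> HD; elim: r => [|r [s [us ss sE]]].
  by exists [::]; split=> // y; rewrite inE; split=> [/eqP ->|->].
have /choice[nb Hnb] := HD.
pose t := (x :: s) ++ flatten [seq nb z | z <- x :: s].
have tE y : within E r.+1 x y -> y \in t.
  move=> /= [/sE|[z [/sE zs /(proj2 (Hnb z)) yz]]]; rewrite mem_cat; first by move=> ->.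
  by apply/orP; right; apply/flattenP; exists (nb z) => //; exact: map_f.
have st : (size t <= D.+1 ^ r.+1)%N.
  rewrite size_cat size_flatten /shape -map_comp expnS mulSn leq_add //.
  have -> : sumn [seq (size \o nb) i | i <- x :: s] = (\sum_(z <- x :: s) size (nb z))%N.
    by rewrite sumnE big_map.
  apply: (@leq_trans (\sum_(z <- x :: s) D)%N).
    by apply: leq_sum => z _; have [] := Hnb z.
  by rewrite big_const_seq count_predT iter_addn_0 leq_mul2l ss orbT.
pose u := [seq y <- undup t | `[< within E r.+1 x y >] ].
have uE y : y \in u <-> within E r.+1 x y.
  rewrite mem_filter mem_undup; split=> [/andP[/asboolP]//|xy].
  by rewrite tE // andbT; apply/asboolP.
have xu : x \in u by apply/uE; exact: within_refl.
exists (rem x u); split.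
- by rewrite /= rem_filter ?filter_uniq ?undup_uniq // mem_filter /= eqxx.
- rewrite size_rem // prednK; last by rewrite -has_predT; apply/hasP; exists x.
  rewrite (leq_trans _ st) // (leq_trans _ (size_undup t)) // size_filter.
  exact: count_size.
- by move=> y; rewrite -uE; have /perm_mem -> := perm_to_rem xu.
Qed.

Lemma cgraph_enum k M : exists N (dec : 'I_N -> cgraph k),
  forall b, (cg_size k b <= M)%N -> exists i, dec i = b.
Proof.
pose I : finType :=
  {n : 'I_M.+1 & ({ffun 'I_n.+1 * 'I_n.+1 -> bool} * {ffun 'I_n.+1 -> 'I_k})%type}.
pose d (i : I) := @CGraph k _ (fun u v => (tagged i).1 (u, v)) (fun u => (tagged i).2 u).
exists #|{: I}|, (fun i => d (enum_val i)) => -[n adj col] /= nM.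
pose z : I := existT _ (Ordinal (nM : n < M.+1)%N)
  ([ffun p => adj p.1 p.2], [ffun u => col u]).
exists (enum_rank z); rewrite enum_rankK /d /=.
by congr CGraph; apply/funext => u; [apply/funext => v|]; rewrite ffunE.
Qed.

Definition ciso {k : nat} (b b' : cgraph k) : Prop :=
  exists h : 'I_(cg_size k b').+1 -> 'I_(cg_size k b).+1,
    [/\ injective h, forall j, exists i, h i = j, h ord0 = ord0,
        forall i j, cg_adj b' i j = cg_adj b (h i) (h j) &
        forall i, cg_col b' i = cg_col b (h i)].

Lemma has_cball_ciso (T : Type) (E : set (T * T)) k (c : T -> 'I_k) r b b' x :
  has_cball E c r b x -> has_cball E c r b' x -> ciso b b'.
Proof.
move=> [phi [[phiI [phi0 [phir phia]]] phic]] [psi [[psiI [psi0 [psir psia]]] psic]].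
have /choice[h Hh] i : exists j, phi j = psi i.
  have : range psi (psi i) by exists i.
  by rewrite psir -phir => -[j _ <-]; exists j.
exists h; split.
- by move=> i j hij; apply: psiI; rewrite -!Hh hij.
- move=> j; have : range phi (phi j) by exists j.
  by rewrite phir -psir => -[i _ ij]; exists i; apply: phiI; rewrite Hh.
- by apply: phiI; rewrite Hh phi0.
- by move=> i j; apply/idP/idP; rewrite psia phia !Hh.
- by move=> i; rewrite -psic -phic Hh.
Qed.

Lemma ciso_has_cball (T : Type) (E : set (T * T)) k (c : T -> 'I_k) r b b' x :
  ciso b b' -> has_cball E c r b x -> has_cball E c r b' x.
Proof.
move=> [h [hI hS h0 ha hc]] [phi [[phiI [phi0 [phir phia]]] phic]].
exists (phi \o h); split; last by move=> i /=; rewrite phic hc.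
split; first exact: inj_comp.
split; first by rewrite /= h0.
split; last by move=> i j; rewrite ha phia.
rewrite -phir; apply/seteqP; split=> [_ [i _ <-]|_ [j _ <-]]; first by exists (h i).
by have [i <-] := hS j; exists i.
Qed.

Lemma has_cball_exists (T : choiceType) (E : set (T * T)) k (c : T -> 'I_k) D r x :
  degree_le E D -> exists b, (cg_size k b <= D.+1 ^ r)%N /\ has_cball E c r b x.
Proof.
move=> /(ball_seq r x)[s [us ss sE]].
pose phi (i : 'I_(size s).+1) := nth x (x :: s) i.
exists (@CGraph k (size s) (fun i j => `[< E (phi i, phi j) >]) (c \o phi)).
split; first exact: ltnW.
exists phi; split=> //; split.
  by move=> i j /eqP; rewrite nth_uniq // => /eqP/val_inj.
split=> //; split; last by move=> i j; split=> /asboolP.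
apply/seteqP; split=> [_ [i _ <-] /=|y /= /sE ys].
  by apply/sE; exact: mem_nth.
have iy : (index y (x :: s) < (size s).+1)%N by rewrite index_mem.
by exists (Ordinal iy) => //; rewrite /phi nth_index.
Qed.

Section coloured_statistics.
Variable R : realType.

Lemma Pr_with_edges (H : pregraphing R) F r a :
  Pr r (with_edges H F) a = fine (pg_mu H (has_ball F r a)).
Proof. by []. Qed.

(* [canonical i] selects one code in each isomorphism class. *)
Lemma measure_by_cball (H : pregraphing R) k (c : pg_carrier H -> 'I_k) r N
    (dec : 'I_N -> cgraph k) (A : set (pg_carrier H)) (p : pred 'I_N) :
  let canonical (i : 'I_N) := `[< forall j : 'I_N, (j < i)%N -> ~ ciso (dec i) (dec j) >] in
  is_graphing H -> borel_coloring H c ->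
  (forall x, exists i, has_cball (pg_E H) c r (dec i) x) ->
  (forall i x, has_cball (pg_E H) c r (dec i) x -> (A x <-> p i)) ->
  fine (pg_mu H A) = \sum_(i < N | canonical i && p i) Prc r H c (dec i).
Proof.
move=> canonical HG mc cov HA.
have [sB [hmu [mE [_ [_ [bE _]]]]]] := HG.
have mdiag := standard_Borel_diag sB.
have [f [mf Ef]] := standard_Borel_enumeration sB mE bE.
pose X i := has_cball (pg_E H) c r (dec i).
have mX i : measurable (X i) by exact: (measurable_has_cball mdiag mE mf Ef).
have AE : A = \big[setU/set0]_(i < N | canonical i && p i) X i.
  rewrite -bigcup_seq_cond; apply/seteqP; split=> [x Ax|x [i /= /and3P[_ _ pi] Xi]]; last first.
    by apply/(HA _ _ Xi).
  have ex : exists n, `[< exists i : 'I_N, i = n :> nat /\ X i x >].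
    by have [i Xi] := cov x; exists i; apply/asboolP; exists i.
  case: (ex_minnP ex) => n /asboolP[i [<- Xi]] Hmin; exists i => //=.
  rewrite mem_index_enum (HA _ _ Xi).1 // andbT; apply/asboolP => j ji dij.
  have Xj := ciso_has_cball dij Xi.
  have := Hmin j; rewrite leqNgt ji => H'.
  by have : false by apply: H'; apply/asboolP; exists j.
have PA := @measure_bigsetU_ord_cond _ _ _ (trim hmu) N
  (fun i => canonical i && p i) X (fun i _ => mX i).
have mA : measurable A by rewrite AE; apply: bigsetU_measurable.
rewrite -(trimE hmu mA) {1}AE PA.
  rewrite -sum_fine; last by move=> i _; exact: fin_num_measure.
  by apply: eq_bigr => i _; congr fine; exact: trimE (mX i).
move=> i j /= /andP[/asboolP ci _] /andP[/asboolP cj _] [x [Xi Xj]].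
apply: val_inj; have [ij|ji|//] := ltngtP (val i) (val j).
  by exfalso; apply: (cj i ij); exact: has_cball_ciso Xj Xi.
by exfalso; apply: (ci j ji); exact: has_cball_ciso Xi Xj.
Qed.

Definition colour_edges (H : pregraphing R) k (c : pg_carrier H -> 'I_k)
    (P : 'I_k -> 'I_k -> Prop) :=
  pg_E H `&` [set e | P (c e.1) (c e.2)].

Lemma Pr_close k D r : exists N : nat, forall (H H' : pregraphing R)
    (c : pg_carrier H -> 'I_k) (c' : pg_carrier H' -> 'I_k) (delta : R),
  is_graphing H -> is_graphing H' ->
  degree_le (pg_E H) D -> degree_le (pg_E H') D ->
  borel_coloring H c -> borel_coloring H' c' ->
  (forall b, `|Prc r H c b - Prc r H' c' b| <= delta) ->
  forall P s a, (s <= r)%N ->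
  `|Pr s (with_edges H (colour_edges c P)) a -
    Pr s (with_edges H' (colour_edges c' P)) a| <= N%:R * delta.
Proof.
have [N [dec Hdec]] := cgraph_enum k (D.+1 ^ r).
exists N => H H' c c' delta HG HG' dH dH' mc mc' Hd P s a sr.
have cov : forall x, exists i, has_cball (pg_E H) c r (dec i) x.
  move=> x; have [b [/Hdec[i <-] ?]] := has_cball_exists c r x dH; by exists i.
have cov' : forall x, exists i, has_cball (pg_E H') c' r (dec i) x.
  move=> x; have [b [/Hdec[i <-] ?]] := has_cball_exists c' r x dH'; by exists i.
pose A := has_ball (colour_edges c P) s a.
pose A' := has_ball (colour_edges c' P) s a.
(* Asking for a witness in either graph makes both sums run over the same types; by [has_cball_sub]
   one witness decides for all vertices of the type. *)
pose p i := `[< (exists2 x, has_cball (pg_E H) c r (dec i) x & A x) \/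
                (exists2 x, has_cball (pg_E H') c' r (dec i) x & A' x) >].
rewrite !Pr_with_edges (@measure_by_cball H k c r N dec _ p) //; last first.
  move=> i x Xi; split=> [Ax|/asboolP[[y Xy Ay]|[y Xy Ay]]].
  - by apply/asboolP; left; exists x.
  - exact/(has_cball_sub P a sr Xi Xy).
  - exact/(has_cball_sub P a sr Xi Xy).
rewrite (@measure_by_cball H' k c' r N dec _ p) //; last first.
  move=> i x Xi; split=> [Ax|/asboolP[[y Xy Ay]|[y Xy Ay]]].
  - by apply/asboolP; right; exists x.
  - exact/(has_cball_sub P a sr Xi Xy).
  - exact/(has_cball_sub P a sr Xi Xy).
rewrite -sumrB (le_trans (ler_norm_sum _ _ _)) //.
rewrite (@le_trans _ _ (\sum_(i < N) delta)) //.
  rewrite big_mkcond /=; apply: ler_sum => i _; case: ifP => _; first exact: Hd.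
  exact: le_trans (normr_ge0 _) (Hd (dec i)).
by rewrite sumr_const card_ord mulr_natl.
Qed.

End coloured_statistics.

(** * Colourings *)

Lemma greedy_colouring (V : finType) (e : rel V) (D : nat) : symmetric e ->
  (forall x, #|[set y | e x y & y != x]%SET| <= D)%N ->
  exists c : V -> 'I_D.+1, forall x y, x != y -> e x y -> c x != c y.
Proof.
move=> se De.
suff [c Hc] : exists c : V -> 'I_D.+1,
    forall x y, x \in enum V -> y \in enum V -> x != y -> e x y -> c x != c y.
  by exists c => x y; apply: Hc; rewrite mem_enum.
elim: (enum V) => [|x s [c Hc]]; first by exists (fun=> ord0).
pose forb := [set c y | y in [set y | e x y & y != x]%SET]%SET.
have [k kf] : exists k, k \notin forb.
  apply/existsP; rewrite -negb_forall; apply/negP => /forallP H.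
  have : (#|[set: 'I_D.+1]%SET| <= #|forb|)%N.
    by apply: subset_leq_card; apply/fintype.subsetP => k _.
  rewrite cardsT card_ord => /leq_trans /(_ (leq_imset_card _ _)).
  by move=> /leq_trans /(_ (De x)); rewrite ltnn.
have ck y : e x y -> y != x -> c y != k.
  by move=> exy yx; apply: contra kf => /eqP <-; apply: imset_f; rewrite inE exy.
exists (fun y => if y == x then k else c y) => y z; rewrite !inE.
have [-> _|yx /= ys] := eqVneq y x; have [->|zx /= zs] := eqVneq z x => //.
- by move=> _ exz; rewrite eq_sym; exact: ck.
- by move=> _ _ eyx; apply: ck => //; rewrite se.
- exact: Hc.
Qed.

Lemma fin_degree_le (R : realType) m (adj : rel 'I_m.+1) D :
  (forall v : 'I_m.+1, #|adj v| <= D)%N -> degree_le (pg_E (fin_graphing R adj)) D.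
Proof.
move=> HD x; exists (enum (adj x) : seq (fvert m)); split; first by rewrite -cardE.
by move=> y xy; rewrite mem_enum.
Qed.

(** Greedy colouring of the graph that joins vertices at distance at most [r]; [ball_seq] bounds its
    degrees. *)
Lemma distance_colouring (R : realType) m (adj : rel 'I_m.+1) D r : symmetric adj ->
  (forall v : 'I_m.+1, #|adj v| <= D)%N ->
  exists c : 'I_m.+1 -> 'I_(D.+1 ^ r).+1, forall x y : 'I_m.+1, x <> y ->
    within (pg_E (fin_graphing R adj)) r x y -> c x <> c y.
Proof.
move=> sadj HD; pose E := pg_E (fin_graphing R adj).
have sE (x y : fvert m) : E (x, y) -> E (y, x) by rewrite /E /= sadj.
pose e : rel 'I_m.+1 := fun x y => `[< within E r x y >].
have [||c Hc] := @greedy_colouring _ e (D.+1 ^ r).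
- by move=> x y; apply/asboolP/asboolP; exact: within_sym.
- move=> x; have [s [_ ss sE']] := ball_seq r (x : fvert m) (@fin_degree_le R _ _ _ HD).
  apply: leq_trans (ltnW ss); rewrite cardE; apply: uniq_leq_size; first exact: enum_uniq.
  move=> y; rewrite mem_enum inE => /andP[/asboolP/sE' + yx].
  by rewrite inE (negbTE yx).
- by exists c => x y /eqP xy exy; apply/eqP/Hc => //; apply/asboolP.
Qed.

(* Edge colourings in [k.+1] colours are encoded by vertex colourings: besides a
   colour in [U], a vertex stores the colour of the edge leading to the
   neighbour of each colour. *)
Definition code_type (U : finType) (k : nat) : finType :=
  (U * {ffun U -> 'I_k.+1})%type.

(** Local-global convergence returns arbitrary vertex colourings, whose two ends may disagree about
    an edge; the default keeps decoding symmetric. *)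
Definition edge_code {U : finType} {k : nat} (u v : code_type U k) : 'I_k.+1 :=
  if u.2 v.1 == v.2 u.1 then u.2 v.1 else ord0.

Lemma edge_codeC U k (u v : code_type U k) : edge_code u v = edge_code v u.
Proof. by rewrite /edge_code eq_sym; case: eqP => // ->. Qed.

Definition decode_edges {T : Type} {U : finType} {k : nat}
    (c : T -> 'I_#|{: code_type U k}|) (e : T * T) : 'I_k.+1 :=
  edge_code (enum_val (c e.1)) (enum_val (c e.2)).

(** * Transfer of edge colourings in both directions *)

Section transfer.
Variable R : realType.

Lemma measurable_colour_rel (H : pregraphing R) k (c : pg_carrier H -> 'I_k)
    (P : 'I_k -> 'I_k -> Prop) : borel_coloring H c ->
  measurable [set e : pg_carrier H * pg_carrier H | P (c e.1) (c e.2)].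
Proof.
move=> mc; rewrite -[measurable _]/(mpred _).
apply: (@eq_mpred _ _ (fun e => exists i, exists j, c e.1 = i /\ c e.2 = j /\ P i j)).
  by move=> e; split=> [[i [j [-> [-> ]]]]//|Pe]; exists (c e.1), (c e.2).
apply: mpred_exists => i; apply: mpred_exists => j.
apply: mpredA; first exact: (@mpred_pre _ _ _ _ fst (c @^-1` [set i])).
apply: mpredA; last exact: mpred_cst.
exact: (@mpred_pre _ _ _ _ snd (c @^-1` [set j])).
Qed.

Lemma decode_edge_map (H : pregraphing R) U k
    (c : pg_carrier H -> 'I_#|{: code_type U k}|) :
  is_graphing H -> borel_coloring H c -> edge_map H (decode_edges c).
Proof.
move=> [_ [_ [mE _]]] mc; split; first by move=> x y; exact: edge_codeC.
move=> i; apply: measurableI => //.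
exact: (@measurable_colour_rel _ _ c (fun u v => edge_code (enum_val u) (enum_val v) = i)).
Qed.

Lemma edge_map_subset (H : pregraphing R) k (F : pg_carrier H * pg_carrier H -> 'I_k)
    (S : {set 'I_k}) : edge_map H F ->
  measurable (pg_E H `&` [set e | F e \in S]).
Proof.
move=> [_ mF]; rewrite -[measurable _]/(mpred _).
apply: (@eq_mpred _ _ (fun e => exists i, i \in S /\ (pg_E H `&` F @^-1` [set i]) e)).
  move=> e; split=> [[i [iS [Ee /= Fi]]]|[Ee Fe]]; last by exists (F e).
  by split=> //=; rewrite Fi.
by apply: mpred_exists => i; apply: mpredA; [exact: mpred_cst | exact: mF].
Qed.

Definition colour_class (H : pregraphing R) k (F : pg_carrier H * pg_carrier H -> 'I_k)
    (S : {set 'I_k}) : pregraphing R :=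
  with_edges H (pg_E H `&` [set e | F e \in S]).

Lemma colour_class_graphing (H : pregraphing R) k (F : pg_carrier H * pg_carrier H -> 'I_k)
    (S : {set 'I_k}) : is_graphing H -> edge_map H F ->
  is_graphing (colour_class F S).
Proof.
move=> HG eF; apply: with_edges_graphing => //; first exact: edge_map_subset.
move=> x y [Exy Fxy]; split; first by case: HG => _ [_ [_ [+ _]]]; apply.
by rewrite /= (proj1 eF).
Qed.

(** Two neighbours of a vertex are at distance at most 2, hence differently coloured by [c0], so
    decoding [c] returns [F] on every edge. A colouring [c'] of [G] with similar statistics is then
    decoded by the same rule. *)
Lemma transfer_from_finite (m : nat -> nat) (adj : forall n, rel 'I_(m n).+1)
    (G : pregraphing R) D k r (delta : R) :
  (forall n, symmetric (adj n) /\ irreflexive (adj n)) ->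
  (forall n (v : 'I_(m n).+1), (#|adj n v| <= D)%N) ->
  is_graphing G -> local_global_conv (fun n => fin_graphing R (adj n)) G ->
  (1 <= r)%N -> 0 < delta ->
  \forall n \near \oo, forall F, @edge_map R k.+1 (fin_graphing R (adj n)) F ->
    exists2 F', edge_map G F' & forall S s a, (s <= r)%N ->
      `|Pr s (colour_class F S) a - Pr s (colour_class F' S) a| <= delta.
Proof.
move=> sadj HD HG lg r1 d0.
have [D' dG] : exists D', degree_le (pg_E G) D'.
  by apply: bounded_degree_le; case: HG => _ [_ [_ [_ [_ []]]]].
pose U : finType := 'I_(D.+1 ^ 2).+1.
(* [G] has its own degree bound [D'], so ball types are counted for the larger bound. *)
have [N HN] := @Pr_close R #|{: code_type U k}| (maxn D D') r.
have e0 : 0 < delta / N.+1%:R by rewrite divr_gt0.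
have k1 : (1 <= #|{: code_type U k}|)%N.
  by apply/card_gt0P; exists (ord0, [ffun=> ord0]).
have := lg _ r k1 r1 _ e0; apply: filterS => n [lgn _] F eF.
pose H := fin_graphing R (adj n).
have [c0 Hc0] := distance_colouring R 2 (sadj n).1 (HD n).
pose t (x : fvert (m n)) (u : U) : 'I_k.+1 :=
  if [pick y | adj n x y & c0 y == u] is Some y then F (x, y) else ord0.
pose col (x : fvert (m n)) : code_type U k := (c0 x, [ffun u => t x u]).
pose c (x : pg_carrier H) : 'I_#|{: code_type U k}| := enum_rank (col x).
have tE x y : adj n x y -> t x (c0 y) = F (x, y).
  move=> xy; rewrite /t; case: pickP => [z /andP[xz /eqP zy]|/(_ y)]; last first.
    by rewrite xy eqxx.
  congr (F (x, _)); apply: contrapT => zy'; apply: (Hc0 z y) => //.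
  have zx : pg_E H (z, x) by rewrite /= (sadj n).1.
  exact: (within_trans (within_edge zx) (within_edge (_ : pg_E H (x, y)))).
have FE x y : adj n x y -> decode_edges c (x, y) = F (x, y).
  move=> xy; have yx : adj n y x by rewrite (sadj n).1.
  rewrite /decode_edges /= !enum_rankK /edge_code /= !ffunE !tE //.
  by rewrite (proj1 eF y x) eqxx.
have mc : borel_coloring H c by [].
have [_ [c' [mc' ->]] Hc'] := lgn (Prc r H c) (ex_intro _ c (conj mc erefl)).
exists (decode_edges c'); first exact: decode_edge_map.
move=> S s a sr.
have -> : colour_class F S = with_edges H (@colour_edges R H _ c
    (fun u v => edge_code (enum_val u) (enum_val v) \in S)).
  congr (@PreGraphing R _ _ _ _).
  by apply/seteqP; split=> -[x y] [/= xy FS]; split=> //=; move: FS; rewrite -(FE _ _ xy).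
apply: le_trans (HN _ _ c c' (delta / N.+1%:R) _ _ _ _ _ _ _ _ _ a sr) _ => //.
- by apply: fin_graphing_graphing; case: (sadj n).
- exact: degree_leW (leq_maxl D D') (@fin_degree_le R _ _ _ (HD n)).
- exact: degree_leW (leq_maxr D D') dG.
- by rewrite mulrA ler_pdivrMr // mulrC ler_wpM2l ?ler_nat // ltW.
Qed.

Lemma seq_bound (A : eqType) (h : A -> nat) (s : seq A) :
  exists M, forall a, a \in s -> (h a <= M)%N.
Proof.
elim: s => [|b s [M HM]]; first by exists 0%N.
exists (maxn (h b) M) => a; rewrite inE leq_max => /predU1P[->|/HM ->].
  by rewrite leqnn.
by rewrite orbT.
Qed.

Lemma borel_fiber d (T : measurableType d) (J : finType) (p : J -> T -> Prop)
    (Q : {ffun J -> bool} -> Prop) : (forall j, mpred (p j)) ->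
  mpred (fun x => Q [ffun j => `[< p j x >] ]).
Proof.
move=> mp; apply: (@eq_mpred _ _ (fun x => exists v : {ffun J -> bool},
    Q v /\ forall j, p j x <-> v j)).
  move=> x; split=> [[v [Qv vE]]|Qx].
    suff -> : [ffun j => `[< p j x >] ] = v by [].
    by apply/ffunP => j; rewrite ffunE; apply/asboolP/idP => /vE.
  by exists [ffun j => `[< p j x >] ]; split=> // j; rewrite ffunE; split=> /asboolP.
apply: mpred_exists => v; apply: mpredA; first exact: mpred_cst.
by apply: mpred_forall => j; apply: mpred_iff => //; exact: mpred_cst.
Qed.

Lemma fine_prob_close d (T : measurableType d) (P : probability T R) (A B C : set T) :
  measurable A -> measurable B -> measurable C ->
  (forall x, ~ C x -> (A x <-> B x)) -> `|fine (P A) - fine (P B)| <= fine (P C).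
Proof.
move=> mA mB mC ABC.
have le (A' B' : set T) : measurable A' -> measurable B' ->
    (forall x, ~ C x -> A' x -> B' x) -> fine (P A') <= fine (P B') + fine (P C).
  move=> mA' mB' AB'; rewrite -lee_fin EFinD !fineK; try exact: fin_num_measure.
  apply: (@le_trans _ _ (P (B' `|` C))).
    apply: (@le_measure _ _ _ P);
      [exact: mem_set | by apply: mem_set; exact: measurableU |].
    by move=> x Ax; have [Cx|/AB'/(_ Ax)] := pselect (C x); [right | left].
  exact: (@measureU2 _ _ _ P).
rewrite ler_distl lerBlDr; apply/andP; split; apply: le => // x /ABC; tauto.
Qed.

Section separating_bits.
Context (G : pregraphing R) (g : pg_carrier G -> R).
Hypotheses (HG : is_graphing G) (gI : injective g) (mg : measurable_fun setT g).
Let T := pg_carrier G.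
Let E := pg_E G.

Definition bits N (x : T) : {ffun 'I_N -> bool} :=
  [ffun i : 'I_N => g x < ratr (odflt 0 (@choice.unpickle rat i))].

Definition ambiguous r N : set T :=
  [set x | exists y z, [/\ within E r x y, within E r x z &
                           y <> z /\ bits N y = bits N z]].

Lemma mpred_bit i : mpred (fun x : T => g x < ratr (odflt 0 (@choice.unpickle rat i))).
Proof.
have := @mpred_pre _ _ _ _ g `]-oo, (ratr (odflt 0 (@choice.unpickle rat i)))[%classic mg.
by move=> /(_ (measurable_itv _)); apply: eq_mpred => x; rewrite /= in_itv.
Qed.

Lemma mpred_bits N (Q : {ffun 'I_N -> bool} -> Prop) : mpred (fun x => Q (bits N x)).
Proof.
apply: eq_mpred (borel_fiber Q (fun i : 'I_N => mpred_bit i)) => x.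
suff -> : bits N x = [ffun j : 'I_N =>
  `[< g x < ratr (odflt 0 (@choice.unpickle rat j)) >] ] by [].
by apply/ffunP => i; rewrite !ffunE asboolb.
Qed.

Lemma measurable_ambiguous r N : measurable (ambiguous r N).
Proof.
have [sB [_ [mE [_ [_ [bE _]]]]]] := HG.
have mdiag := standard_Borel_diag sB.
have [f [mf Ef]] := standard_Borel_enumeration sB mE bE.
apply: (measurable_within_exists mdiag mE mf Ef r
  (S := [set p | p.1 <> p.2 /\ bits N p.1 = bits N p.2])).
rewrite -[measurable _]/(mpred _); apply: mpredA; first exact: (mpredN mdiag).
apply: (@eq_mpred _ _ (fun p => exists v, bits N p.1 = v /\ bits N p.2 = v)).
  by move=> p; split=> [[v [-> ->]]//|e]; exists (bits N p.1).
apply: mpred_exists => v; apply: mpredA.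
  apply: (@mpred_pre _ _ _ _ fst [set x | bits N x = v]) => //.
  exact: (mpred_bits (fun w => w = v)).
apply: (@mpred_pre _ _ _ _ snd [set x | bits N x = v]) => //.
exact: (mpred_bits (fun w => w = v)).
Qed.

Lemma ambiguous_decr r N M : (N <= M)%N -> ambiguous r M `<=` ambiguous r N.
Proof.
move=> NM x [y [z [xy xz [yz b]]]]; exists y, z; split=> //; split=> //.
apply/ffunP => i; have /ffunP/(_ (widen_ord NM i)) := b.
by rewrite !ffunE.
Qed.

Lemma ambiguous_bigcap r : \bigcap_N ambiguous r N = set0.
Proof.
have [D dE] : exists D, degree_le E D.
  by apply: bounded_degree_le; case: HG => _ [_ [_ [_ [_ []]]]].
rewrite -subset0 => x Hx; have [s [_ _ sE]] := ball_seq r x dE.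
have sep (y z : T) : exists N, y <> z -> bits N y <> bits N z.
  have [->|yz] := pselect (y = z); first by exists 0%N.
  have sepq (u v : T) : g u < g v -> exists N, bits N u <> bits N v.
    move=> /rat_in_itvoo[q]; rewrite in_itv /= => /andP[uq qv].
    exists (choice.pickle q).+1 => /ffunP/(_ ord_max); rewrite !ffunE /= choice.pickleK /= uq.
    by rewrite ltNge (ltW qv).
  have [lt|lt|/gI//] := ltgtP (g y) (g z).
    by have [N] := sepq _ _ lt; exists N.
  by have [N HN] := sepq _ _ lt; exists N => _ /esym.
have /choice[N HN] : forall yz : T * T, exists N, yz.1 <> yz.2 -> bits N yz.1 <> bits N yz.2.
  by move=> yz; exact: sep.
have /choice[M1 HM1] y := seq_bound (fun z => N (y, z)) (x :: s).
have [M HM] := seq_bound M1 (x :: s).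
have [y [z [/sE ys /sE zs [yz b]]]] := Hx M I.
apply: (HN (y, z) yz) => /=; apply/ffunP => i.
have NM : (N (y, z) <= M)%N.
  exact: leq_trans (HM1 y z zs) (HM y ys).
by have /ffunP/(_ (widen_ord NM i)) := b; rewrite !ffunE.
Qed.

(** More bits shrink the ambiguous set, and a finite ball is eventually separated because [g] is
    injective; continuity from above then applies. *)
Lemma ambiguous_small r (delta : R) : 0 < delta ->
  exists N, fine (pg_mu G (ambiguous r N)) <= delta.
Proof.
move=> d0; have [_ [hmu _]] := HG.
have := @nonincreasing_cvg_mu _ _ _ (trim hmu) (ambiguous r).
rewrite ambiguous_bigcap measure0 => H.
have {}H : (trim hmu \o ambiguous r) n @[n --> \oo] --> 0%E.
  apply: H => //.
  - by rewrite (le_lt_trans (probability_le1 _ _)) ?ltry //; exact: measurable_ambiguous.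
  - by move=> N; exact: measurable_ambiguous.
  - by move=> N M NM; rewrite subsetEset; exact: ambiguous_decr.
have /fine_cvgP[_ /cvgr_dist_le/(_ delta d0)] := H.
move=> [N _ /(_ N (leqnn N))] /=; rewrite sub0r normrN => HN.
exists N; rewrite -(trimE hmu); last exact: measurable_ambiguous.
exact: le_trans (ler_norm _) HN.
Qed.

End separating_bits.

(** Bits replace the distance colouring. Half of [delta] pays for the vertices whose balls the bits
    do not separate, where decoding [c] may differ from [F]; the other half pays for passing from
    [c] to [c']. *)
Lemma transfer_to_finite (m : nat -> nat) (adj : forall n, rel 'I_(m n).+1)
    (G : pregraphing R) D k r (delta : R) :
  (forall n, symmetric (adj n) /\ irreflexive (adj n)) ->
  (forall n (v : 'I_(m n).+1), (#|adj n v| <= D)%N) ->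
  is_graphing G -> local_global_conv (fun n => fin_graphing R (adj n)) G ->
  (1 <= r)%N -> 0 < delta ->
  \forall n \near \oo, forall F', @edge_map R k.+1 G F' ->
    exists2 F, edge_map (fin_graphing R (adj n)) F & forall S s a, (s <= r)%N ->
      `|Pr s (colour_class F S) a - Pr s (colour_class F' S) a| <= delta.
Proof.
move=> sadj HD HG lg r1 d0.
have [[g [gI [mrg [mg mig]]]] [hmu [mE [symE [_ [bE _]]]]]] := HG.
have sB : standard_Borel R (pg_carrier G) by exists g.
have mdiag := standard_Borel_diag sB.
have [f [mf Ef]] := standard_Borel_enumeration sB mE bE.
have [D' dG] := bounded_degree_le bE.
have d20 : 0 < delta / 2 by rewrite divr_gt0.
(* The radius is [r.+1] because the colours stored at a vertex of the [r]-ball refer to its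
   neighbours. *)
have [M HM] := ambiguous_small HG gI mg r.+1 d20.
pose U : finType := {ffun 'I_M -> bool}.
have [N HN] := @Pr_close R #|{: code_type U k}| (maxn D D') r.
have e0 : 0 < delta / 2 / N.+1%:R by rewrite divr_gt0.
have k1 : (1 <= #|{: code_type U k}|)%N.
  by apply/card_gt0P; exists ([ffun=> true], [ffun=> ord0]).
have := lg _ r k1 r1 _ e0; apply: filterS => n [_ lgn] F eF.
pose nb (x : pg_carrier G) (u : U) i := exists y, pg_E G (x, y) /\ bits g M y = u /\ F (x, y) = i.
(* Neighbours sharing the bits [u] may have edges of different colours; one of these colours is
   picked. *)
pose t (x : pg_carrier G) (u : U) : 'I_k.+1 := odflt ord0 [pick i | `[< nb x u i >] ].
pose col (x : pg_carrier G) : code_type U k := (bits g M x, [ffun u => t x u]).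
pose c (x : pg_carrier G) : 'I_#|{: code_type U k}| := enum_rank (col x).
have mc : borel_coloring G c.
  (* [col x] depends on finitely many predicates of [x]; the existential in [nb] becomes countable
     through the maps [f]. *)
  pose p (j : ('I_M + U * 'I_k.+1)%type) x := match j with
    | inl i => is_true (g x < ratr (odflt 0 (@choice.unpickle rat i)))
    | inr (u, i) => nb x u i end.
  have mp j : mpred (p j).
    case: j => [i|[u i]] /=; first exact: mpred_bit.
    apply: (@eq_mpred _ _ (fun x => exists j, (pg_E G `&` F @^-1` [set i]) (x, f j x) /\
        bits g M (f j x) = u)).
      move=> x; split=> [[j [[Ej Fj] bj]]|[y [Exy [by_ Fy]]]]; first by exists (f j x).
      by have [j yj] := Ef _ _ Exy; exists j; rewrite -yj.
    apply: mpred_exists => j; apply: mpredA.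
      apply: (@mpred_pre _ _ _ _ (fun x => (x, f j x))); first exact: measurable_fun_pair.
      exact: (proj2 eF).
    apply: (@mpred_pre _ _ _ _ (f j) [set x | bits g M x = u]) => //.
    exact: (mpred_bits mg (fun w => w = u)).
  pose h (v : {ffun ('I_M + U * 'I_k.+1)%type -> bool}) : code_type U k :=
    ([ffun i => v (inl i)], [ffun u => odflt ord0 [pick i | v (inr (u, i))]]).
  have colE x : col x = h [ffun j => `[< p j x >] ].
    congr pair; apply/ffunP => i; rewrite !ffunE ?asboolb //.
    by congr odflt; apply: eq_pick => j; rewrite ffunE.
  move=> i; rewrite -[measurable _]/(mpred _).
  apply: eq_mpred (borel_fiber (fun v => enum_rank (h v) = i) mp) => x.
  by rewrite -colE.
have FE x y z : ~ ambiguous g r.+1 M x -> within (pg_E G) r x y -> within (pg_E G) r x z ->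
    pg_E G (y, z) -> decode_edges c (y, z) = F (y, z).
  move=> nx.
  have tE u v : within (pg_E G) r x u -> within (pg_E G) r x v -> pg_E G (u, v) ->
      t u (bits g M v) = F (u, v).
    move=> xu xv uv; rewrite /t; case: pickP => [i /asboolP[w [uw [wv <-]]]|/(_ (F (u, v)))].
      congr (F (u, _)); apply: contrapT => wv'; apply: nx; exists w, v; split=> //.
      - by right; exists u.
      - by left.
    by move/asboolP => []; exists v.
  move=> xy xz yz; have zy := symE _ _ yz.
  rewrite /decode_edges /= !enum_rankK /edge_code /= !ffunE !tE //.
  by rewrite (proj1 eF z y) eqxx.
have [_ [c' [mc' ->]] Hc'] := lgn (Prc r G c) (ex_intro _ c (conj mc erefl)).
have HGn : is_graphing (fin_graphing R (adj n)).
  by apply: fin_graphing_graphing; case: (sadj n).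
exists (decode_edges c'); first exact: decode_edge_map.
move=> S s a sr.
pose P (u v : 'I_#|{: code_type U k}|) : Prop :=
  edge_code (enum_val u) (enum_val v) \in S.
have E1 : `|Pr s (colour_class (decode_edges c') S) a -
            Pr s (with_edges G (colour_edges c P)) a| <= delta / 2.
  apply: le_trans (HN _ _ c' c (delta / 2 / N.+1%:R) _ _ _ _ _ _ _ P _ a sr) _ => //.
  - exact: degree_leW (leq_maxl D D') (@fin_degree_le R _ _ _ (HD n)).
  - exact: degree_leW (leq_maxr D D') dG.
  - by rewrite mulrA ler_pdivrMr // mulrC ler_wpM2l ?ler_nat // ltW.
have mS1 : measurable (colour_edges c P).
  by apply: measurableI => //; exact: measurable_colour_rel.
have mS2 : measurable (pg_E G `&` [set e | F e \in S]) by exact: edge_map_subset.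
have E2 : `|Pr s (with_edges G (colour_edges c P)) a -
            Pr s (colour_class F S) a| <= delta / 2.
  have mb (W : set (pg_carrier G * pg_carrier G)) : measurable W -> W `<=` pg_E G ->
      measurable (has_ball W s a).
    by move=> mW WE; apply: (measurable_has_ball mdiag mW mf) => x y /WE/Ef.
  have m1 := mb _ mS1 (@subIsetl _ _ _); have m2 := mb _ mS2 (@subIsetl _ _ _).
  have m3 := measurable_ambiguous HG mg r.+1 M.
  rewrite !Pr_with_edges -(trimE hmu m1) -(trimE hmu m2).
  apply: le_trans HM; rewrite -(trimE hmu m3).
  apply: fine_prob_close => // x nx; apply: eq_has_ball => y z xy xz.
  have sub : colour_edges c P `|` (pg_E G `&` [set e | F e \in S]) `<=` pg_E G.
    by move=> e [[]|[]].
  have {}xy := within_mono sr (within_sub sub xy).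
  have {}xz := within_mono sr (within_sub sub xz).
  by split=> -[yz FS]; split=> //; move: FS; rewrite /= -(FE x y z).
rewrite (splitr delta); apply: le_trans (lerD E1 E2).
by rewrite -[X in `|X|](subrKA (Pr s (with_edges G (colour_edges c P)) a)) ler_normD.
Qed.

End transfer.

(** * Probability measures on the space of binary sequences *)

Definition cylinder (s : seq bool) : set (nat -> bool) :=
  [set w | mkseq w (size s) = s].

Definition cylinders : set (set (nat -> bool)) :=
  [set A | A = set0 \/ exists s, A = cylinder s].

Definition bitseqs := g_sigma_algebraType cylinders.

Lemma mkseq_eqP (w : nat -> bool) s :
  mkseq w (size s) = s <-> forall i, (i < size s)%N -> w i = nth false s i.
Proof.
split=> [ws i si|H]; first by rewrite -ws nth_mkseq.
by apply: (@eq_from_nth _ false); rewrite size_mkseq // => i si; rewrite nth_mkseq // H.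
Qed.

Lemma take_mkseq (w : nat -> bool) n m :
  (n <= m)%N -> take n (mkseq w m) = mkseq w n.
Proof. by move=> nm; rewrite /mkseq -map_take take_iota (minn_idPl nm). Qed.

Lemma cylinder_mkseq (w : nat -> bool) n : cylinder (mkseq w n) w.
Proof. by rewrite /cylinder /mkset size_mkseq. Qed.

Lemma cylinders_setI : setI_closed cylinders.
Proof.
have aux s t : (size s <= size t)%N -> cylinders (cylinder s `&` cylinder t).
  move=> st; have [sE|nsE] := pselect (take (size s) t = s).
    right; exists t; apply/seteqP; split=> [w []//|w wt]; split=> //=.
    by rewrite /cylinder /= -(take_mkseq w st) wt.
  left; rewrite -subset0 => w [/= ws wt]; apply: nsE.
  by have := take_mkseq w st; rewrite wt ws.
move=> A B [->|[s ->]]; first by rewrite set0I; left.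
move=> [->|[t ->]]; first by rewrite setI0; left.
have [st|/ltnW ts] := leqP (size s) (size t); first exact: aux.
by rewrite setIC; exact: aux.
Qed.

Lemma measurable_cylinder s : measurable (cylinder s : set bitseqs).
Proof. by apply: sub_sigma_algebra; right; exists s. Qed.

Lemma mpred_nth n : mpred (fun w : bitseqs => w n).
Proof.
apply: (@eq_mpred _ _ (fun w : bitseqs =>
    exists s, (size s = n.+1 /\ nth false s n) /\ cylinder s w)).
  move=> w; split=> [[s [[ss sn] /mkseq_eqP/(_ n)]]|wn].
    by rewrite ss ltnS leqnn sn => ->.
  exists (mkseq w n.+1); rewrite size_mkseq nth_mkseq //; split=> //.
  exact: cylinder_mkseq.
apply: mpred_exists => s; apply: mpredA; first exact: mpred_cst.
exact: measurable_cylinder.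
Qed.

Lemma mpred_mkseq n (Q : seq bool -> Prop) : mpred (fun w : bitseqs => Q (mkseq w n)).
Proof.
apply: (@eq_mpred _ _ (fun w : bitseqs =>
    exists s, (size s = n /\ Q s) /\ cylinder s w)).
  move=> w; split=> [[s [[<- Qs] ws]]|Qw]; first by rewrite ws.
  by exists (mkseq w n); rewrite size_mkseq; split=> //; exact: cylinder_mkseq.
apply: mpred_exists => s; apply: mpredA; first exact: mpred_cst.
exact: measurable_cylinder.
Qed.

Lemma measurable_to_bitseqs d (X : measurableType d) (psi : X -> bitseqs) :
  (forall n, mpred (fun x => psi x n)) -> measurable_fun setT psi.
Proof.
move=> mpsi; apply: (@measurability _ _ X bitseqs setT psi cylinders erefl).
move=> _ [A [->|[s ->]] <-]; first by rewrite preimage_set0 setI0.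
rewrite setTI -[measurable _]/(mpred _).
apply: (@eq_mpred _ _ (fun x => forall i : 'I_(size s), psi x i <-> nth false s i)).
  move=> x; split=> [H|/mkseq_eqP H i]; last by rewrite H.
  by apply/mkseq_eqP => i si; apply/idP/idP => /(H (Ordinal si)).
by apply: mpred_forall => i; apply: mpred_iff => //; exact: mpred_cst.
Qed.

Section ternary.
Variable R : realType.

Let shift (w : nat -> bool) := fun n => w n.+1.

(** Partial sums of the Cantor map, the sum of [2 * w i / 3 ^ (i + 1)]. Its middle gap makes
    comparison with [1 / 2] recover the first digit; base 2 would identify some sequences. *)
Let kap := fix kap n (w : nat -> bool) : R :=
  if n is n'.+1 then (2 * (w 0%N)%:R + kap n' (shift w)) / 3 else 0.

Let kap_ge0 n w : 0 <= kap n w.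
Proof.
by elim: n w => //= n IHn w; rewrite divr_ge0 // addr_ge0 // mulr_ge0.
Qed.

Let kap_le1 n w : kap n w <= 1.
Proof.
elim: n w => [|n IHn] w /=; first exact: ler01.
rewrite ler_pdivrMr // mul1r.
by move: (kap n (shift w)) (IHn (shift w)) => z; case: (w 0%N) => /=; lra.
Qed.

Let kapS n w : kap n w <= kap n.+1 w.
Proof.
elim: n w => [|n IHn] w; first exact: kap_ge0.
by rewrite /= ler_pM2r ?invr_gt0 // lerD2l; exact: IHn.
Qed.

Let kappa w : R := limn (kap ^~ w).

Let kappa_cvg w : kap n w @[n --> \oo] --> kappa w.
Proof.
apply: nondecreasing_is_cvgn.
  by apply/nondecreasing_seqP => n; exact: kapS.
by exists 1 => _ [n _ <-]; exact: kap_le1.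
Qed.

Let kappaE w : kappa w = (2 * (w 0%N)%:R + kappa (shift w)) / 3.
Proof.
have H : kap n.+1 w @[n --> \oo] --> kappa w.
  by have := @kappa_cvg w; rewrite -(cvg_shiftS (kap ^~ w)).
apply: (cvg_unique _ H) => //=.
apply: cvgMl; apply: cvgD; [exact: cvg_cst | exact: kappa_cvg].
Qed.

Let kappa_itv w : 0 <= kappa w <= 1.
Proof.
apply/andP; split.
  by apply: limr_ge; [exact: kappa_cvg | near=> n; exact: kap_ge0].
by apply: limr_le; [exact: kappa_cvg | near=> n; exact: kap_le1].
Unshelve. all: end_near. Qed.

(** Removing the leading ternary digit: on values of [kappa] one step is the shift of the
    sequence. *)
Let state (t : R) := fix state n := if n is n'.+1 then
  3 * state n' - (if 1 / 2 < state n' then 2 else 0) else t.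

Let digit (t : R) n : bool := 1 / 2 < state t n.

Let kappa_gt w : (1 / 2 < kappa w) = w 0%N.
Proof.
rewrite kappaE; have /andP[k0 k1] := kappa_itv (shift w).
by case: (w 0%N) => /=; apply/idP/idP => //; lra.
Qed.

Let state_kappa w n : state (kappa w) n = kappa (fun i => w (i + n)%N).
Proof.
elim: n => [|n IHn] /=; first by congr kappa; apply/funext => i; rewrite addn0.
rewrite IHn kappa_gt [kappa (fun i => w (i + n)%N)]kappaE.
have -> : shift (fun i => w (i + n)%N) = (fun i => w (i + n.+1)%N).
  by apply/funext => i; rewrite /shift addSnnS.
by case: (w (0 + n)%N) => /=; lra.
Qed.

Let digitK w : digit (kappa w) = w.
Proof. by apply/funext => n; rewrite /digit state_kappa kappa_gt add0n. Qed.

Let measurable_kap d (X : measurableType d) n (psi : X -> nat -> bool) :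
  (forall i, mpred (fun x => psi x i)) -> measurable_fun setT (fun x => kap n (psi x)).
Proof.
elim: n psi => [|n IHn] psi mpsi /=; first exact: measurable_cst.
apply: measurable_funM; last exact: measurable_cst.
apply: measurable_funD; last by apply: (IHn (shift \o psi)) => i; exact: mpsi.
apply: measurable_funM; first exact: measurable_cst.
rewrite (_ : (fun x => _) = (fun x => if psi x 0%N then 1 else 0 : R)); last first.
  by apply/funext => x; case: (psi x 0%N).
apply: measurable_fun_ifT; [|exact: measurable_cst|exact: measurable_cst].
by apply: (measurable_fun_bool true); rewrite setTI; exact: mpsi.
Qed.

Let measurable_kappa : measurable_fun setT (kappa : bitseqs -> R).
Proof.
apply: (@measurable_fun_cvg _ bitseqs R setT (fun n (w : bitseqs) => kap n w) kappa)
  => [n|w _].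
  by apply: (@measurable_kap _ bitseqs n (fun w => w)) => i; exact: mpred_nth.
exact: kappa_cvg.
Qed.

Let measurable_state n : measurable_fun setT (state ^~ n).
Proof.
elim: n => [|n IHn] /=; first exact: measurable_id.
apply: measurable_funB.
  by apply: measurable_funM => //; exact: measurable_cst.
apply: measurable_fun_ifT; [|exact: measurable_cst|exact: measurable_cst].
apply: (measurable_fun_bool true); rewrite setTI.
have := @mpred_pre _ _ _ _ (state ^~ n) `](1 / 2), +oo[%classic IHn (measurable_itv _).
by apply: eq_mpred => t; rewrite /= in_itv /= andbT.
Qed.

Let measurable_digit : measurable_fun setT (digit : R -> bitseqs).
Proof.
apply: measurable_to_bitseqs => n.
have := @mpred_pre _ _ _ _ (state ^~ n) `](1 / 2), +oo[%classic
  (@measurable_state n) (measurable_itv _).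
by apply: eq_mpred => t; rewrite /= in_itv /= andbT.
Qed.

(** The Borel left inverse [digit] turns the image of a Borel set into a preimage, cut down to the
    Borel set where [kappa (digit t) = t]. *)
Lemma bitseqs_standard_Borel : standard_Borel R bitseqs.
Proof.
have mi (A : set bitseqs) : measurable A -> measurable (kappa @` A).
  move=> mA.
  have -> : kappa @` A = [set t | kappa (digit t) = t] `&` digit @^-1` A.
    apply/seteqP; split=> [_ [w Aw <-]|t [/= tE At]]; last by exists (digit t).
    by split; rewrite /= digitK.
  apply: measurableI.
    have -> : [set t | kappa (digit t) = t] =
        (fun t => kappa (digit t) - t) @^-1` [set 0].
      apply/seteqP; split=> t /=; first by move=> ->; rewrite subrr.
      by move=> /eqP; rewrite subr_eq0 => /eqP.
    rewrite -[X in measurable X]setTI; apply: measurable_funB => //.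
    exact: (@measurableT_comp _ _ _ _ bitseqs _ kappa _ digit measurable_kappa measurable_digit).
  by rewrite -[X in measurable X]setTI; exact: measurable_digit.
exists kappa; split; first exact: (can_inj digitK).
split; first exact: mi.
by split.
Qed.

End ternary.

Section tree_probability.
Context (R : realType) (p : seq bool -> R).
Hypotheses (p_nil : p [::] = 1) (p_ge0 : forall s, 0 <= p s)
  (p_split : forall s, p s = p (rcons s false) + p (rcons s true)).

(* [path u n] is the node of depth [n] whose interval contains [u], with the
   left end of that interval. *)
Let path (u : R) := fix path n : seq bool * R := if n is n'.+1 then
  let b := (path n').2 + p (rcons (path n').1 false) <= u in
  (rcons (path n').1 b,
   if b then (path n').2 + p (rcons (path n').1 false) else (path n').2)
  else ([::], 0).

(** All bits are false outside [[0, 1[], a part of the line on which no mass will be placed. *)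
Let om u n : bool := (0 <= u < 1) && ((path u n).2 + p (rcons (path u n).1 false) <= u).

Let mkseq_om u n : 0 <= u < 1 -> mkseq (om u) n = (path u n).1.
Proof.
by move=> u01; elim: n => // n IHn; rewrite mkseqS IHn /= /om u01.
Qed.

Let path_itv s : exists a, [/\ 0 <= a, a + p s <= 1 & forall u, 0 <= u < 1 ->
  ((path u (size s)).1 = s <-> a <= u < a + p s) /\
  ((path u (size s)).1 = s -> (path u (size s)).2 = a)].
Proof.
elim/last_ind: s => [|s b [a [a0 a1 Ha]]].
  by exists 0; rewrite add0r p_nil; split=> // u u01; split=> //=; split.
have p0 := p_ge0 (rcons s false); have p1 := p_ge0 (rcons s true).
have ps := p_split s.
exists (if b then a + p (rcons s false) else a); split.
- by case: b => //; rewrite addr_ge0.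
- by case: b; lra.
move=> u u01; have [H1 H2] := Ha u u01; rewrite size_rcons.
have stepE : (path u (size s).+1).1 = rcons s b <->
    (path u (size s)).1 = s /\ b = (a + p (rcons s false) <= u).
  rewrite /=; split=> [/rcons_inj[sE <-]|[sE ->]]; first by rewrite (H2 sE) sE.
  by rewrite (H2 sE) sE.
split.
  rewrite stepE H1; case: b {stepE}; split.
  - by move=> [/andP[? ?] /esym ?]; apply/andP; split; lra.
  - move=> /andP[? ?]; split; first by apply/andP; split; lra.
    by apply/esym/idP; lra.
  - by move=> [/andP[? ?] /esym/negbT]; rewrite -ltNge => ?; apply/andP; split; lra.
  - move=> /andP[? ?]; split; first by apply/andP; split; lra.
    by apply/esym/negbTE; rewrite -ltNge; lra.
by move=> /stepE[sE ->] /=; rewrite (H2 sE) sE.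
Qed.

Let mom : measurable_fun setT (om : R -> bitseqs).
Proof.
apply: measurable_to_bitseqs => n.
have mi (i : interval R) : mpred (fun u : R => u \in i) by exact: measurable_itv.
have /choice[A HA] := path_itv.
apply: (@eq_mpred _ _ (fun u : R => (u \in `[0, 1[) /\ exists s : seq bool, size s = n /\
    ((u \in `[A s, A s + p s[) /\ (u \in `[A s + p (rcons s false), +oo[)))).
  move=> u; rewrite /om in_itv /=; split.
    move=> [u01 [s [ss]]]; rewrite !in_itv /= andbT => -[us uf].
    have [_ _ /(_ u u01)[/iffRL/(_ us) sE /(_ _)]] := HA s.
    by rewrite ss in sE * => /(_ sE) ->; rewrite u01 sE.
  move=> /andP[u01 uf]; split=> //; exists (path u n).1.
  have sz : size (path u n).1 = n by rewrite -(mkseq_om n u01) size_mkseq.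
  have [_ _ /(_ u u01)] := HA (path u n).1; rewrite sz => -[H1 H2].
  by split=> //; rewrite !in_itv /= andbT; split; [exact/H1 | rewrite -H2].
apply: mpredA; first exact: mi.
apply: mpred_exists => s; apply: mpredA; first exact: mpred_cst.
by apply: mpredA; exact: mi.
Qed.

(** Push forward Lebesgue measure on [[0, 1[]: the node [s] owns a half-open interval of length
    [p s], divided between its children, and [om] reads the nodes containing a point. *)
Lemma tree_probability : exists mu : set bitseqs -> \bar R,
  is_probability_measure mu /\ forall s, mu (cylinder s) = (p s)%:E.
Proof.
pose mu (A : set bitseqs) : \bar R := lebesgue_measure (om @^-1` A `&` `[0, 1[%classic).
have mpre (A : set bitseqs) : measurable A -> measurable (om @^-1` A `&` `[0, 1[%classic).
  move=> mA; apply: measurableI; last exact: measurable_itv.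
  by rewrite -[X in measurable X]setTI; exact: mom.
have mucyl s : mu (cylinder s) = (p s)%:E.
  have [a [a0 a1 Ha]] := path_itv s.
  rewrite /mu (_ : _ `&` _ = `[a, a + p s[%classic).
    rewrite lebesgue_measure_itv /= lte_fin; case: ltrP => [_|].
      by rewrite -EFinB addrC addKr.
    by have := p_ge0 s => ? ?; congr EFin; lra.
  apply/seteqP; split=> [u [/= us]|u /=]; rewrite !in_itv /=.
    by move=> u01; apply/(proj1 (Ha u u01)); rewrite -mkseq_om.
  move=> us; have u01 : 0 <= u < 1 by move/andP: us => [? ?]; apply/andP; split; lra.
  by split=> //; rewrite /cylinder /= mkseq_om //; apply/(proj1 (Ha u u01)).
exists mu; split=> //; split; first by rewrite /mu preimage_set0 set0I measure0.
split; first by move=> A _; exact: measure_ge0.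
split; last first.
  have -> : [set: bitseqs] = cylinder [::] by apply/seteqP; split.
  by rewrite mucyl p_nil.
move=> F mF tF mUF; rewrite /mu preimage_bigcup setI_bigcupl.
apply: measure_semi_sigma_additive.
- by move=> n; exact: mpre.
- by move=> i j _ _ [u [[Fi _] [Fj _]]]; apply: tF => //; exists (om u).
- by rewrite -setI_bigcupl -preimage_bigcup; exact: mpre.
Qed.

End tree_probability.

(** By Tychonoff the sequence has a cluster point [q]; [f j] is an index past [j] that is close to
    [q] on the coordinates with code below [j]. Monotonicity of [f] is not claimed. *)
Lemma diagonal_subsequence (R : realType) (I : countType) (u : nat -> I -> R) :
  (forall n i, 0 <= u n i <= 1) ->
  exists (q : I -> R) (f : nat -> nat), (forall j, (j <= f j)%N) /\
    forall i, u (f j) i @[j --> \oo] --> q i.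
Proof.
move=> u01.
pose X := prod_topology (fun _ : I => R).
pose A (_ : I) := `[0 : R, 1]%classic.
have cA : compact ([set f | forall i, A i (f i)] : set X).
  by apply: (@tychonoff I (fun=> R)) => i; exact: segment_compact.
have [|q [_ clq]] := cA ((u n : X) @[n --> \oo]) _.
  by exists 0%N => // n _ i; rewrite /A /= in_itv /=; exact: u01.
have near_q (J : seq I) (e : R) N : 0 < e ->
    exists n, (N <= n)%N /\ forall i, i \in J -> `|u n i - q i| < e.
  move=> e0.
  have : nbhs (q : X) [set x : X | forall i, i \in J -> `|x i - q i| < e].
    elim: J => [|i J IHJ]; first exact: filterE.
    have Hi : nbhs (q : X) [set x : X | `|x i - q i| < e].
      have := @proj_continuous I (fun=> R) i q [set y | `|y - q i| < e].
      apply; apply/nbhs_ballP; exists e => //= y.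
      by rewrite /ball /= distrC.
    apply: filterS2 IHJ Hi => x H1 H2 k; rewrite inE => /predU1P[->//|]; exact: H1.
  move=> /(clq [set x | exists2 n, (N <= n)%N & x = u n]).
  case; first by exists N => // n Nn; exists n.
  by move=> _ [[n Nn ->] H]; exists n.
have /choice[f Hf] : forall j : nat, exists n, (j <= n)%N /\
    forall i : I, (choice.pickle i < j)%N -> `|u n i - q i| < j.+1%:R^-1.
  move=> j; pose J := pmap (@choice.unpickle I) (iota 0 j).
  have [|n [jn Hn]] := near_q J j.+1%:R^-1 j; first by rewrite invr_gt0.
  exists n; split=> // i ij; apply: Hn; rewrite mem_pmap -(choice.pickleK i).
  by apply: map_f; rewrite mem_iota.
exists q, f; split=> [j|i]; first by have [] := Hf j.
apply/cvgrPdist_lt => e e0.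
have [N Ne] := natSinv_lt e0.
exists (maxn N (choice.pickle i).+1) => // j /=; rewrite geq_max => /andP[Nj ij].
rewrite distrC; apply: le_lt_trans Ne; apply/ltW.
apply: lt_le_trans (proj2 (Hf j) i ij) _.
by rewrite lef_pV2 ?posrE // ler_nat ltnS.
Qed.

(** * Coding finite graphs by binary sequences *)

(** Words of length [r] reach the whole ball, but an edge is tested by comparing some [u] with
    [p :: w], whence [r.+1]. *)
Lemma word_ball_transfer (T T' A : Type) (t : A -> T -> T) (t' : A -> T' -> T')
    (E : set (T * T)) (E' : set (T' * T')) r a x x' :
  (forall w y, E (foldr t x w, y) <->
     foldr t x w <> y /\ exists p, y = t p (foldr t x w)) ->
  (forall w y, E' (foldr t' x' w, y) <->
     foldr t' x' w <> y /\ exists p, y = t' p (foldr t' x' w)) ->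
  (forall w w', (size w <= r.+1)%N -> (size w' <= r.+1)%N ->
     (foldr t x w = foldr t x w' <-> foldr t' x' w = foldr t' x' w')) ->
  has_ball E r a x <-> has_ball E' r a x'.
Proof.
move=> HE HE' Hw.
have reach (U : Type) (h : A -> U -> U) (F : set (U * U)) z :
    (forall w y, F (foldr h z w, y) -> exists p, y = h p (foldr h z w)) ->
    forall s y, within F s z y -> exists w, (size w <= s)%N /\ y = foldr h z w.
  move=> HF; elim=> [|s IHs] y /=; first by move=> <-; exists [::].
  move=> [/IHs[w [ws ->]]|[v [/IHs[w [ws ->]] /HF[p ->]]]].
    by exists w; rewrite leqW.
  by exists (p :: w).
apply: (@ball_transfer_iff _ _ _ _ _ _ _
  (fun y y' => exists w, [/\ (size w <= r)%N, y = foldr t x w & y' = foldr t' x' w])).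
- move=> y /(reach _ t); case; first by move=> w z /HE[].
  by move=> w [wr ->]; exists (foldr t' x' w), w.
- move=> y /(reach _ t'); case; first by move=> w z /HE'[].
  by move=> w [wr ->]; exists (foldr t x w), w.
- by move=> _ _ _ _ [w [ws -> ->]] [u [us -> ->]]; apply: Hw; exact: leqW.
- by exists [::].
- move=> _ _ _ _ [w [ws -> ->]] [u [us -> ->]]; rewrite HE HE'.
  have wu := Hw w u (leqW ws) (leqW us).
  split=> -[nwu [p up]]; (split; first by move=> /wu); exists p.
    by apply/(Hw u (p :: w)) => //; exact: leqW.
  by apply/(Hw u (p :: w)) => //; exact: leqW.
Qed.

(** * Partial involutions from a distance colouring, and codes of vertices *)

Section moves.
Context (R : realType) (m K : nat) (adj : rel 'I_m.+1) (c : 'I_m.+1 -> 'I_K).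
Let E := pg_E (fin_graphing R adj).
Hypotheses (sadj : symmetric adj) (iadj : irreflexive adj)
  (Hc : forall x y : 'I_m.+1, x <> y -> within E 2 x y -> c x <> c y).

(* The involution exchanging the ends of the edges whose end colours are [p.1]
   and [p.2]. *)
Definition move (p : 'I_K * 'I_K) (v : 'I_m.+1) : 'I_m.+1 :=
  if (p.1 < p.2)%N then
    if c v == p.1 then odflt v [pick y | adj v y & c y == p.2]
    else if c v == p.2 then odflt v [pick y | adj v y & c y == p.1]
    else v
  else v.

Let E1 x y : adj x y -> within E 1 x y.
Proof. by move=> xy; exact: (@within_edge _ E). Qed.

Let nbU v y z : adj v y -> adj v z -> c y = c z -> y = z.
Proof.
move=> vy vz cyz; apply: contrapT => yz; apply: (Hc yz) => //.
by apply: (within_trans (E1 _) (E1 vz)); rewrite sadj.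
Qed.

Let nbC v y : adj v y -> c v != c y.
Proof.
move=> vy; apply/eqP; apply: Hc; last exact: (@within_mono _ _ 1 2) (E1 vy).
by move=> e; move: vy; rewrite e iadj.
Qed.

Lemma move_of_edge v y : adj v y ->
  ((c v < c y)%N -> move (c v, c y) v = y) /\ ((c y < c v)%N -> move (c y, c v) v = y).
Proof.
move=> vy; rewrite /move /=; split=> -> ; rewrite ?(negbTE (nbC vy)) eqxx.
  case: pickP => [z /andP[vz /eqP zy]|/(_ y)]; last by rewrite vy eqxx.
  by rewrite /= (nbU vz vy zy).
case: pickP => [z /andP[vz /eqP zy]|/(_ y)]; last by rewrite vy eqxx.
by rewrite /= (nbU vz vy zy).
Qed.

Lemma move_edge p v : move p v = v \/ adj v (move p v) /\
  ((p = (c v, c (move p v)) /\ (c v < c (move p v))%N) \/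
   (p = (c (move p v), c v) /\ (c (move p v) < c v)%N)).
Proof.
case: p => a b; rewrite /move /=; case: ifP => ab; last by left.
case: eqP => [va|_]; last first.
  case: eqP => [vb|_]; last by left.
  case: pickP => [y /andP[vy /eqP ya]|_]; last by left.
  by right; split=> //=; right; rewrite vb ya.
case: pickP => [y /andP[vy /eqP yb]|_]; last by left.
by right; split=> //=; left; rewrite va yb.
Qed.

Lemma moveK p : involutive (move p).
Proof.
move=> v; have [e|[]] := move_edge p v; first by rewrite !e.
set y := move p v => vy; have yv : adj y v by rewrite sadj.
have [H1 H2] := move_of_edge yv.
by move=> [[-> vlt]|[-> ylt]]; [exact: H2 | exact: H1].
Qed.

(** A move that does not fix [v] has the colours of both ends, in increasing order, as its index. *)
Lemma move_uniq p q v : move p v = move q v -> move p v <> v -> p = q.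
Proof.
move=> pq nv; have [//|[_]] := move_edge p v.
have [|[_]] := move_edge q v; first by rewrite -pq.
rewrite -pq; move: (move p v) => y [[-> h1]|[-> h1]] [[-> h2]|[-> h2]] //.
  by move: h1; rewrite ltnNge ltnW.
by move: h1; rewrite ltnNge ltnW.
Qed.

Lemma adj_move v y : adj v y <-> v <> y /\ exists p, y = move p v.
Proof.
split=> [vy|[vy [p yp]]].
  split; first by move=> e; move: vy; rewrite e iadj.
  have [H1 H2] := move_of_edge vy; have [lt|lt|/val_inj e] := ltngtP (c v) (c y).
  - by exists (c v, c y); rewrite H1.
  - by exists (c y, c v); rewrite H2.
  - by have := nbC vy; rewrite e eqxx.
by have [e|[]] := move_edge p v; [case: vy; rewrite yp e | rewrite -yp].
Qed.

Lemma within_moves w v : within E (size w) v (foldr move v w).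
Proof.
elim: w => //= p w IHw; have [->|[vy _]] := move_edge p (foldr move v w).
  by left.
by right; exists (foldr move v w).
Qed.

End moves.

(* Bit [(w, r, k)] of the code of a vertex [v] tells whether the vertex reached
   from [v] by the word [w] of moves has colour [k] in the [r]-th colouring. *)
Section codes.
Variable K : nat.
Let A := ('I_K * 'I_K)%type.
Let B := (seq A * nat * nat)%type.

Definition bit_index (b : B) : nat := choice.pickle b.

Definition bit_of_index (n : nat) : option B := choice.unpickle n.

Lemma bit_indexK b : bit_of_index (bit_index b) = Some b.
Proof. exact: choice.pickleK. Qed.

(** [foldr] applies the last letter first, so moving the root by [p] appends [p] to the words. *)
Definition shift_code (p : A) (w : nat -> bool) : nat -> bool :=
  fun n => if bit_of_index n is Some (u, r, k) then w (bit_index (rcons u p, r, k))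
           else false.

Lemma shift_codes_bit v w u r k :
  foldr shift_code w v (bit_index (u, r, k)) = w (bit_index (u ++ v, r, k)).
Proof.
elim: v u => [|p v IHv] u; first by rewrite cats0.
by rewrite /= {1}/shift_code bit_indexK IHv cat_rcons.
Qed.

Definition agree N (w w' : nat -> bool) := forall i, (i < N)%N -> w i = w' i.

Lemma agreeW N M w w' : (N <= M)%N -> agree M w w' -> agree N w w'.
Proof. by move=> NM H i iN; apply: H; exact: leq_trans NM. Qed.

Lemma shift_codes_local v i : exists N, forall w w', agree N w w' ->
  foldr shift_code w v i = foldr shift_code w' v i.
Proof.
elim: v i => [|p v IHv] i /=; first by exists i.+1 => w w'; apply.
rewrite /shift_code; case: bit_of_index => [[[u r] k]|]; last by exists 0%N.
exact: IHv.
Qed.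

Lemma shift_codes_local_seq v n : exists N, forall w w', agree N w w' ->
  agree n (foldr shift_code w v) (foldr shift_code w' v).
Proof.
have /choice[N HN] := shift_codes_local v.
have [M HM] := seq_bound N (iota 0 n).
exists M => w w' ww' i si; apply: HN; apply: agreeW ww'; apply: HM.
by rewrite mem_iota.
Qed.

Section code.
Context (m : nat) (mv : A -> 'I_m.+1 -> 'I_m.+1) (lab : nat -> 'I_m.+1 -> nat).

Definition vertex_code (v : 'I_m.+1) : nat -> bool := fun n =>
  if bit_of_index n is Some (w, r, k) then lab r (foldr mv v w) == k else false.

Lemma vertex_code_move p v : vertex_code (mv p v) = shift_code p (vertex_code v).
Proof.
apply/funext => n; rewrite /vertex_code /shift_code.
by case: bit_of_index => [[[u r] k]|//]; rewrite bit_indexK -cats1 foldr_cat.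
Qed.

Lemma vertex_code_moves w v : vertex_code (foldr mv v w) = foldr shift_code (vertex_code v) w.
Proof. by elim: w => //= p w <-; rewrite vertex_code_move. Qed.

Lemma vertex_code_bit v w r k : vertex_code v (bit_index (w, r, k)) = (lab r (foldr mv v w) == k).
Proof. by rewrite /vertex_code bit_indexK. Qed.

End code.
End codes.

(** * Graphing limits of finite graphs *)

Section limit.
Context (R : realType) (D : nat) (m : nat -> nat) (adj : forall l, rel 'I_(m l).+1)
  (col : forall l r, 'I_(m l).+1 -> 'I_(D.+1 ^ r).+1).
Arguments adj : clear implicits.
Arguments col : clear implicits.
Let E l := pg_E (fin_graphing R (adj l)).
Arguments E : clear implicits.
Hypotheses (sadj : forall l, symmetric (adj l)) (iadj : forall l, irreflexive (adj l))
  (Hcol : forall l r (x y : 'I_(m l).+1), x <> y -> within (E l) r x y ->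
            col l r x <> col l r y).

Let K := (D.+1 ^ 2).+1.
Let A := ('I_K * 'I_K)%type.
Let mv l : A -> 'I_(m l).+1 -> 'I_(m l).+1 := move (adj l) (col l 2).
Arguments mv : clear implicits.
Let lab l r (v : 'I_(m l).+1) : nat := col l r v.
Arguments lab : clear implicits.
Let cd l (v : 'I_(m l).+1) : nat -> bool := vertex_code (mv l) (lab l) v.
Arguments cd : clear implicits.
Let sh (p : A) := shift_code p.

(** The two ends are at distance at most [r], so the [r]-th colouring tells them apart; this is why
    all radii are stored. *)
Let moves_eq l r w w' v : (size w + size w' <= r)%N ->
  lab l r (foldr (mv l) v w) = lab l r (foldr (mv l) v w') ->
  foldr (mv l) v w = foldr (mv l) v w'.
Proof.
move=> wr lw; apply: contrapT => nw; apply: (Hcol nw (r := r)); last exact: val_inj.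
apply: (@within_mono _ _ (size w' + size w)); first by rewrite addnC.
have sE (x y : fvert (m l)) : E l (x, y) -> E l (y, x) by rewrite /E /= sadj.
have wm u : within (E l) (size u) v (foldr (mv l) v u) by exact: within_moves.
exact: within_trans (within_sym sE (wm w)) (wm w').
Qed.

Let mvK l p v : mv l p (mv l p v) = v.
Proof. by apply: (@moveK R _ _ (adj l)) => //; exact: Hcol. Qed.

(* The closure of the set of codes of vertices. *)
Definition good (w : nat -> bool) := forall n, exists l v, agree n w (cd l v).

Let good_shift p w : good w -> good (sh p w).
Proof.
move=> gw n; have [N HN] := shift_codes_local_seq [:: p] n.
have [l [v wv]] := gw N; exists l, (mv l p v) => i ni.
by rewrite /cd vertex_code_move; exact: HN wv i ni.
Qed.

Let good_shifts w v : good w -> good (foldr sh w v).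
Proof. by move=> gw; elim: v => //= p v; exact: good_shift. Qed.

Let good_code l v : good (cd l v).
Proof. by move=> n; exists l, v. Qed.

(** Each bit of either side depends on finitely many bits of [w], so the identity passes from vertex
    codes to their closure. *)
Let shiftK p w : good w -> sh p (sh p w) = w.
Proof.
move=> gw; apply/funext => i; have [N HN] := shift_codes_local [:: p; p] i.
have [l [v wv]] := gw (maxn N i.+1).
rewrite -[LHS]/(foldr sh w [:: p; p] i) (HN _ (cd l v)); last exact: agreeW (leq_maxl _ _) wv.
rewrite -(vertex_code_moves (mv l) (lab l)) /= mvK -/(cd l v).
by rewrite wv // leq_maxr.
Qed.

(** The bits compared are finite in number, hence shared with the code of an actual vertex, where
    equal colours mean equal ends by [moves_eq]. *)
Let words_eq w r u u' : good w -> (size u + size u' <= r)%N ->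
  (forall k, (k < (D.+1 ^ r).+1)%N -> w (bit_index (u, r, k)) = w (bit_index (u', r, k))) ->
  foldr sh w u = foldr sh w u'.
Proof.
move=> gw ur wk; apply/funext => i.
have [N HN] := shift_codes_local u i; have [N' HN'] := shift_codes_local u' i.
have [M HM] := seq_bound (fun k => bit_index (u, r, k)) (iota 0 (D.+1 ^ r).+1).
have [M' HM'] := seq_bound (fun k => bit_index (u', r, k)) (iota 0 (D.+1 ^ r).+1).
have [l [v wv]] := gw (maxn (maxn N N') (maxn M M').+1).
have a1 : agree N w (cd l v).
  by apply: agreeW wv; rewrite !leq_max leqnn.
have a2 : agree N' w (cd l v).
  by apply: agreeW wv; rewrite !leq_max leqnn orbT.
rewrite (HN _ _ a1) (HN' _ _ a2) -!(vertex_code_moves (mv l) (lab l)).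
rewrite (@moves_eq l r u u' v) //; apply/eqP; rewrite eq_sym -vertex_code_bit -/(cd l v).
have kK : (lab l r (foldr (mv l) v u) < (D.+1 ^ r).+1)%N by exact: ltn_ord.
rewrite -wv; last first.
  by rewrite leq_max; apply/orP; right; rewrite ltnS leq_max HM' ?mem_iota ?orbT.
rewrite -wk // wv; last first.
  by rewrite leq_max; apply/orP; right; rewrite ltnS leq_max HM ?mem_iota.
by rewrite /cd vertex_code_bit.
Qed.

(** A bit where [sh p w] differs from [w] certifies that the approximating vertex is really moved,
    so that [move_uniq] applies to it. *)
Let shift_uniq p q w : good w -> sh p w = sh q w -> sh p w <> w -> p = q.
Proof.
move=> gw pq pw.
have [i ni] : exists i, sh p w i <> w i.
  apply: contrapT => H; apply: pw; apply/funext => i; apply: contrapT => ?; apply: H.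
  by exists i.
have [N HN] := shift_codes_local [:: p] i.
have [M HM] := seq_bound (fun k => bit_index ([:: p], 2, k)%N) (iota 0 (D.+1 ^ 2).+1).
have [M' HM'] := seq_bound (fun k => bit_index ([:: q], 2, k)%N) (iota 0 (D.+1 ^ 2).+1).
have [l [v wv]] := gw (maxn (maxn N i.+1) (maxn M M').+1).
have bE k : (k < (D.+1 ^ 2).+1)%N ->
    cd l v (bit_index ([:: p], 2, k)%N) = cd l v (bit_index ([:: q], 2, k)%N).
  move=> kK; rewrite -!wv; last 2 first.
  - by rewrite leq_max; apply/orP; right; rewrite ltnS leq_max HM' ?mem_iota ?orbT.
  - by rewrite leq_max; apply/orP; right; rewrite ltnS leq_max HM ?mem_iota.
  by rewrite -!(@shift_codes_bit _ _ w [::]) /= -/(sh p w) -/(sh q w) pq.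
have mpq : mv l p v = mv l q v.
  apply: (@moves_eq l 2 [:: p] [:: q] v) => //.
  apply/eqP; rewrite eq_sym -vertex_code_bit -/(cd l v) -bE; last exact: ltn_ord.
  by rewrite /cd vertex_code_bit.
apply: (move_uniq mpq) => mpv.
apply: ni; rewrite -[sh p w i]/(foldr sh w [:: p] i) (HN _ (cd l v)); last first.
  by apply: agreeW wv; rewrite !leq_max leqnn.
rewrite -(vertex_code_moves (mv l) (lab l)) /= [mv l p v]mpv -/(cd l v) wv //.
by rewrite !leq_max leqnn orbT.
Qed.

(** Shifts are involutions on good sequences; elsewhere the identity is used, so that [t i] is an
    involution everywhere. *)
Let t (i : nat) (w : bitseqs) : bitseqs :=
  if @pickle_inv A i is Some p then if `[< good w >] then sh p w else w else w.

Let EH : set (bitseqs * bitseqs) := [set e | e.1 <> e.2 /\ exists i, e.2 = t i e.1].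

Let EH_good w y : good w -> EH (w, y) <-> w <> y /\ exists p, y = sh p w.
Proof.
move=> gw; split=> -[/= wy [i yi]]; split=> //.
  move: yi; rewrite /t; case: pickle_inv => [p|e]; last by case: wy.
  by rewrite asboolT //; exists p.
by exists (choice.pickle i); rewrite /t pickleK_inv asboolT.
Qed.

(** Unrelated vertices may share a code, but ends of words from one root do not, as a colouring of
    large radius separates them. *)
Let ball_code l v r a : has_ball (E l) r a v <-> has_ball EH r a (cd l v : bitseqs).
Proof.
apply: (@word_ball_transfer _ _ A (mv l) sh).
- by move=> w y; apply: (@adj_move R _ _ (adj l)) => //; exact: Hcol.
- by move=> w y; apply: EH_good; exact: good_shifts.
- move=> w w' _ _; rewrite -!(vertex_code_moves (mv l) (lab l)).
  split=> [-> //|ww']; apply: (@moves_eq l (size w + size w')) => //.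
  apply/eqP; rewrite -[X in X == _]/(lab l _ (foldr (mv l) (foldr (mv l) v w) [::])).
  by rewrite -vertex_code_bit ww' vertex_code_bit.
Qed.

Let ball_agree r : exists N, forall w w' a, good w -> good w' -> agree N w w' ->
  has_ball EH r a (w : bitseqs) <-> has_ball EH r a (w' : bitseqs).
Proof.
(* Two words of length at most [r.+1] are compared, so their ends are at distance at most [r0]. *)
pose r0 := (r.+1 + r.+1)%N.
pose words := flatten [seq [seq tval x | x : j.-tuple A] | j <- iota 0 r.+2].
have wordsP (w : seq A) : (size w <= r.+1)%N -> w \in words.
  move=> sw; apply/flattenP; exists [seq tval x | x : (size w).-tuple A].
    by apply/mapP; exists (size w) => //; rewrite mem_iota.
  by apply/mapP; exists (in_tuple w) => //; rewrite mem_enum.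
have [N HN] := seq_bound (fun wk => bit_index (wk.1, r0, wk.2))
  [seq (w, k) | w <- words, k <- iota 0 (D.+1 ^ r0).+1].
exists N.+1 => w w' a gw gw' ww'.
have bE (u : seq A) k : (size u <= r.+1)%N -> (k < (D.+1 ^ r0).+1)%N ->
    w (bit_index (u, r0, k)) = w' (bit_index (u, r0, k)).
  move=> su kk; apply: ww'; rewrite ltnS; apply: (HN (u, k)).
  by apply: allpairs_f; [exact: wordsP | rewrite mem_iota].
apply: (@word_ball_transfer _ _ A sh sh).
- by move=> u y; apply: EH_good; exact: good_shifts.
- by move=> u y; apply: EH_good; exact: good_shifts.
- have sb (x : nat -> bool) (z : seq A) k :
      x (bit_index (z, r0, k)) = foldr sh x z (@bit_index K ([::], r0, k)).
    exact/esym/(@shift_codes_bit K z x [::]).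
  move=> u u' su su'; split=> uu'; (apply: (@words_eq _ r0) => //; first exact: leq_add).
    by move=> k kk; rewrite -!bE // (sb w u) (sb w u') uu'.
  by move=> k kk; rewrite !bE // (sb w' u) (sb w' u') uu'.
Qed.

Let freq l (W : pred (seq bool)) N : R :=
  #|[set v : 'I_(m l).+1 | W (mkseq (cd l v) N)]%SET|%:R / (m l).+1%:R.

Context (mu : set bitseqs -> \bar R) (q : seq bool -> R) (f : nat -> nat).
Hypotheses (hmu : is_probability_measure mu)
  (muq : forall s, mu (cylinder s) = (q s)%:E)
  (fq : forall s, freq (f j) (pred1 s) (size s) @[j --> \oo] --> q s).

Let tup N (w : nat -> bool) : N.-tuple bool := Tuple (introT eqP (size_mkseq w N)).

Let freq_sum l W N : freq l W N =
  \sum_(i < #|{: N.-tuple bool}| | W (tval (enum_val i))) freq l (pred1 (tval (enum_val i))) N.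
Proof.
rewrite /freq -mulr_suml -natr_sum; congr (_%:R / _).
rewrite -sum1_card (partition_big (fun v => enum_rank (tup N (cd l v)))
  (fun i => W (tval (enum_val i)))) /=; last first.
  by move=> v; rewrite inE enum_rankK.
apply: eq_bigr => i Wi; rewrite -[RHS]sum1_card; apply: eq_bigl => v; rewrite !inE /=.
apply/andP/eqP => [[_ /eqP <-]|vi]; first by rewrite enum_rankK.
by rewrite vi; split=> //; apply/eqP; apply: enum_val_inj; rewrite enum_rankK; exact: val_inj.
Qed.

Let mu_sum (W : pred (seq bool)) N : fine (mu [set w | W (mkseq w N)]) =
  \sum_(i < #|{: N.-tuple bool}| | W (tval (enum_val i))) q (tval (enum_val i)).
Proof.
pose X (i : 'I_#|{: N.-tuple bool}|) : set bitseqs := cylinder (tval (enum_val i)).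
have AE : [set w : bitseqs | W (mkseq w N)] =
    \big[setU/set0]_(i < #|{: N.-tuple bool}| | W (tval (enum_val i))) X i.
  rewrite -bigcup_seq_cond; apply/seteqP; split=> [w /= Ww|w [i /andP[_ Wi]]]; last first.
    by rewrite /X /cylinder /= size_tuple => ->.
  exists (enum_rank (tup N w)); first by rewrite /= mem_index_enum enum_rankK.
  by rewrite /X enum_rankK; exact: cylinder_mkseq.
have PA := @measure_bigsetU_ord_cond _ _ _ (trim hmu) _
  (fun i : 'I_#|{: N.-tuple bool}| => W (tval (enum_val i))) X
  (fun i _ => measurable_cylinder _).
have mA : measurable [set w : bitseqs | W (mkseq w N)] by exact: (mpred_mkseq N (fun s => W s)).
rewrite -(trimE hmu mA) AE PA.
  rewrite -sum_fine; last by move=> i _; apply: fin_num_measure; exact: measurable_cylinder.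
  apply: eq_bigr => i _; rewrite -[RHS]/(fine (q (tval (enum_val i)))%:E) -muq; congr fine.
  exact: trimE (measurable_cylinder _).
move=> i j _ _ [w [/= wi wj]]; apply: enum_val_inj; apply: val_inj => /=.
by move: wi wj; rewrite /X /cylinder /= !size_tuple => -> ->.
Qed.

Let freq_cvg (W : pred (seq bool)) N :
  freq (f j) W N @[j --> \oo] --> fine (mu [set w | W (mkseq w N)]).
Proof.
rewrite mu_sum (_ : (fun j => _) = (fun j => \sum_(i < #|{: N.-tuple bool}| |
    W (tval (enum_val i))) freq (f j) (pred1 (tval (enum_val i))) N)); last first.
  by apply/funext => j; rewrite freq_sum.
apply: cvg_big => [|i _]; first exact: add_continuous.
have := @fq (tval (enum_val i)); rewrite size_tuple; exact.
Qed.

Let mkseq_agree N w w' : mkseq w N = mkseq w' N <-> agree N w w'.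
Proof.
split=> [e i iN|H]; last first.
  apply: (@eq_from_nth _ false); rewrite !size_mkseq // => i iN.
  by rewrite !nth_mkseq // H.
by rewrite -(nth_mkseq false w iN) e nth_mkseq.
Qed.

Let mgood : mpred (good : bitseqs -> Prop).
Proof.
apply: mpred_forall => n.
apply: (@eq_mpred _ _ (fun w : bitseqs => (fun s => exists l v, s = mkseq (cd l v) n) (mkseq w n))).
  by move=> w; split=> -[l [v /mkseq_agree]]; exists l, v => //; apply/mkseq_agree.
exact: (mpred_mkseq n (fun s => exists l v, s = mkseq (cd l v) n)).
Qed.

(** A prefix that no code has occurs with frequency 0 in every graph, hence in the limit; a sequence
    that is not good has such a prefix. *)
Let mu_good : mu (~` [set w | good w]) = 0%E.
Proof.
have mC : measurable (~` [set w : bitseqs | good w]) by exact: (mpredN mgood).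
rewrite -(trimE hmu mC).
pose F n : set bitseqs := [set w | ~~ `[< exists l v, mkseq w n = mkseq (cd l v) n >] ].
have mF n : measurable (F n).
  exact: (mpred_mkseq n (fun s => ~~ `[< exists l v, s = mkseq (cd l v) n >])).
have F0 n : trim hmu (F n) = 0%E.
  have := @freq_cvg (fun s => ~~ `[< exists l v, s = mkseq (cd l v) n >]) n.
  rewrite (_ : (fun j => _) = cst 0); last first.
    apply/funext => j; rewrite /freq (_ : [set v | _]%SET = finset.set0) ?cards0 ?mul0r //.
    apply/setP => v; rewrite !inE; apply/negbF/asboolP.
    by exists (f j), v.
  move=> /(cvg_unique _ (@cvg_cst _ _ _ _ _)) H.
  rewrite -(fineK (fin_num_measure (trim hmu) _ (mF n))); congr EFin.
  by rewrite [RHS](H (@Rhausdorff R)); congr fine; exact: trimE.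
apply: (@measure_negligible _ _ _ (trim hmu)) => //.
have -> : ~` [set w : bitseqs | good w] = \bigcup_n F n.
  apply/seteqP; split=> [w /= /existsNP[n ng]|w [n _ /asboolPn ng] gw].
    exists n => //; apply/asboolPn => -[l [v /mkseq_agree wv]]; apply: ng.
    by exists l, v.
  by apply: ng; have [l [v /mkseq_agree wv]] := gw n; exists l, v.
by apply: negligible_bigcup => n; exists (F n); split=> //; exact: F0.
Qed.

Let mu_eq (X Y : set bitseqs) : measurable X -> measurable Y ->
  (forall w, good w -> (X w <-> Y w)) -> mu X = mu Y.
Proof.
move=> mX mY XY; rewrite -(trimE hmu mX) -(trimE hmu mY).
have mC : measurable (~` [set w : bitseqs | good w]) by exact: (mpredN mgood).
have XY' w : ~ (~` [set w : bitseqs | good w]) w -> (X w <-> Y w).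
  by move=> /contrapT; exact: XY.
have H : `|fine (trim hmu X) - fine (trim hmu Y)| <=
    fine (trim hmu (~` [set w : bitseqs | good w])) := fine_prob_close (trim hmu) mX mY mC XY'.
move: H; rewrite (trimE hmu mC) mu_good normr_le0 subr_eq0 => /eqP H.
rewrite -(fineK (fin_num_measure (trim hmu) _ mX)) -(fineK (fin_num_measure (trim hmu) _ mY)).
by congr EFin.
Qed.

Let mt i : measurable_fun setT (t i).
Proof.
apply: measurable_to_bitseqs => n; rewrite /t.
case: pickle_inv => [p|]; last exact: mpred_nth.
apply: (@eq_mpred _ _ (fun w : bitseqs =>
    (good w /\ sh p w n) \/ (~ good w /\ w n))).
  move=> w; case: asboolP => gw; split=> //; try tauto.
apply: mpredO; apply: mpredA => //; last exact: mpred_nth.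
  rewrite /sh /shift_code; case: bit_of_index => [[[u r] k]|]; first exact: mpred_nth.
  exact: mpred_cst.
exact: mpredN.
Qed.

(** In each finite graph a move permutes the vertices, so a cylinder and its preimage have the same
    frequency. The limit gives equality on cylinders, which determine the measure. *)
Let mu_t i (X : set bitseqs) : measurable X -> mu (t i @^-1` X) = mu X.
Proof.
have mpre (Y : set bitseqs) : measurable Y -> measurable (t i @^-1` Y).
  by move=> mY; rewrite -[Z in measurable Z]setTI; exact: mt.
have hmu2 : is_probability_measure (fun Y => mu (t i @^-1` Y)).
  have [h0 [h1 [h2 h3]]] := hmu; split; first by rewrite preimage_set0.
  split; first by move=> Y mY; apply: h1; exact: mpre.
  split; last by rewrite preimage_setT.
  move=> F mF tF mUF; rewrite preimage_bigcup; apply: h2.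
  - by move=> n; exact: mpre.
  - by move=> n k _ _ [w [Fn Fk]]; apply: tF => //; exists (t i w).
  - by rewrite -preimage_bigcup; exact: mpre.
suff cylE s : mu (t i @^-1` cylinder s) = mu (cylinder s).
  have G0 (_ : nat) : cylinders setT by right; exists [::]; apply/seteqP; split.
  have GT : \bigcup_(_ : nat) setT = [set: bitseqs] by rewrite bigcup_const.
  have GE Y : cylinders Y -> trim hmu2 Y = trim hmu Y.
    move=> [->|[s ->]]; first by rewrite !trimE //; case: hmu2 => -> _; case: hmu.
    by rewrite !trimE //; exact: measurable_cylinder.
  have Goo (_ : nat) : (trim hmu2 setT < +oo)%E.
    by rewrite (le_lt_trans (probability_le1 _ _)) ?ltry.
  move=> mX; rewrite -(trimE hmu mX).
  apply: (etrans (esym (trimE hmu2 mX))).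
  exact: (@measure_unique _ R bitseqs cylinders (fun=> setT) erefl cylinders_setI G0 GT
    (trim hmu2) (trim hmu) GE Goo X mX).
case ip: (@pickle_inv A i) => [p|]; last first.
  by congr mu; apply/seteqP; split=> w; rewrite /preimage /= /t ip.
have tE w : good w -> t i w = sh p w by move=> gw; rewrite /t ip asboolT.
have [N HN] := shift_codes_local_seq [:: p] (size s).
pose W (x : seq bool) := mkseq (sh p (nth false x)) (size s) == s.
have WE w : W (mkseq w N) = (mkseq (sh p w) (size s) == s).
  congr (_ == _); apply/mkseq_agree; apply: (HN (nth false (mkseq w N)) w) => j jN.
  by rewrite nth_mkseq.
have mW : measurable [set w : bitseqs | W (mkseq w N)] by exact: (mpred_mkseq N (fun s => W s)).
have -> : mu (t i @^-1` cylinder s) = mu [set w | W (mkseq w N)].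
  apply: mu_eq => //; first by apply: mpre; exact: measurable_cylinder.
  by move=> w gw /=; rewrite /cylinder /= tE // WE; split=> /eqP.
have freqE l : freq l W N = freq l (pred1 s) (size s).
  rewrite /freq -[in RHS](card_preimset _ (can_inj (mvK (l := l) p))).
  congr (_%:R / _); apply: eq_card => v.
  by rewrite !inE WE /= /cd vertex_code_move.
have := @freq_cvg W N; rewrite (_ : (fun j => _) = (fun j => freq (f j) (pred1 s) (size s))).
  move=> /(cvg_unique _ (@fq s)) qW.
  rewrite muq qW // -(trimE hmu mW) fineK //; exact: fin_num_measure.
by apply/funext => j; exact: freqE.
Qed.

Definition limit_graphing : pregraphing R := @PreGraphing R _ bitseqs mu EH.

Lemma limit_graphing_graphing : is_graphing limit_graphing.
Proof.
have pC i p : @pickle_inv A i = Some p -> choice.pickle p = i.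
  by move=> ip; have := @pickle_invK A i; rewrite ip.
pose C := (\max_(p : A) choice.pickle p).+1%N.
apply: (@involution_graphing R limit_graphing C t) => //.
- exact: bitseqs_standard_Borel.
- move=> i w; rewrite /t; case: pickle_inv => // p.
  case: (asboolP (good w)) => gw; last by rewrite asboolF.
  by rewrite asboolT ?shiftK //; exact: good_shift.
- move=> i w; rewrite /t; case ip: pickle_inv => [p|//].
  have iC := @leq_bigmax A (fun p : A => choice.pickle p) p.
  by rewrite (pC _ _ ip) in iC; move=> /leq_trans/(_ iC); rewrite ltnn.
- move=> i j w; rewrite /t; case: (asboolP (good w)) => gw; last by case: pickle_inv.
  case ip: (pickle_inv i) => [p|//]; case jq: (pickle_inv j) => [p'|]; last by move=> ->.
  by move=> pp /(shift_uniq gw pp) e; rewrite -(pC _ _ ip) -(pC _ _ jq) e.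
Qed.

(** On good sequences the ball event depends on the first [N] bits only, so up to a null set it is a
    finite union of cylinders, whose frequencies converge. *)
Lemma limit_graphing_cvg : local_conv (fun j => fin_graphing R (adj (f j))) limit_graphing.
Proof.
move=> r a _ _; have [N HN] := ball_agree r.
have [sB [_ [mE [_ [_ [bE _]]]]]] := limit_graphing_graphing.
have [g [mg Eg]] := standard_Borel_enumeration sB mE bE.
have mb : measurable (has_ball EH r a).
  exact: (measurable_has_ball (standard_Borel_diag sB) mE mg Eg).
pose W (x : seq bool) :=
  `[< exists w, [/\ good w, mkseq w N = x & has_ball EH r a (w : bitseqs)] >].
have WE w : good w -> W (mkseq w N) <-> has_ball EH r a (w : bitseqs).
  move=> gw; split=> [/asboolP[w' [gw' /mkseq_agree ww']]|hw]; first by move/(HN _ _ _ gw' gw ww').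
  by apply/asboolP; exists w.
have -> : Pr r limit_graphing a = fine (mu [set w | W (mkseq w N)]).
  congr fine; apply: mu_eq => //; first exact: (mpred_mkseq N (fun s => W s)).
  by move=> w gw; rewrite /= WE.
rewrite (_ : (fun j => _) = (fun j => freq (f j) W N)); first exact: freq_cvg.
apply/funext => j; rewrite /Pr /= /freq; congr (_%:R / _).
rewrite cardE; apply: card_fset_set_seq; first exact: enum_uniq.
move=> v; rewrite mem_enum inE -/(has_ball _ r a v).
by rewrite (WE _ (good_code _)) -ball_code.
Qed.

End limit.

Lemma finite_graphs_sequentially_compact (R : realType) (D : nat) (m : nat -> nat)
    (adj : forall l, rel 'I_(m l).+1) :
  (forall l, symmetric (adj l)) -> (forall l, irreflexive (adj l)) ->
  (forall l (v : 'I_(m l).+1), (#|adj l v| <= D)%N) ->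
  exists f : nat -> nat, (forall j, (j <= f j)%N) /\
    exists2 H : pregraphing R, is_graphing H &
      local_conv (fun j => fin_graphing R (adj (f j))) H.
Proof.
move=> sadj iadj HD.
pose col l r := sval (cid (distance_colouring R r (sadj l) (HD l))).
have Hcol l r (x y : 'I_(m l).+1) : x <> y ->
    within (pg_E (fin_graphing R (adj l))) r x y -> col l r x <> col l r y.
  exact: (svalP (cid (distance_colouring R r (sadj l) (HD l)))).
pose cd l (v : 'I_(m l).+1) : nat -> bool :=
  vertex_code (move (adj l) (col l 2)) (fun r v => col l r v : nat) v.
pose u l (s : seq bool) : R :=
  #|[set v : 'I_(m l).+1 | pred1 s (mkseq (cd l v) (size s))]%SET|%:R / (m l).+1%:R.
have u01 l s : 0 <= u l s <= 1.
  rewrite /u divr_ge0 //= ler_pdivrMr ?ltr0n // mul1r ler_nat.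
  by rewrite -[X in (_ <= X)%N](card_ord (m l).+1) max_card.
have [q [f [jf fq]]] := diagonal_subsequence u01.
have [mu [hmu muq]] : exists mu : set bitseqs -> \bar R,
    is_probability_measure mu /\ forall s, mu (cylinder s) = (q s)%:E.
  apply: tree_probability.
  - apply: (cvg_unique _ (fq [::])) => //=.
    rewrite (_ : (fun j => _) = cst 1); first exact: cvg_cst.
    apply/funext => j; rewrite /u /= (_ : [set v | _]%SET = [set: 'I_(m (f j)).+1]%SET).
      by rewrite cardsT card_ord divff // pnatr_eq0.
    by apply/setP => v; rewrite !inE.
  - move=> s; rewrite -(cvg_lim (@Rhausdorff R) (fq s)); apply: limr_ge.
      exact: cvgP (fq s).
    by apply: nearW => j; case/andP: (u01 (f j) s).
  - move=> s; apply: (cvg_unique _ (fq s)) => //=.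
    rewrite (_ : (fun j => _) = (fun j => u (f j) (rcons s false) + u (f j) (rcons s true))).
      by apply: cvgD; exact: fq.
    apply/funext => j; rewrite /u -mulrDl -natrD; congr (_%:R / _).
    rewrite -cardsUI [X in (_ = _ + X)%N](_ : _ = 0)%N ?addn0.
      apply: eq_card => v; rewrite !inE /= !size_rcons mkseqS !eqseq_rcons.
      by case: (cd _ v (size s)); rewrite !eqE /= ?andbT ?andbF ?orbF.
    apply/eqP; rewrite cards_eq0; apply/eqP/setP => v.
    rewrite !inE /= !size_rcons mkseqS !eqseq_rcons.
    by case: (cd _ v (size s)); rewrite !eqE /= ?andbF.
exists f; split=> //.
exists (limit_graphing adj col mu); first exact: limit_graphing_graphing hmu muq fq.
exact: limit_graphing_cvg hmu muq fq.
Qed.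

(** * Uniform continuity *)

(** Compactness is used on the finite side only: the arbitrary graphings [B] inherit the limit of
    their finite partners. A single [l] controls radius and precision, so a failure for every [l] is
    one sequence of counterexamples. *)
Lemma local_continuous_uniform (R : realType) (f : pregraphing R -> R) (D : nat) (eps : R) :
  local_continuous f -> 0 < eps ->
  exists l, forall m (adj : rel 'I_m.+1) (B : pregraphing R),
    symmetric adj -> irreflexive adj -> (forall v, (#|adj v| <= D)%N) -> is_graphing B ->
    (forall s a, (s <= l.+1)%N ->
       `|Pr s (fin_graphing R adj) a - Pr s B a| <= l.+1%:R^-1) ->
    `|f (fin_graphing R adj) - f B| <= eps.
Proof.
move=> fC e0; apply: contrapT => /forallNP nl.
have /choice[x Hx] : forall l, exists x : {m : nat & rel 'I_m.+1} * pregraphing R,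
    [/\ symmetric (projT2 x.1) /\ irreflexive (projT2 x.1),
        (forall v, (#|projT2 x.1 v| <= D)%N), is_graphing x.2,
        (forall s a, (s <= l.+1)%N ->
           `|Pr s (fin_graphing R (projT2 x.1)) a - Pr s x.2 a| <= l.+1%:R^-1) &
        ~ (`|f (fin_graphing R (projT2 x.1)) - f x.2| <= eps)].
  move=> l; apply: contrapT => nx; apply: (nl l) => m adj B sa ia dB gB AB.
  by apply: contrapT => nAB; apply: nx; exists (existT _ m adj, B).
pose m l := projT1 (x l).1; pose adj l : rel 'I_(m l).+1 := projT2 (x l).1.
pose A l := fin_graphing R (adj l); pose B l := (x l).2.
have sadj l : symmetric (adj l) by have [[]] := Hx l.
have iadj l : irreflexive (adj l) by have [[]] := Hx l.
have dadj l v : (#|adj l v| <= D)%N by have [_ /(_ v)] := Hx l.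
have gB l : is_graphing (B l) by have [] := Hx l.
have AB l s a : (s <= l.+1)%N -> `|Pr s (A l) a - Pr s (B l) a| <= l.+1%:R^-1.
  by have [_ _ _ H _] := Hx l; exact: H.
have fAB l : ~ (`|f (A l) - f (B l)| <= eps) by have [] := Hx l.
have [g [jg [H gH AH]]] := finite_graphs_sequentially_compact R sadj iadj dadj.
have BH : local_conv (fun j => B (g j)) H.
  move=> r a r1 ra; have := AH r a r1 ra; move=> /cvgrPdist_lt cA.
  apply/cvgrPdist_lt => d d0; have d2 : 0 < d / 2 by rewrite divr_gt0.
  have [N Nd] := natSinv_lt d2.
  have rN : \forall j \near \oo, (maxn N r <= j)%N by exists (maxn N r).
  apply: filterS2 (cA _ d2) rN => j Aj; rewrite geq_max => /andP[Nj rj].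
  have gj := jg j.
  have Bj : `|Pr r (A (g j)) a - Pr r (B (g j)) a| < d / 2.
    apply: le_lt_trans (AB _ _ _ _) _; first by rewrite ltnW // ltnS (leq_trans rj).
    apply: le_lt_trans Nd; rewrite lef_pV2 ?posrE // ler_nat ltnS.
    exact: leq_trans gj.
  rewrite (splitr d); apply: le_lt_trans (ltrD Aj Bj).
  by rewrite (le_trans _ (ler_normD _ _)) // addrA subrK.
have fA : f (A (g j)) @[j --> \oo] --> f H.
  by apply: fC => // j; exact: fin_graphing_graphing.
have fB : f (B (g j)) @[j --> \oo] --> f H by exact: fC.
have fAB0 : f (A (g j)) - f (B (g j)) @[j --> \oo] --> f H - f H by exact: cvgB.
have /cvgrPdist_le/(_ eps e0)[j _ /(_ j (leqnn _))] := fAB0.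
by rewrite subrr sub0r normrN; exact: fAB.
Qed.

Lemma fin_colour_class (R : realType) m (adj : rel 'I_m.+1) D k
    (F : fvert m * fvert m -> 'I_k) (S : {set 'I_k}) :
  symmetric adj -> irreflexive adj -> (forall v, (#|adj v| <= D)%N) ->
  (forall x y, F (x, y) = F (y, x)) ->
  exists adj' : rel 'I_m.+1, [/\ symmetric adj', irreflexive adj',
    forall v, (#|adj' v| <= D)%N &
    @colour_class R (fin_graphing R adj) k F S = fin_graphing R adj'].
Proof.
move=> sadj iadj HD sF; exists (fun x y => adj x y && (F (x, y) \in S)); split.
- by move=> x y; rewrite sadj sF.
- by move=> x; rewrite iadj.
- by move=> v; apply: leq_trans (HD v); apply: subset_leq_card; apply/fintype.subsetP => y /andP[].
- rewrite /colour_class /with_edges /fin_graphing /=; congr PreGraphing.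
  by apply/seteqP; split=> [[x y] [/= -> ->]//|[x y] /= /andP[]].
Qed.

Unset Implicit Arguments.

Theorem theorem3p2 (R : realType) (D : nat) (m : nat -> nat)
    (adj : forall n : nat, rel 'I_(m n).+1)
    (G : pregraphing R) (f : pregraphing R -> R) :
  (0 < D)%N ->
  (forall n, symmetric (adj n) /\ irreflexive (adj n)) ->
  (forall n (v : 'I_(m n).+1), (#|adj n v| <= D)%N) ->
  is_graphing G ->
  local_global_conv (fun n => fin_graphing R (adj n)) G ->
  local_continuous f ->
  quotient_conv f (fun n => fin_graphing R (adj n)) G.
Proof.
move=> _ sadj HD HG lg fC [//|k] _ eps e0.
(* Colour classes of finite graphs keep the bound [D], so one [l] serves all [n], all edge
   colourings and all [S]. *)
have [l Hl] := local_continuous_uniform D fC e0.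
have l0 : 0 < l.+1%:R^-1 :> R by rewrite invr_gt0.
have close n F F' (S : {set 'I_k.+1}) : edge_map (fin_graphing R (adj n)) F -> edge_map G F' ->
    (forall S s a, (s <= l.+1)%N ->
       `|Pr s (colour_class F S) a - Pr s (colour_class F' S) a| <= l.+1%:R^-1) ->
    `|f (colour_class F S) - f (colour_class F' S)| <= eps.
  move=> eF eF' FF'; have [sn iN] := sadj n.
  have := FF' S; have [adj' [s' i' d' ->]] := fin_colour_class R S sn iN (HD n) (proj1 eF).
  by move=> AB; apply: Hl => //; exact: colour_class_graphing.
apply: filterS2 (transfer_from_finite k sadj HD HG lg (ltn0Sn l) l0)
  (transfer_to_finite k sadj HD HG lg (ltn0Sn l) l0) => n fromF toF.
split=> [_ [F [eF ->]]|_ [F' [eF' ->]]].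
  have [F' eF' FF'] := fromF F eF.
  exists (fun S => f (colour_class F' S)); first by exists F'.
  by move=> S; exact: close.
have [F eF FF'] := toF F' eF'.
exists (fun S => f (colour_class F S)); first by exists F.
by move=> S; exact: close.
Qed.
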